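(* Let $1\le l\le m$ be integers, and let $\frac1{p(x)}=\frac1{p_1(x)}+\cdots+\frac1{p_m(x)}$ with $p_i(\cdot)\in\mathcal{P}_{\log}(\mathbb{R}^n)$ and $1<(p_i)_-\le(p_i)_+<\infty$ for $1\le i\le m$. Let $u=\prod_{i=1}^mu_i$ with $u_i\in\mathbb{W}^0_{L^{p_i(\cdot)}(\mathbb{R}^n)}$, $1\le i\le m$. Suppose that $\vec b=(b_1,\dots,b_l)\in\mathrm{BMO}^l$ and that the iterated commutator $\mathcal{T}_{\vec b}$ (acting in the first $l$ variables) of an $m$-linear operator $\mathcal{T}$ satisfies the pointwise sparse domination hypothesis. If $p(\cdot)\in\mathcal{P}_{\log}(\mathbb{R}^n)$ with $1<p_-\le p_+<\infty$ and $u\in\mathbb{W}^0_{L^{p(\cdot)}(\mathbb{R}^n)}$, then $$\|\mathcal{T}_{\vec b}(\vec f)\|_{M^u_{L^{p(\cdot)}(\mathbb{R}^n)}}\le C\|\vec b\|_{\mathrm{BMO}}\,\|M\|^{2+l}_{\mathfrak{B}_{L^{p'(\cdot)},u}}\,\|\mathscr{M}\|_{M^{u_1}_{L^{p_1(\cdot)}(\mathbb{R}^n)}\times\cdots\times M^{u_m}_{L^{p_m(\cdot)}(\mathbb{R}^n)}\to M^u_{L^{p(\cdot)}(\mathbb{R}^n)}}\prod_{i=1}^m\|M\|_{M^{u_i}_{L^{p_i(\cdot)}(\mathbb{R}^n)}\to M^{u_i}_{L^{p_i(\cdot)}(\mathbb{R}^n)}}\|f_i\|_{M^{u_i}_{L^{p_i(\cdot)}(\mathbb{R}^n)}},$$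 with $C$ independent of $\vec f$ and $\vec b$.
   Context: Notation. $Q$ denotes cubes in $\mathbb{R}^n$, $\langle f\rangle_Q=\frac1{|Q|}\int_Q f$, $B(x,r)$ is the open ball. $\|b\|_{\mathrm{BMO}}=\sup_Q\frac1{|Q|}\int_Q|b-\langle b\rangle_Q|$ and $\|\vec b\|_{\mathrm{BMO}}=\prod_i\|b_i\|_{\mathrm{BMO}}$. Sparse families. For a cube $Q_0$, $\mathcal{D}(Q_0)$ is the collection of dyadic subcubes of $Q_0$. A dyadic lattice $\mathscr{D}$ is a collection of cubes such that (i) $Q\in\mathscr{D}$ implies $\mathcal{D}(Q)\subset\mathscr{D}$; (ii) any $Q',Q''\in\mathscr{D}$ lie in $\mathcal{D}(Q)$ for some $Q\in\mathscr{D}$; (iii) every compact set is contained in some $Q\in\mathscr{D}$. A family $\mathcal{S}\subset\mathscr{D}$ is $\eta$-sparse ($0<\eta<1$) if $|\bigcup_{Q'\in\mathcal{S},Q'\subsetneq Q}Q'|\le(1-\eta)|Q|$ for all $Q\in\mathcal{S}$; ''sparse'' means $\eta$-sparse for a fixed $\eta\in(0,1)$ not depending on the functions. Iterated commutator and sparse domination hypothesis. For an $m$-linear operator $\mathcal{T}$ with kernel representation $\mathcal{T}(\vec f)(x)=\int_{\mathbb{R}^{nm}}K(x,\vec y)\prod_{s=1}^m f_s(y_s)\,d\vec y$, $$\mathcal{T}_{\vec b}(\vec f)(x)=\int_{\mathbb{R}^{nm}}\prod_{s=1}^l(b_s(x)-b_s(y_s))K(x,\vec y)\prod_{s=1}^m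 f_s(y_s)\,d\vec y;$$ in general $\mathcal{T}_{\vec b}=[b_1,\cdots[b_l,\mathcal{T}]_l\cdots]_1$ with $[b_s,\mathcal{T}]_s(\vec f)=b_s\mathcal{T}(\vec f)-\mathcal{T}(f_1,\dots,b_sf_s,\dots,f_m)$. Put $\mathcal{T}(b,f,Q,1)=|b-\langle b\rangle_Q|\langle|f|\rangle_Q$ (a function of $x$) and $\mathcal{T}(b,f,Q,2)=\langle|(b-\langle b\rangle_Q)f|\rangle_Q$. The pointwise sparse domination hypothesis: there is $C$ such that for all bounded compactly supported $f_1,\dots,f_m$ there exist $3^n$ sparse collections $\mathcal{S}_1,\dots,\mathcal{S}_{3^n}$ with, for a.e. $x$, $$|\mathcal{T}_{\vec b}(\vec f)(x)|\le C\sum_{j=1}^{3^n}\sum_{\vec\gamma\in\{1,2\}^l}\sum_{Q\in\mathcal{S}_j}\Big(\prod_{s=1}^l\mathcal{T}(b_s,f_s,Q,\gamma_s)\Big)\Big(\prod_{s=l+1}^m\langle|f_s|\rangle_Q\Big)\chi_Q(x).$$ Maximal operators. $Mf(x)=\sup_{Q\ni x}\langle|f|\rangle_Q$ and $\mathscr{M}(\vec f)(x)=\sup\prod_{i=1}^m\frac1{|Q|}\int_Q|f_i|$, supremum over balls $Q\ni x$ (using cubes instead changes $\mathscr{M}$ only by a constant factor). Variable exponents. $\mathcal{P}(\mathbb{R}^n)$ is the set of measurable $p(\cdot):\mathbb{R}^n\to[1,\infty]$; $p_-$, $p_+$ are the essential infimum and supremum; $\frac1{p(x)}+\frac1{p'(x)}=1$.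 $\rho_p(f)=\int_{\{p<\infty\}}|f(x)|^{p(x)}dx+\|f\|_{L^\infty(\{p=\infty\})}$, $\|f\|_{L^{p(\cdot)}(\mathbb{R}^n)}=\inf\{\lambda>0:\rho_p(f/\lambda)\le1\}$. A function $\alpha:\mathbb{R}^n\to\mathbb{R}$ is globally log-Hölder continuous if there are $C_1,C_2>0$ and $\alpha_\infty\in\mathbb{R}$ with $|\alpha(x)-\alpha(y)|\le\frac{C_1}{\log(e+1/|x-y|)}$ and $|\alpha(x)-\alpha_\infty|\le\frac{C_2}{\log(e+|x|)}$ for all $x,y$. $\mathcal{P}_{\log}(\mathbb{R}^n)$ is the set of $p(\cdot)\in\mathcal{P}(\mathbb{R}^n)$ with $1/p(\cdot)$ globally log-Hölder continuous. Morrey and block spaces. For a Banach function space $X$ and measurable $u:\mathbb{R}^n\times(0,\infty)\to(0,\infty)$, $\|f\|_{M_X^u}=\sup_{x\in\mathbb{R}^n,r>0}\frac1{u(x,r)}\|f\chi_{B(x,r)}\|_X$. An $(X,u)$-block is a measurable function supported in some $B(x_0,r)$ with $X$-norm at most $1/u(x_0,r)$; $\mathfrak{B}_{X,u}$ is the set of $\sum_k\lambda_kg_k$ with $g_k$ $(X,u)$-blocks and $\sum|\lambda_k|<\infty$, with norm $\inf\sum|\lambda_k|$ over such representations. $\|M\|_{\mathfrak{B}_{X,u}}$ is the operator norm of $M$ on $\mathfrak{B}_{X,u}$; $\|S\|_{A\to B}$ denotes operator norm. $u\in\mathbb{W}_X^0$ means $u$ is measurable and there is $C>0$ such that for all $x,x_1,x_2\in\mathbb{R}^n$,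 $r,r_1,r_2>0$: (1) $\frac{\|\chi_{B(x_1,r_1)}\|_X}{u(x_1,r_1)}\le C\frac{\|\chi_{B(x_2,r_2)}\|_X}{u(x_2,r_2)}$ whenever $u(x_1,r_1)\le u(x_2,r_2)$; (2) $\sum_{j=0}^\infty\frac{\|\chi_{B(x,r)}\|_X}{\|\chi_{B(x,2^{j+1}r)}\|_X}u(x,2^{j+1}r)\le Cu(x,r)$.
   Formalization: The estimate is stated for bounded, compactly supported f_1,…,f_m, the class on which the sparse domination hypothesis controls the iterated commutator; for an abstract m-linear operator and arbitrary f_i in the Morrey spaces the inequality can fail. *)

(* Defs.v *)
From HB Require Import structures.
From mathcomp Require Import all_boot all_order all_algebra.
From mathcomp Require Import all_classical all_reals all_analysis.
From mathcomp Require Import measurable_realfun ess_sup_inf.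

Set Implicit Arguments.
Unset Strict Implicit.
Unset Printing Implicit Defensive.

Import Order.TTheory GRing.Theory Num.Theory.
Import numFieldNormedType.Exports.

Local Open Scope classical_set_scope.
Local Open Scope ring_scope.

(** * Lebesgue measure on R^n = 'rV[R]_n

   The library has no Lebesgue measure in dimension n.  It is built here as
   usual: the outer measure generated by the volume of half-open boxes, then
   its restriction to the Caratheodory-measurable sets.  In particular
   "measurable" below means Lebesgue (not just Borel) measurable. *)

Section LebesgueMeasure.
Context {R : realType} {n : nat}.

Definition box (a b : 'rV[R]_n) : set 'rV[R]_n :=
  [set x | forall i, a ord0 i <= x ord0 i < b ord0 i].

Definition boxes : set (set 'rV[R]_n) := [set A | exists a b : 'rV[R]_n, A = box a b].

(* 0 on set0, the usual volume on a box, +oo (infimum of the empty set) on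
   every other set; hence the sets that are not boxes play no role in the
   covers used by [mu_ext] below. *)
Definition box_volume (A : set 'rV[R]_n) : \bar R :=
  ereal_inf [set v | (A = set0 /\ v = 0%E) \/
    exists a b : 'rV[R]_n, [/\ forall i, a ord0 i <= b ord0 i, A = box a b &
                    v = (\prod_i (b ord0 i - a ord0 i))%:E]].

Lemma box_volume_ge0 A : (0 <= box_volume A)%E.
Proof.
apply: le_ereal_inf_tmp => v [[_ ->]//|[a [b [ab _ ->]]]].
by rewrite lee_fin prodr_ge0// => i _; rewrite subr_ge0.
Qed.

Lemma box_volume0 : box_volume set0 = 0%E.
Proof.
apply/eqP; rewrite eq_le box_volume_ge0 andbT.
by apply: ereal_inf_lbound; left.
Qed.

Definition lebesgue_outer : set 'rV[R]_n -> \bar R :=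
  @mu_ext _ (g_sigma_algebraType boxes) R box_volume.

Let boxT := g_sigma_algebraType boxes.

HB.instance Definition _ := isOuterMeasure.Build R 'rV[R]_n lebesgue_outer
  (@mu_ext0 _ boxT R _ box_volume0 box_volume_ge0)
  (@mu_ext_ge0 _ boxT R _ box_volume_ge0)
  (@le_mu_ext _ boxT R box_volume)
  (@mu_ext_sigma_subadditive _ boxT R _ box_volume_ge0).

End LebesgueMeasure.

HB.instance Definition _ (R : realType) (n : nat) :=
  isMeasurable.Build (caratheodory_display (@lebesgue_outer R n)) 'rV[R]_n
    (@caratheodory_measurable_set0 R _ (@lebesgue_outer R n))
    (@caratheodory_measurable_setC R _ (@lebesgue_outer R n))
    (@caratheodory_measurable_bigcup R _ (@lebesgue_outer R n)).

Definition leb {R : realType} {n : nat} : set 'rV[R]_n -> \bar R :=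
  lebesgue_outer.

HB.instance Definition _ (R : realType) (n : nat) :=
  isMeasure.Build (caratheodory_display (@lebesgue_outer R n)) 'rV[R]_n R
    (@leb R n)
    (@caratheodory_measure0 R _ (@lebesgue_outer R n))
    (@caratheodory_measure_ge0 R _ (@lebesgue_outer R n))
    (@caratheodory_measure_sigma_additive R _ (@lebesgue_outer R n)).

(** * Balls and cubes *)

Section Geometry.
Context {R : realType} {n : nat}.
Implicit Types (x y c : 'rV[R]_n) (Q : set 'rV[R]_n).

(* The library norm on 'rV[R]_n is the sup norm, and [ball] refers to it. *)
Definition enorm x : R := Num.sqrt (\sum_i x ord0 i ^+ 2).

Definition eball x (r : R) : set 'rV[R]_n := [set y | enorm (y - x) < r].

(* Half-open, as is customary with dyadic lattices, so that the dyadic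
   subcubes of a given generation partition the cube. *)
Definition cube c (h : R) : set 'rV[R]_n := box c (c + const_mx h).

Definition is_cube Q : Prop := exists c (h : R), 0 < h /\ Q = cube c h.

Definition dyadic_subcubes Q0 : set (set 'rV[R]_n) :=
  [set Q | exists c (h : R) (k : nat) (v : 'I_n -> 'I_(2 ^ k)),
    [/\ 0 < h, Q0 = cube c h &
        Q = cube (c + \row_i (h / 2 ^+ k * (v i)%:R)) (h / 2 ^+ k)]].

Definition dyadic_lattice (D : set (set 'rV[R]_n)) : Prop :=
  [/\ D `<=` is_cube,
      forall Q, D Q -> dyadic_subcubes Q `<=` D,
      forall Q1 Q2, D Q1 -> D Q2 ->
        exists Q, [/\ D Q, dyadic_subcubes Q Q1 & dyadic_subcubes Q Q2]
    & forall K : set 'rV[R]_n, compact K -> exists2 Q, D Q & K `<=` Q].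

Definition sparse (eta : R) (S : set (set 'rV[R]_n)) : Prop :=
  (exists2 D, dyadic_lattice D & S `<=` D) /\
  forall Q, S Q ->
    (leb (\bigcup_(Q' in [set Q' | S Q' /\ Q' `<` Q]) Q') <=
     (1 - eta)%:E * leb Q)%E.

End Geometry.

(** * Averages, maximal operators and BMO *)

Section Averages.
Context {R : realType} {n : nat}.
Implicit Types (A Q : set 'rV[R]_n) (f g : 'rV[R]_n -> \bar R)
  (b : 'rV[R]_n -> R) (x : 'rV[R]_n).

(* <|f|>_A, possibly +oo *)
Definition avg A f : \bar R := ((leb A)^-1 * \int[leb]_(x in A) `|f x|)%E.

(* <b>_A, meaningful for b integrable on A *)
Definition mean A b : R := (fine (leb A))^-1 * \int[leb]_(x in A) b x.

Definition maximal f x : \bar R :=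
  ereal_sup [set avg Q f | Q in [set Q | is_cube Q /\ Q x]].

Definition multi_maximal (m : nat) (f : 'I_m -> 'rV[R]_n -> \bar R) x : \bar R :=
  ereal_sup [set (\prod_(i < m) avg B (f i))%E |
    B in [set B | (exists y r, 0 < r /\ B = eball y r) /\ B x]].

Definition bmo_norm b : \bar R :=
  ereal_sup [set avg Q (fun x => (b x - mean Q b)%:E) | Q in is_cube].

Definition BMO b : Prop :=
  (forall K : set 'rV[R]_n, compact K -> leb.-integrable K (EFin \o b)) /\
  (bmo_norm b < +oo)%E.

Definition bounded_csupp (f : 'rV[R]_n -> R) : Prop :=
  [/\ measurable_fun setT f, exists C : R, forall x, `|f x| <= C &
      exists2 K : set 'rV[R]_n, compact K & forall x, ~ K x -> f x = 0].

End Averages.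

(** * Multilinear operators, commutators and sparse domination *)

Section Operators.
Context {R : realType} {n : nat}.

Definition function_subspace (D : set ('rV[R]_n -> R)) : Prop :=
  [/\ forall g, D g -> measurable_fun setT g, D (cst 0) &
      forall (a : R) g h, D g -> D h -> D (fun x => a * g x + h x)].

(* T acts on D 0 x ... x D (m-1); its values outside this domain are junk,
   and its values inside it only matter almost everywhere. *)
Definition multilinear_operator (m : nat) (D : 'I_m -> set ('rV[R]_n -> R))
    (T : ('I_m -> 'rV[R]_n -> R) -> 'rV[R]_n -> R) : Prop :=
  [/\ forall i, function_subspace (D i),
      forall f, (forall i, D i (f i)) -> measurable_fun setT (T f)
    & forall f i (a : R) g h, (forall j, D j (f j)) -> D i g -> D i h ->
      \forall x \ae leb,
        T (dfwith f i (fun y => a * g y + h y)) x =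
        a * T (dfwith f i g) x + T (dfwith f i h) x].

Definition commutator (m : nat) (i : 'I_m) (b : 'rV[R]_n -> R)
    (T : ('I_m -> 'rV[R]_n -> R) -> 'rV[R]_n -> R) :
    ('I_m -> 'rV[R]_n -> R) -> 'rV[R]_n -> R :=
  fun f x => b x * T f x - T (dfwith f i (fun y => b y * f i y)) x.

(* [b_1, ... [b_l, T]_l ... ]_1, the slots being numbered from 0 *)
Definition iterated_commutator (l m : nat) (hlm : (l <= m)%N)
    (b : 'I_l -> 'rV[R]_n -> R)
    (T : ('I_m -> 'rV[R]_n -> R) -> 'rV[R]_n -> R) :
    ('I_m -> 'rV[R]_n -> R) -> 'rV[R]_n -> R :=
  foldr (fun s S => commutator (widen_ord hlm s) (b s) S) T (enum 'I_l).

(* T(b, f, Q, gamma) at x; gamma = 1, 2 is encoded by false, true *)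
Definition sparse_factor (b f : 'rV[R]_n -> R) (Q : set 'rV[R]_n)
    (gamma : bool) (x : 'rV[R]_n) : \bar R :=
  if gamma then avg Q (fun y => ((b y - mean Q b) * f y)%:E)
  else (`|b x - mean Q b|%:E * avg Q (EFin \o f))%E.

Definition sparse_domination (l m : nat) (hlm : (l <= m)%N) (C eta : R)
    (b : 'I_l -> 'rV[R]_n -> R)
    (Tb : ('I_m -> 'rV[R]_n -> R) -> 'rV[R]_n -> R) : Prop :=
  forall f : 'I_m -> 'rV[R]_n -> R, (forall i, bounded_csupp (f i)) ->
  exists S : 'I_(3 ^ n) -> set (set 'rV[R]_n),
    (forall j, sparse eta (S j)) /\
    \forall x \ae leb,
      (`|Tb f x|%:E <= C%:E *
        \sum_(j < 3 ^ n) \sum_(gamma : {ffun 'I_l -> bool})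
          \esum_(Q in S j)
            ((\prod_(s < l)
                sparse_factor (b s) (f (widen_ord hlm s)) Q (gamma s) x) *
             (\prod_(i < m | (l <= i)%N) avg Q (EFin \o f i)) *
             (\1_Q x)%:E))%E.

End Operators.

(** * Variable exponents *)

Section VariableExponents.
Context {R : realType} {n : nat}.
Implicit Types (p : 'rV[R]_n -> \bar R) (f : 'rV[R]_n -> \bar R).

Definition variable_exponent p : Prop :=
  measurable_fun setT p /\ forall x, (1%E <= p x)%E.

Definition p_minus p : \bar R := ess_inf leb p.
Definition p_plus p : \bar R := ess_sup leb p.

(* At x = y the library convention 0^-1 = 0 makes the first bound 0 <= C1. *)
Definition log_hoelder (alpha : 'rV[R]_n -> R) : Prop :=
  exists C1 C2 alpha_oo : R,
    [/\ 0 < C1, 0 < C2,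
        forall x y, `|alpha x - alpha y| <=
          C1 / ln (expR 1 + (enorm (x - y))^-1) &
        forall x, `|alpha x - alpha_oo| <= C2 / ln (expR 1 + enorm x)].

Definition Plog p : Prop :=
  variable_exponent p /\ log_hoelder (fun x => fine (inve (p x))).

Definition conjugate_exponent p : 'rV[R]_n -> \bar R :=
  fun x => hoelder_conjugate (p x).

Definition modular p f : \bar R :=
  (\int[leb]_(x in [set x | (p x < +oo)%E]) (`|f x| `^ fine (p x)) +
   ess_sup leb (fun x => `|f x| * (\1_[set y | p y = +oo%E] x)%:E))%E.

Definition Lvar_norm p f : \bar R :=
  ereal_inf [set lam%:E | lam in
    [set lam : R | 0 < lam /\ (modular p (fun x => f x / lam%:E) <= 1)%E]].

End VariableExponents.

(** * Morrey and block spaces over X, where X is given by its norm NX *)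

Section MorreyBlock.
Context {R : realType} {n : nat}.
Implicit Types (NX : ('rV[R]_n -> \bar R) -> \bar R)
  (u : 'rV[R]_n -> R -> R) (f : 'rV[R]_n -> \bar R).

Definition indic_norm NX (x : 'rV[R]_n) (r : R) : \bar R :=
  NX (fun y => (\1_(eball x r) y)%:E).

Definition morrey_norm NX u f : \bar R :=
  ereal_sup [set v | exists x r, 0 < r /\
    v = ((u x r)^-1%:E * NX (fun y => f y * (\1_(eball x r) y)%:E))%E].

Definition is_block NX u (g : 'rV[R]_n -> R) : Prop :=
  measurable_fun setT g /\
  exists x0 r, [/\ 0 < r, forall y, ~ eball x0 r y -> g y = 0 &
                   (NX (EFin \o g) <= (u x0 r)^-1%:E)%E].

(* f = sum_k lam_k g_k almost everywhere *)
Definition block_decomposition NX u f (lam : nat -> R)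
    (g : nat -> 'rV[R]_n -> R) : Prop :=
  [/\ forall k, is_block NX u (g k),
      (\sum_(0 <= k <oo) `|lam k|%:E < +oo)%E &
      \forall x \ae leb, f x \is a fin_num /\
        (fun N => \sum_(0 <= k < N) lam k * g k x) @ \oo --> fine (f x)].

(* +oo (infimum of the empty set) off the block space *)
Definition block_norm NX u f : \bar R :=
  ereal_inf [set v | exists lam g, block_decomposition NX u f lam g /\
    v = (\sum_(0 <= k <oo) `|lam k|%:E)%E].

(* The space (0, oo) of radii is the last coordinate of R^(n+1). *)
Definition measurable_weight u : Prop :=
  (forall x r, 0 < r -> 0 < u x r) /\
  measurable_fun [set v : 'rV[R]_(n + 1) | 0 < rsubmx v ord0 ord0]
    (fun v : 'rV[R]_(n + 1) => u (lsubmx v) (rsubmx v ord0 ord0)).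

Definition W0 NX u : Prop :=
  measurable_weight u /\
  exists C : R, [/\ 0 < C,
    forall x1 x2 r1 r2, 0 < r1 -> 0 < r2 -> u x1 r1 <= u x2 r2 ->
      (indic_norm NX x1 r1 / (u x1 r1)%:E <=
       C%:E * (indic_norm NX x2 r2 / (u x2 r2)%:E))%E &
    forall x r, 0 < r ->
      (\sum_(0 <= j <oo)
         (indic_norm NX x r / indic_norm NX x (2 ^+ j.+1 * r) *
          (u x (2 ^+ j.+1 * r))%:E) <= C%:E * (u x r)%:E)%E].

End MorreyBlock.

(** * Operator norms

   The spaces A, B are given by extended norms NA, NB, so that A consists of
   the measurable f with NA f < +oo.  Operator norms may be +oo. *)

Section OperatorNorms.
Context {R : realType} {n : nat}.
Implicit Types (NA NB : ('rV[R]_n -> \bar R) -> \bar R).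

Definition op_norm NA NB
    (S : ('rV[R]_n -> \bar R) -> 'rV[R]_n -> \bar R) : \bar R :=
  ereal_inf [set c%:E | c in [set c : R | 0 <= c /\
    forall f : 'rV[R]_n -> R, measurable_fun setT f ->
      (NA (EFin \o f) < +oo)%E ->
      (NB (S (EFin \o f)) <= c%:E * NA (EFin \o f))%E]].

Definition multi_op_norm (m : nat)
    (NAs : 'I_m -> ('rV[R]_n -> \bar R) -> \bar R) NB
    (S : ('I_m -> 'rV[R]_n -> \bar R) -> 'rV[R]_n -> \bar R) : \bar R :=
  ereal_inf [set c%:E | c in [set c : R | 0 <= c /\
    forall f : 'I_m -> 'rV[R]_n -> R,
      (forall i, measurable_fun setT (f i)) ->
      (forall i, (NAs i (EFin \o f i) < +oo)%E) ->
      (NB (S (fun i => EFin \o f i)) <=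
       c%:E * \prod_(i < m) NAs i (EFin \o f i))%E]].

End OperatorNorms.

(* Main.v *)
(* By duality it suffices to bound the integral of |T_b f| g by u(B) times the
   right-hand side, where g >= 0 is bounded, supported in a ball B and of norm
   at most 1 in L^{p'}, so that g is a multiple of a block.  Sparse domination
   reduces this to integrals over the cubes Q of a sparse family S of products
   of averages of the f_i with oscillations |b_s - <b_s>_Q|.  A stopping time
   argument gives

     int_Q (prod_{s in A} |b_s - <b_s>_Q|) g
       <= C (prod_{s in A} ||b_s||_BMO) int_Q M^{#A} g,

   a substitute for the John-Nirenberg inequality which moves each oscillation
   to one maximal operator.  Applied to g and to the f_s with gamma_s = 2, it
   bounds the sum over S by sum_Q |Q| prod_i <F_i>_Q <M^k g>_Q with k <= l and
   F_i in {f_i, M f_i}, hence, as the sets Q minus its S-descendants are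
   disjoint and have measure at least eta |Q|, by the integral of
   MM(F_1, ..., F_m) M^{k+1} g.  The pairing of the Morrey space with the block
   space concludes, since the operator norms of M are at least 1. *)

(* The conventions for extended reals shape the last step. Operator norms may be [+oo] and
   [0 * +oo = 0], so one vanishing BMO or Morrey norm makes the right-hand side 0 whatever the other
   factors are; in that case every sparse term is shown to integrate to 0. Otherwise all factors are
   positive, the operator norms thanks to explicit tests on the unit cube, so a finite right-hand
   side forces each factor to be finite and the rest is real arithmetic. The stopping-time estimate
   is run on a single function psi_Q, the sum of all normalised oscillations, because a product of
   #A oscillations is at most a multiple of psi_Q^#A. The danger is a constant that grows with the
   number of nested stopping generations. It does not: passing to a stopping cube costs an error of
   lower degree only, and that error is charged to the part of Q outside the stopping cubes, at
   least half of Q, by spending the spare maximal operator. The f_i and g being bounded, all maximal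
   functions in play are finite, so they can be iterated as real functions. *)
Require Import Defs.
From HB Require Import structures.
From mathcomp Require Import all_boot all_order all_algebra.
From mathcomp Require Import all_classical all_reals all_analysis.
From mathcomp Require Import measurable_realfun ess_sup_inf.
From mathcomp Require Import ring lra zify.

Set Implicit Arguments.
Unset Strict Implicit.
Unset Printing Implicit Defensive.

Import Order.TTheory GRing.Theory Num.Theory.
Import numFieldNormedType.Exports.

Local Open Scope classical_set_scope.
Local Open Scope ring_scope.

(** * Lebesgue measure of boxes *)

(* The integral of a nonnegative function is a supremum over the simple
   functions below it; the library lemma assumes measurability. *)
Lemma ge0_le_integral_nomeas d (T : measurableType d) (R : realType)
    (mu : {measure set T -> \bar R}) (D : set T) (f g : T -> \bar R) :
  (forall x, D x -> (0 <= f x)%E) -> (forall x, D x -> (f x <= g x)%E) ->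
  (\int[mu]_(x in D) f x <= \int[mu]_(x in D) g x)%E.
Proof.
move=> f0 fg; have g0 x : D x -> (0 <= g x)%E.
  by move=> Dx; exact: le_trans (f0 _ Dx) (fg _ Dx).
rewrite !ge0_integralE//; apply: ereal_sup_le => _ [h hf <-].
exists h => // x.
apply: le_trans (hf x) _; rewrite !patchE; case: ifPn => // xD.
by apply: fg; exact: set_mem.
Qed.

Lemma ge0_le_integral_subset d (T : measurableType d) (R : realType)
    (mu : {measure set T -> \bar R}) (A B : set T) (f : T -> \bar R) :
  (forall x, B x -> 0 <= f x)%E -> A `<=` B ->
  (\int[mu]_(x in A) f x <= \int[mu]_(x in B) f x)%E.
Proof.
move=> f0 AB; rewrite integral_mkcond [leRHS]integral_mkcond.
apply: ge0_le_integral_nomeas => x _.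
  by apply: erestrict_ge0 => y /AB/f0.
rewrite [leLHS]patchE; case: ifPn => xA; last exact: erestrict_ge0.
by rewrite patchE mem_set//; apply: AB; exact: set_mem.
Qed.

(** Coordinates are integrated out one at a time. [F j] has side lengths in the coordinates below
    [j] and indicators in the others: for [j = 0] the inequality is the pointwise covering, and
    one-dimensional Lebesgue integration in coordinate [j], with monotone convergence for the
    series, turns it into the inequality for [j.+1]. No compactness argument is involved. *)
Lemma box_subset_bigcup_vol (R : realType) (n : nat) (a b : 'rV[R]_n)
    (a_ b_ : nat -> 'rV[R]_n) :
  (forall i, a ord0 i <= b ord0 i) ->
  (forall k i, a_ k ord0 i <= b_ k ord0 i) ->
  box a b `<=` \bigcup_k box (a_ k) (b_ k) ->
  ((\prod_i (b ord0 i - a ord0 i))%:E <=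
   \sum_(0 <= k <oo) (\prod_i (b_ k ord0 i - a_ k ord0 i))%:E)%E.
Proof.
move=> ab ab_ sub.
pose F (j : nat) (a b : 'rV[R]_n) (x : 'I_n -> R) : R :=
  \prod_(i < n) (if (i < j)%N then b ord0 i - a ord0 i
                 else \1_(`[a ord0 i, b ord0 i[) (x i)).
have F0 j (c d : 'rV[R]_n) x : (forall i, c ord0 i <= d ord0 i) -> 0 <= F j c d x.
  by move=> cd; apply: prodr_ge0 => i _; case: ifP => // _; rewrite subr_ge0.
have key j : (j <= n)%N -> forall x,
    ((F j a b x)%:E <= \sum_(0 <= k <oo) (F j (a_ k) (b_ k) x)%:E)%E.
  elim: j => [_ x|j IH jn x].
    have [xb|xb] := pselect (box a b (\row_i x i)).
      have [k _ xk] := sub _ xb.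
      rewrite (@nneseriesD1 _ _ k)//; last by move=> i _; rewrite lee_fin F0.
      have -> : F 0 (a_ k) (b_ k) x = 1.
        apply: big1 => i _ /=; rewrite indicE mem_set//=.
        by have := xk i; rewrite mxE in_itv.
      rewrite (@le_trans _ _ 1%E)//.
        rewrite lee_fin; apply: prodr_ile1 => i _ /=.
        by rewrite indicE; case: (_ \in _); rewrite ?ler01 ?lexx.
      rewrite leeDl//; apply: nneseries_ge0 => i _ _.
      by rewrite lee_fin F0.
    suff -> : F 0 a b x = 0.
      by apply: nneseries_ge0 => i _ _; rewrite lee_fin F0.
    apply/eqP; rewrite prodf_seq_eq0; apply/hasP.
    have /existsNP[i xi] := xb.
    exists i; first exact: mem_index_enum.
    rewrite /= indicE memNset//= in_itv/=; apply/negP.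
    by move: xi => /negP; rewrite mxE.
  pose i0 := Ordinal jn.
  pose G (a b : 'rV[R]_n) : R :=
    \prod_(i < n | i != i0) (if (i < j)%N then b ord0 i - a ord0 i
                 else \1_(`[a ord0 i, b ord0 i[) (x i)).
  have FG c d t : F j c d (fun i => if i == i0 then t else x i) =
      G c d * \1_(`[c ord0 i0, d ord0 i0[) t.
    rewrite /F (bigD1 i0)//= ltnn eqxx mulrC; congr (_ * _).
    by apply: eq_bigr => i /negbTE ->.
  have FSG c d : F j.+1 c d x = G c d * (d ord0 i0 - c ord0 i0).
    rewrite /F (bigD1 i0)//= leqnn mulrC; congr (_ * _).
    apply: eq_bigr => i ii0; rewrite ltnS leq_eqVlt.
    by rewrite (_ : _ == _ = false)//; apply/negbTE; apply: contra ii0 => /eqP ij; apply/eqP/val_inj.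
  have intF (c d : 'rV[R]_n) : (forall i, c ord0 i <= d ord0 i) ->
      (\int[lebesgue_measure]_t (F j c d (fun i => if i == i0 then t else x i))%:E =
       (F j.+1 c d x)%:E)%E.
    move=> cd; under eq_integral do rewrite FG EFinM.
    rewrite ge0_integralZl//=; last 2 first.
    - by apply/measurable_EFinP; apply: measurable_indic.
    - by rewrite lee_fin; apply: prodr_ge0 => i _; case: ifP => // _; rewrite subr_ge0.
    rewrite integral_indic// setIT FSG EFinM; congr (_ * _)%E.
    etransitivity; first exact: lebesgue_measure_itv.
    rewrite /= lte_fin; case: ltP => // dc.
    have -> : c ord0 i0 = d ord0 i0 by apply: le_anti; rewrite cd.
    by rewrite subrr.
  have mF c d : measurable_fun [set: R]
      (fun t => (F j c d (fun i => if i == i0 then t else x i))%:E).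
    under eq_fun do rewrite FG.
    by apply/measurable_EFinP; apply: measurable_funM => //; apply: measurable_indic.
  rewrite -intF//.
  under [leRHS]eq_eseriesr do rewrite -intF//.
  rewrite -integral_nneseries//; last 2 first.
  - by move=> k; exact: mF.
  - by move=> k t _; rewrite lee_fin F0.
  apply: ge0_le_integral_nomeas => // t _; first by rewrite lee_fin F0.
  by apply: IH; exact: ltnW.
have := key n (leqnn n) (fun=> 0).
have FE c d : F n c d (fun=> 0) = \prod_i (d ord0 i - c ord0 i).
  by apply: eq_bigr => i _; rewrite ltn_ord.
by rewrite FE; under eq_eseriesr do rewrite FE.
Qed.
Lemma box_subset_vol (R : realType) (n : nat) (hn : (0 < n)%N) (a b c d : 'rV[R]_n) :
  (forall i, a ord0 i <= b ord0 i) -> (forall i, c ord0 i <= d ord0 i) ->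
  box a b `<=` box c d ->
  \prod_i (b ord0 i - a ord0 i) <= \prod_i (d ord0 i - c ord0 i).
Proof.
move=> ab cd sub.
(* The cover consists of one box followed by degenerate ones, whose volume is 0 because the product
   of side lengths is not empty. *)
pose d_ (k : nat) := if k is 0%N then d else c.
have cd_ k i : c ord0 i <= d_ k ord0 i by case: k => //= _.
have /(box_subset_bigcup_vol ab cd_) : box a b `<=` \bigcup_k box c (d_ k).
  by move=> x /sub cdx; exists 0%N.
rewrite (@nneseriesD1 _ _ 0%N)//=; last first.
  by move=> k _; rewrite lee_fin prodr_ge0// => i _; rewrite subr_ge0.
rewrite (@eq_eseriesr _ _ (cst 0%E)); last first.
  move=> [|k] //= _; congr (_%:E); rewrite (bigD1 (Ordinal hn))//=.
  by rewrite subrr mul0r.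
by rewrite eseries0// adde0 lee_fin.
Qed.

Lemma box_volume_boxE (R : realType) (n : nat) (hn : (0 < n)%N) (a b : 'rV[R]_n) :
  (forall i, a ord0 i <= b ord0 i) ->
  box_volume (box a b) = (\prod_i (b ord0 i - a ord0 i))%:E.
Proof.
move=> ab; apply/eqP; rewrite eq_le; apply/andP; split.
  by apply: ereal_inf_lbound; right; exists a, b.
apply: le_ereal_inf_tmp => v [[ab0 ->]|[c [d [cd abcd ->]]]].
  pose z : 'rV[R]_n := 0.
  have : box a b `<=` box z z by rewrite ab0.
  move/(box_subset_vol hn ab (fun=> lexx _)).
  by rewrite lee_fin (bigD1 (Ordinal hn) (F := fun i => z ord0 i - _))//= subrr mul0r.
by rewrite lee_fin; apply: box_subset_vol => //; rewrite abcd.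
Qed.

Lemma box_volume_lty (R : realType) (n : nat) (hn : (0 < n)%N)
    (A : set 'rV[R]_n) : (box_volume A < +oo)%E ->
  exists a b : 'rV[R]_n, [/\ forall i, a ord0 i <= b ord0 i, A `<=` box a b &
    box_volume A = (\prod_i (b ord0 i - a ord0 i))%:E].
Proof.
move=> /ereal_inf_lt[v [[-> _]|[a [b [ab -> _]]] _]].
  exists 0, 0; split => //; rewrite box_volume0 (bigD1 (Ordinal hn))//=.
  by rewrite subrr mul0r.
by exists a, b; split => //; rewrite box_volume_boxE.
Qed.

Lemma lebesgue_outer_le_vol (R : realType) (n : nat) (a b : 'rV[R]_n) :
  (forall i, a ord0 i <= b ord0 i) ->
  (lebesgue_outer (box a b) <= (\prod_i (b ord0 i - a ord0 i))%:E)%E.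
Proof.
move=> ab; apply: (@le_trans _ _ (box_volume (box a b))); last first.
  by apply: ereal_inf_lbound; right; exists a, b.
pose A (k : nat) : set 'rV[R]_n := if k is 0%N then box a b else set0.
apply: ereal_inf_lbound; exists A.
  split; last by move=> x abx; exists 0%N.
  move=> [|k]; last exact: measurable0.
  by apply: sub_sigma_algebra; exists a, b.
rewrite (@nneseriesD1 _ _ 0%N)//=; last by move=> k _; exact: box_volume_ge0.
by rewrite eseries0 ?adde0// => -[|k]//= _ _; exact: box_volume0.
Qed.

(** The covers in [mu_ext] range over the whole generated sigma-algebra, but a cover with a member
    of infinite [box_volume] has an infinite sum, so only box covers have to be examined. *)
Lemma lebesgue_outer_coverP (R : realType) (n : nat) (hn : (0 < n)%N)
    (X : set 'rV[R]_n) (t : \bar R) :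
  (forall a b : nat -> 'rV[R]_n, (forall k i, a k ord0 i <= b k ord0 i) ->
     X `<=` \bigcup_k box (a k) (b k) ->
     (t <= \sum_(0 <= k <oo) (\prod_i (b k ord0 i - a k ord0 i))%:E)%E) ->
  (t <= lebesgue_outer X)%E.
Proof.
move=> h; apply: le_ereal_inf_tmp => _ [A [mA XA] <-].
have [Aoo|] := pselect (forall k, (box_volume (A k) < +oo)%E); last first.
  move=> /existsNP[k /negP]; rewrite -leNgt leye_eq => /eqP Ak.
  rewrite (@nneseriesD1 _ _ k)//=; last by move=> *; exact: box_volume_ge0.
  rewrite Ak addye ?leey// -ltNye (@lt_le_trans _ _ 0%E)//.
  by apply: nneseries_ge0 => *; exact: box_volume_ge0.
have /choice[a /choice[b ab]] := fun k => box_volume_lty hn (Aoo k).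
have volE k : box_volume (A k) = (\prod_i (b k ord0 i - a k ord0 i))%:E by case: (ab k).
under eq_eseriesr do rewrite volE.
apply: h; first by move=> k; case: (ab k).
by move=> x /XA[k _ Akx]; exists k => //; case: (ab k) => _ + _; apply.
Qed.

Lemma lebesgue_outer_box (R : realType) (n : nat) (hn : (0 < n)%N) (a b : 'rV[R]_n) :
  (forall i, a ord0 i <= b ord0 i) ->
  lebesgue_outer (box a b) = (\prod_i (b ord0 i - a ord0 i))%:E.
Proof.
move=> ab; apply/eqP; rewrite eq_le lebesgue_outer_le_vol//=.
by apply: lebesgue_outer_coverP => // c d cd; exact: box_subset_bigcup_vol.
Qed.

(** The hyperplane cuts each box of a cover into two boxes whose volumes add up, which is the
    Caratheodory inequality on covers. *)
Lemma measurable_halfspace (R : realType) (n : nat) (hn : (0 < n)%N) (i0 : 'I_n) (t : R) :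
  measurable [set x : 'rV[R]_n | x ord0 i0 < t].
Proof.
set H := [set x | _].
apply: le_caratheodory_measurable => X.
apply: lebesgue_outer_coverP => // a b ab Xab.
(* The cutting level is [t] clamped to the side of the box, so both pieces remain boxes, possibly
   degenerate, when the hyperplane misses the box. *)
pose a2 k : 'rV[R]_n := \row_i (if i == i0 then Num.min (b k ord0 i) (Num.max (a k ord0 i) t) else a k ord0 i).
pose b1 k : 'rV[R]_n := \row_i (if i == i0 then Num.min (b k ord0 i) (Num.max (a k ord0 i) t) else b k ord0 i).
have ab1 k i : a k ord0 i <= b1 k ord0 i.
  by rewrite mxE; case: ifP => // _; rewrite le_min ab le_max lexx.
have a2b k i : a2 k ord0 i <= b k ord0 i.
  by rewrite mxE; case: ifP => // _; rewrite ge_min lexx.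
have vol k : \prod_i (b k ord0 i - a k ord0 i) =
    \prod_i (b1 k ord0 i - a k ord0 i) + \prod_i (b k ord0 i - a2 k ord0 i).
  rewrite !(bigD1 i0 (P := predT))//= !mxE eqxx.
  rewrite (eq_bigr (fun i => b k ord0 i - a k ord0 i) (F1 := fun i => b1 k ord0 i - _)); last first.
    by move=> i /negbTE ii0; rewrite mxE ii0.
  rewrite (eq_bigr (fun i => b k ord0 i - a k ord0 i) (F1 := fun i => _ - a2 k ord0 i)); last first.
    by move=> i /negbTE ii0; rewrite mxE ii0.
  by rewrite -mulrDl; congr (_ * _); ring.
apply: (@le_trans _ _ (\sum_(0 <= k <oo) (\prod_i (b1 k ord0 i - a k ord0 i))%:E +
    \sum_(0 <= k <oo) (\prod_i (b k ord0 i - a2 k ord0 i))%:E)%E); last first.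
  rewrite -nneseriesD//; first by under [leRHS]eq_eseriesr do rewrite vol EFinD.
  - by move=> k _; rewrite lee_fin prodr_ge0// => i _; rewrite subr_ge0.
  - by move=> k _; rewrite lee_fin prodr_ge0// => i _; rewrite subr_ge0.
have aux (c d : nat -> 'rV[R]_n) Y : (forall k i, c k ord0 i <= d k ord0 i) ->
    Y `<=` \bigcup_k box (c k) (d k) ->
    (lebesgue_outer Y <= \sum_(0 <= k <oo) (\prod_i (d k ord0 i - c k ord0 i))%:E)%E.
  move=> cd Ycd; apply: (le_trans (le_outer_measure lebesgue_outer _ _ Ycd)).
  apply: (le_trans (outer_measure_sigma_subadditive lebesgue_outer _)).
  by apply: lee_nneseries => k _; [move=> _; exact: (outer_measure_ge0 lebesgue_outer)|exact: lebesgue_outer_le_vol].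
apply: leeD; apply: aux => // x [/Xab[k _ xk] Hx]; exists k => // i;
  have /andP[h1 h2] := xk i; rewrite mxE; case: ifPn => [/eqP ii0|_]; rewrite ?h1 ?h2//=.
  by rewrite lt_min h2 lt_max ii0 Hx orbT.
rewrite andbT ge_min; apply/orP; right; rewrite ge_max h1/=.
by rewrite leNgt; apply/negP; rewrite ii0.
Qed.

Lemma measurable_box (R : realType) (n : nat) (hn : (0 < n)%N) (a b : 'rV[R]_n) :
  measurable (box a b).
Proof.
have -> : box a b = \bigcap_(i in [set: 'I_n])
    ((~` [set x : 'rV[R]_n | x ord0 i < a ord0 i]) `&` [set x | x ord0 i < b ord0 i]).
  apply/seteqP; split=> x h i.
    by move=> _; have /andP[h1 h2] := h i; split => //=; apply/negP; rewrite -leNgt.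
  by have [/= /negP] := h i I; rewrite -leNgt => -> ->.
apply: fin_bigcap_measurable => [|i _]; first exact: finite_finset.
apply: measurableI; last exact: measurable_halfspace.
by apply: measurableC; exact: measurable_halfspace.
Qed.

Lemma leb_box (R : realType) (n : nat) (hn : (0 < n)%N) (a b : 'rV[R]_n) :
  (forall i, a ord0 i <= b ord0 i) ->
  leb (box a b) = (\prod_i (b ord0 i - a ord0 i))%:E.
Proof. exact: lebesgue_outer_box. Qed.

Lemma leb_cube (R : realType) (n : nat) (hn : (0 < n)%N) (c : 'rV[R]_n) (h : R) :
  0 <= h -> leb (cube c h) = (h ^+ n)%:E.
Proof.
move=> h0; rewrite leb_box//; last by move=> i; rewrite !mxE lerDl.
congr (_%:E); rewrite (eq_bigr (fun=> h)) => [|i _]; last by rewrite !mxE addrAC subrr add0r.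
by rewrite prodr_const card_ord.
Qed.

(** An open set is the union of the boxes with rational corners that it contains; [unpickle]
    enumerates the pairs of corners. *)
Lemma measurable_open (R : realType) (n : nat) (hn : (0 < n)%N) (U : set 'rV[R]_n) :
  open U -> measurable U.
Proof.
move=> oU.
pose q (v : 'rV[rat]_n) : 'rV[R]_n := map_mx ratr v.
pose F k : set 'rV[R]_n := if unpickle k is Some vw then
  (if `[< box (q vw.1) (q vw.2) `<=` U >] then box (q vw.1) (q vw.2) else set0) else set0.
rewrite (_ : U = \bigcup_k F k).
  apply: bigcupT_measurable => k; rewrite /F; case: unpickle => [[v w]|]//.
  by case: ifP => // _; exact: measurable_box.
apply/seteqP; split => x; last first.
  move=> [k _]; rewrite /F; case: unpickle => // -[v w]/=.
  by case: ifPn => // /asboolP h /h.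
move=> Ux; have : nbhs x U by exact: open_nbhs_nbhs.
move=> /nbhs_ballP[e /= e0 xeU].
have /choice[v hv] i : exists v : rat, x ord0 i - e < ratr v < x ord0 i.
  have /rat_in_itvoo[v] : x ord0 i - e < x ord0 i by rewrite gtrBl.
  by rewrite in_itv/= => h; exists v.
have /choice[w hw] i : exists v : rat, x ord0 i < ratr v < x ord0 i + e.
  have /rat_in_itvoo[w] : x ord0 i < x ord0 i + e by rewrite ltrDl.
  by rewrite in_itv/= => h; exists w.
exists (pickle (\row_i v i, \row_i w i)) => //; rewrite /F pickleK/=.
rewrite ifT; last first.
  apply/asboolP => y hy; apply: xeU; split => // i j; rewrite (ord1 i) /ball/=.
  have := hy j; rewrite !mxE ltr_distlC => /andP[h1 h2].
  by have /andP[h3 h4] := hv j; have /andP[h5 h6] := hw j; apply/andP; split; lra.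
by move=> i; rewrite !mxE; have /andP[_ /ltW ->] := hv i; have /andP[-> _] := hw i.
Qed.
Lemma near_box (R : realType) (n : nat) (a b x : 'rV[R]_n) :
  (forall i, a ord0 i < x ord0 i < b ord0 i) ->
  \forall y \near x, forall i, a ord0 i < (y : 'rV[R]_n) ord0 i < b ord0 i.
Proof.
move=> xab.
apply: (@filter_forall _ _ (fun i (y : 'rV[R]_n) => a ord0 i < y ord0 i < b ord0 i) (nbhs x)) => i.
have /andP[h1 h2] := xab i.
have /(_ x) cx := @coord_continuous R 1 n ord0 i.
have : \forall y \near x ord0 i, a ord0 i < y < b ord0 i.
  have /near_in_itvoo : x ord0 i \in `]a ord0 i, b ord0 i[ by rewrite in_itv/= h1.
  by apply: filterS => y; rewrite in_itv.
by move/cx.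
Qed.

Lemma open_eball (R : realType) (n : nat) (x : 'rV[R]_n) (r : R) : open (eball x r).
Proof.
have -> : eball x r = (fun y => enorm (y - x)) @^-1` [set t | t < r] by [].
apply: open_comp; last exact: open_lt.
move=> y _; apply: (@continuous_comp _ _ _
  (fun y : 'rV[R]_n => \sum_i (y - x) ord0 i ^+ 2) Num.sqrt); last exact: sqrt_continuous.
apply: (@continuous_big R^o _ +%R 0 predT); first exact: add_continuous.
move=> i _ {}y.
have ci : {for y, continuous (fun z : 'rV[R]_n => (z - x) ord0 i)}.
  rewrite (_ : (fun z => _) = (fun z : 'rV[R]_n => z ord0 i - x ord0 i)).
    apply: (@continuousB _ R^o); last exact: cst_continuous.
    exact: (@coord_continuous R 1 n ord0 i y).
  by apply/funext => z; rewrite !mxE.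
exact: (cvgM ci ci).
Qed.

Lemma measurable_fun_open_gt (R : realType) (n : nat) (hn : (0 < n)%N)
    (f : 'rV[R]_n -> \bar R) :
  (forall a : R, open [set x | (a%:E < f x)%E]) -> measurable_fun setT f.
Proof.
move=> of_; apply: (measurability _ (ErealGenOInfty.measurableE R)).
move=> /= _ [_ [a ->]] <-; rewrite setTI; apply: measurable_open => //.
by rewrite preimage_itvoy; exact: of_.
Qed.

(** * Maximal operators *)

Section Averages.
Context {R : realType} {n : nat} (hn : (0 < n)%N).
Implicit Types (f g : 'rV[R]_n -> \bar R) (Q : set 'rV[R]_n).

Lemma avg_ge0 Q f : (0 <= avg Q f)%E.
Proof.
rewrite /avg mule_ge0//; last exact: integral_ge0.
by rewrite inve_ge0; exact: measure_ge0.
Qed.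

Lemma is_cube_measurable Q : is_cube Q -> measurable Q.
Proof. by move=> [c [h [_ ->]]]; exact: measurable_box. Qed.

Lemma is_cube_leb Q : is_cube Q -> exists2 v : R, 0 < v & leb Q = v%:E.
Proof.
move=> [c [h [h0 ->]]]; exists (h ^+ n); first exact: exprn_gt0.
by rewrite leb_cube// ltW.
Qed.

Lemma is_cube_avg Q f : is_cube Q ->
  (leb Q * avg Q f = \int[leb]_(x in Q) `|f x|)%E.
Proof.
move=> /is_cube_leb[v v0 Qv].
by rewrite /avg Qv muleA divee ?mul1e// eqe gt_eqF.
Qed.

Lemma avg_le_cst Q f (C : R) : is_cube Q ->
  (forall x, Q x -> `|f x| <= C%:E)%E -> (avg Q f <= C%:E)%E.
Proof.
move=> cQ fC; have [v v0 Qv] := is_cube_leb cQ.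
rewrite /avg Qv inver gt_eqF// lee_pdivrMl//.
rewrite (@le_trans _ _ (\int[leb]_(x in Q) C%:E)%E)//.
  exact: ge0_le_integral_nomeas.
have -> : (\int[leb]_(x in Q) C%:E = C%:E * leb Q)%E.
  exact: (integral_cst leb (is_cube_measurable cQ) C%:E).
by rewrite Qv muleC.
Qed.

Lemma maximal_ge0 f x : (0 <= maximal f x)%E.
Proof.
apply: (@le_trans _ _ (avg (cube x 1) f)); first exact: avg_ge0.
apply: ereal_sup_ubound; exists (cube x 1) => //; split; first by exists x, 1.
by move=> i; rewrite !mxE lexx ltrDl ltr01.
Qed.

Lemma avg_le_maximal Q f x : is_cube Q -> Q x -> (avg Q f <= maximal f x)%E.
Proof. by move=> cQ Qx; apply: ereal_sup_ubound; exists Q. Qed.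

Lemma maximal_le_cst f (C : R) x : (forall x, `|f x| <= C%:E)%E ->
  (maximal f x <= C%:E)%E.
Proof. by move=> fC; apply: ge_ereal_sup => _ [Q [cQ _] <-]; exact: avg_le_cst. Qed.

(* The half-open cubes containing [x] need not contain a neighbourhood of [x],
   so they are first enlarged slightly. *)
Lemma open_maximal_gt f (t : R) : open [set x | (t%:E < maximal f x)%E].
Proof.
rewrite openE => x /= /ereal_sup_gt[_ [Q [cQ Qx] <-] tQ].
suff [e e0 [Q' [cQ' Q'x tQ']]] : exists2 e : R, 0 < e & exists Q', [/\ is_cube Q',
    \forall y \near x, Q' y & (t%:E < avg Q' f)%E].
  near=> y; apply: (lt_le_trans tQ'); apply: avg_le_maximal => //.
  by near: y.
have [t0|t0] := ltP t 0.
  exists 1 => //; exists (cube (x - const_mx 1) 2); split.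
  - by exists (x - const_mx 1), 2.
  - have xx : forall i, (x - const_mx 1) ord0 i < x ord0 i < (x + const_mx 1) ord0 i.
      by move=> i; rewrite !mxE; apply/andP; split; lra.
    apply: filterS (near_box xx) => y hy i.
    by have := hy i; rewrite !mxE => /andP[h1 h2]; apply/andP; split; lra.
  - by rewrite (@lt_le_trans _ _ 0%E)// ?lte_fin// avg_ge0.
have [c [h [h0 Qch]]] := cQ.
move: tQ; rewrite /avg Qch leb_cube ?ltW// inver gt_eqF ?exprn_gt0//.
rewrite lte_pdivlMl ?exprn_gt0//; set I := (\int[_]_(_ in _) _)%E => tI.
(* The strict inequality leaves room for a slightly longer side, by continuity of the power at
   [h]. *)
have [e /= e0 he] : exists2 e : R, 0 < e & (((h + e) ^+ n * t)%:E < I)%E.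
  have I0 : (0 <= I)%E by exact: integral_ge0.
  move: tI I0; case: I => [I||//]; last by move=> _ _; exists 1; rewrite ?ltry.
  rewrite lte_fin => tI _.
  have : (fun e : R => (h + e) ^+ n * t) @ (0:R) --> (h + 0) ^+ n * t.
    have ch : (fun e : R => h + e) @ (0:R) --> h + 0 by apply: cvgD; [exact: cvg_cst|exact: cvg_id].
    apply: cvgM; last exact: cvg_cst.
    exact: (cvg_comp _ _ ch (@exprn_continuous R n (h + 0))).
  rewrite addr0 => /cvgr_lt/(_ _ tI) /nbhs_ballP[d /= d0 hd].
  exists (d / 2); first by rewrite divr_gt0.
  rewrite lte_fin; apply: hd; rewrite /ball/= sub0r normrN gtr0_norm ?divr_gt0//.
  by rewrite ltr_pdivrMr// ltr_pMr// ltr1n.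
exists e => //; exists (cube (c - const_mx e) (h + e)); split.
- by exists (c - const_mx e), (h + e); split => //; rewrite addr_gt0.
- have xx : forall i, (c - const_mx e) ord0 i < x ord0 i < (c + const_mx h) ord0 i.
    move=> i; move: Qx; rewrite Qch => /(_ i); rewrite !mxE => /andP[h1 ->].
    by rewrite andbT; lra.
  apply: filterS (near_box xx) => y hy i.
  by have := hy i; rewrite !mxE => /andP[h1 h2]; apply/andP; split; lra.
- rewrite /avg leb_cube ?addr_ge0 ?ltW// inver gt_eqF ?exprn_gt0 ?addr_gt0//.
  rewrite lte_pdivlMl; last by rewrite exprn_gt0// addr_gt0.
  apply: (lt_le_trans he); apply: ge0_le_integral_subset => // y hy i.
  by have := hy i; rewrite !mxE => /andP[h1 h2]; apply/andP; split; lra.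
Unshelve. all: by end_near. Qed.

Lemma measurable_maximal f : measurable_fun setT (maximal f).
Proof. by apply: measurable_fun_open_gt => // t; exact: open_maximal_gt. Qed.

(** Balls are open, so the ball that works at [x] works at all nearby points and need not be
    enlarged. *)
Lemma open_multi_maximal_gt (m : nat) (f : 'I_m -> 'rV[R]_n -> \bar R) (t : R) :
  open [set x | (t%:E < multi_maximal f x)%E].
Proof.
rewrite openE => x /= /ereal_sup_gt[_ [B [[y [r [r0 ->]]] yrx] <-] tB].
have := @open_eball R n y r; rewrite openE => /(_ _ yrx); apply: filterS => z yrz /=.
apply: (lt_le_trans tB); apply: ereal_sup_ubound.
by exists (eball y r) => //; split => //; exists y, r.
Qed.

Lemma measurable_multi_maximal (m : nat) (f : 'I_m -> 'rV[R]_n -> \bar R) :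
  measurable_fun setT (multi_maximal f).
Proof. by apply: measurable_fun_open_gt => // t; exact: open_multi_maximal_gt. Qed.

End Averages.

Lemma lee_prode (R : realType) (I : Type) (r : seq I) (P : pred I) (a b : I -> \bar R) :
  (forall i, P i -> 0 <= a i)%E -> (forall i, P i -> a i <= b i)%E ->
  (\prod_(i <- r | P i) a i <= \prod_(i <- r | P i) b i)%E.
Proof.
move=> a0 ab; elim: r => [|i r IH]; first by rewrite !big_nil.
rewrite !big_cons; case: ifPn => // Pi.
by apply: lee_pmul => //; [exact: a0|exact: prode_ge0|exact: ab].
Qed.

Lemma enorm_coord_lt (R : realType) (n : nat) (v : 'rV[R]_n) (r : R) (i : 'I_n) :
  enorm v < r -> `|v ord0 i| < r.
Proof.
apply: le_lt_trans; rewrite -sqrtr_sqr ler_wsqrtr// (bigD1 i)//= lerDl.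
by apply: sumr_ge0 => j _; exact: sqr_ge0.
Qed.

(** The distance to the corner is at most [h] times the square root of [n]; [n.+1] is a convenient
    strict upper bound for that root. *)
Lemma cube_subset_eball (R : realType) (n : nat) (c : 'rV[R]_n) (h : R) :
  0 < h -> cube c h `<=` eball c (n.+1%:R * h).
Proof.
move=> h0 y yQ; rewrite /eball/= /enorm.
have r0 : 0 < n.+1%:R * h by rewrite mulr_gt0.
rewrite -[ltRHS]gtr0_norm// -sqrtr_sqr ltr_sqrt ?exprn_gt0//.
apply: (@le_lt_trans _ _ (\sum_(i < n) h ^+ 2)).
  apply: ler_sum => i _; have := yQ i; rewrite !mxE => /andP[h1 h2].
  by rewrite ler_sqr ?nnegrE; lra.
rewrite sumr_const card_ord -[ltLHS]mulr_natl exprMn ltr_pM2r ?exprn_gt0//.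
by rewrite expr2 -natrM ltr_nat; nia.
Qed.

Lemma eball_subset_cube (R : realType) (n : nat) (c : 'rV[R]_n) (r : R) :
  eball c r `<=` cube (c - const_mx r) (2 * r).
Proof.
move=> y /= yr i; have := enorm_coord_lt i yr.
by rewrite !mxE ltr_norml => /andP[h1 h2]; apply/andP; split; lra.
Qed.

(** * Real-valued maximal functions of bounded functions; from cubes to balls *)

Section BoundedMeasurable.
Context {R : realType} {n : nat} (hn : (0 < n)%N).
Implicit Types (f g : 'rV[R]_n -> R) (Q : set 'rV[R]_n).

Definition bounded_measurable f : Prop :=
  measurable_fun setT f /\ exists C : R, forall x, `|f x| <= C.

(** Real values allow [iter] and real arithmetic; by [rmaximalE], [fine] loses nothing on bounded
    functions. *)
Definition rmaximal f : 'rV[R]_n -> R := fun x => fine (maximal (EFin \o f) x).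

Lemma rmaximal_ge0 f x : 0 <= rmaximal f x.
Proof. by apply: fine_ge0; exact: maximal_ge0. Qed.

Lemma rmaximalE f : bounded_measurable f ->
  EFin \o rmaximal f = maximal (EFin \o f).
Proof.
move=> [_ [C fC]]; apply/funext => x /=; rewrite /rmaximal fineK//.
rewrite ge0_fin_numE ?maximal_ge0// (@le_lt_trans _ _ C%:E) ?ltry//.
by apply: maximal_le_cst => // y; rewrite lee_fin.
Qed.

Lemma bounded_measurable_rmaximal f :
  bounded_measurable f -> bounded_measurable (rmaximal f).
Proof.
move=> bf; split.
  apply/measurable_EFinP; rewrite (rmaximalE bf); exact: measurable_maximal.
have [_ [C fC]] := bf; exists C => x; rewrite ger0_norm ?rmaximal_ge0//.
rewrite -lee_fin; have /= -> := congr1 (fun F => F x) (rmaximalE bf).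
by apply: maximal_le_cst => // y; rewrite lee_fin.
Qed.

Lemma avg_le_rmaximal f Q x : bounded_measurable f -> is_cube Q -> Q x ->
  (avg Q (EFin \o f) <= (rmaximal f x)%:E)%E.
Proof.
move=> bf cQ Qx; have /= -> := congr1 (fun F => F x) (rmaximalE bf).
exact: avg_le_maximal.
Qed.

Lemma bounded_measurable_iter f k :
  bounded_measurable f -> bounded_measurable (iter k rmaximal f).
Proof. by move=> bf; elim: k => [|k IH]; [exact: bf|exact: bounded_measurable_rmaximal IH]. Qed.

(** A cube of side [h] lies in a ball of radius [n.+1 * h], which lies in a cube of side
    [2 * n.+1 * h]; this is the ratio of the volumes of the two cubes. *)
Definition ball_cube_ratio : R := (2 * n.+1%:R) ^+ n.

Lemma ball_cube_ratio_gt0 : 0 < ball_cube_ratio.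
Proof. by rewrite exprn_gt0// mulr_gt0. Qed.

Lemma cube_eball Q : is_cube Q -> exists c r, [/\ 0 < r, Q `<=` eball c r &
  (leb (eball c r) <= ball_cube_ratio%:E * leb Q)%E].
Proof.
move=> [c [h [h0 ->]]]; exists c, (n.+1%:R * h); split.
- by rewrite mulr_gt0.
- exact: cube_subset_eball.
have r0 : 0 < n.+1%:R * h by rewrite mulr_gt0.
apply: (@le_trans _ _ (leb (cube (c - const_mx (n.+1%:R * h)) (2 * (n.+1%:R * h))))).
  by apply: (le_outer_measure lebesgue_outer); exact: eball_subset_cube.
rewrite (leb_cube hn _ (ltW h0)) leb_cube ?mulr_ge0 ?(ltW h0)//.
by rewrite -EFinM lee_fin /ball_cube_ratio mulrA exprMn.
Qed.

Lemma cube_avg_le_ball Q (f : 'rV[R]_n -> \bar R) c r : is_cube Q ->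
  Q `<=` eball c r -> (leb (eball c r) <= ball_cube_ratio%:E * leb Q)%E ->
  (avg Q f <= ball_cube_ratio%:E * avg (eball c r) f)%E.
Proof.
move=> cQ QB BQ; have [v v0 Qv] := is_cube_leb hn cQ.
have QB' : (leb Q <= leb (eball c r))%E by exact: (le_outer_measure lebesgue_outer).
have [w Bw] : exists w, leb (eball c r) = w%:E.
  exists (fine (leb (eball c r))); rewrite fineK// ge0_fin_numE ?measure_ge0//.
  by apply: le_lt_trans BQ _; rewrite Qv -EFinM ltry.
have w0 : 0 < w by rewrite -lte_fin -Bw (lt_le_trans _ QB')// Qv lte_fin.
rewrite /avg Qv Bw !inver !gt_eqF// lee_pdivrMl// !muleA.
move: BQ; rewrite Qv Bw -EFinM lee_fin => BQ.
rewrite -!EFinM; apply: (@le_trans _ _ (1 * \int[leb]_(x in eball c r) `|f x|)%E).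
  by rewrite mul1e; exact: ge0_le_integral_subset.
apply: lee_wpmul2r; first exact: integral_ge0.
by rewrite lee_fin -mulrA mulrCA mulrA ler_pdivlMr// mul1r.
Qed.

Lemma cube_avg_le_multi_maximal (m : nat) (f : 'I_m -> 'rV[R]_n -> \bar R) Q x :
  is_cube Q -> Q x ->
  (\prod_(i < m) avg Q (f i) <= (ball_cube_ratio ^+ m)%:E * multi_maximal f x)%E.
Proof.
move=> cQ Qx; have [c [r [r0 QB BQ]]] := cube_eball cQ.
apply: (@le_trans _ _ (\prod_(i < m) (ball_cube_ratio%:E * avg (eball c r) (f i)))%E).
  apply: lee_prode => i _; [exact: avg_ge0|exact: cube_avg_le_ball].
rewrite big_split/= prodEFin prodr_const card_ord.
apply: lee_wpmul2l; first by rewrite lee_fin exprn_ge0// ltW// ball_cube_ratio_gt0.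
apply: ereal_sup_ubound; exists (eball c r) => //; split; last exact: QB.
by exists c, r.
Qed.

Lemma avg_eball_le_cst (f : 'rV[R]_n -> \bar R) c r (C : R) : 0 <= C ->
  (forall x, `|f x| <= C%:E)%E -> (avg (eball c r) f <= C%:E)%E.
Proof.
move=> C0 fC; set B := eball c r.
have mB : measurable B by apply: measurable_open => //; exact: open_eball.
have Boo : (leb B < +oo)%E.
  apply: (@le_lt_trans _ _ (leb (cube (c - const_mx `|r|) (2 * `|r|)))).
    apply: (le_outer_measure lebesgue_outer) => y yB.
    by apply: eball_subset_cube; rewrite /eball/=; apply: (lt_le_trans yB); exact: ler_norm.
  by rewrite leb_cube ?ltry// mulr_ge0.
have B0 : (0 <= leb B)%E by exact: measure_ge0.
have [v Bv] : exists v, leb B = v%:E by exists (fine (leb B)); rewrite fineK// ge0_fin_numE.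
have iB : (\int[leb]_(x in B) `|f x| <= C%:E * leb B)%E.
  have <- : (\int[leb]_(x in B) C%:E = C%:E * leb B)%E.
    exact: (integral_cst leb mB C%:E).
  exact: ge0_le_integral_nomeas.
rewrite /avg; move: iB B0; rewrite Bv lee_fin => iB.
rewrite le_eqVlt => /orP[/eqP v0|v0]; last first.
  by rewrite inver gt_eqF// lee_pdivrMl// muleC.
(* For a null ball the inverse of the measure is [+oo], but the integral is 0 and the product is 0
   by convention. *)
rewrite -v0 mule0 in iB.
have -> : (\int[leb]_(x in B) `|f x| = 0)%E by apply/eqP; rewrite eq_le iB integral_ge0.
by rewrite mule0 lee_fin.
Qed.

Lemma multi_maximal_ge0 (m : nat) (f : 'I_m -> 'rV[R]_n -> \bar R) x :
  (0 <= multi_maximal f x)%E.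
Proof.
apply: (@le_trans _ _ (\prod_(i < m) avg (eball x 1) (f i))%E).
  by apply: prode_ge0 => i _; exact: avg_ge0.
apply: ereal_sup_ubound; exists (eball x 1) => //; split; first by exists x, 1.
rewrite /eball/= /enorm big1 ?sqrtr0// => i _.
by rewrite !mxE subrr expr0n.
Qed.

Definition rmulti_maximal (m : nat) (f : 'I_m -> 'rV[R]_n -> R) : 'rV[R]_n -> R :=
  fun x => fine (multi_maximal (fun i => EFin \o f i) x).

Lemma rmulti_maximalE (m : nat) (f : 'I_m -> 'rV[R]_n -> R) :
  (forall i, bounded_measurable (f i)) ->
  EFin \o rmulti_maximal f = multi_maximal (fun i => EFin \o f i).
Proof.
move=> bf; apply/funext => x /=; rewrite /rmulti_maximal fineK//.
rewrite ge0_fin_numE ?multi_maximal_ge0//.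
have /choice[C fC] := fun i => (bf i).2.
have C0 i : 0 <= C i by exact: le_trans (fC i 0).
apply: (@le_lt_trans _ _ (\prod_(i < m) C i)%:E); last exact: ltry.
apply: ge_ereal_sup => _ [B [[y [r [_ ->]]] _] <-].
rewrite -prodEFin; apply: lee_prode => i _; first exact: avg_ge0.
by apply: avg_eball_le_cst => // z; rewrite lee_fin.
Qed.

Lemma measurable_rmulti_maximal (m : nat) (f : 'I_m -> 'rV[R]_n -> R) :
  (forall i, bounded_measurable (f i)) -> measurable_fun setT (rmulti_maximal f).
Proof.
move=> bf; apply/measurable_EFinP; rewrite (rmulti_maximalE bf).
exact: measurable_multi_maximal.
Qed.

Lemma rmulti_maximal_ge0 (m : nat) (f : 'I_m -> 'rV[R]_n -> R) x : 0 <= rmulti_maximal f x.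
Proof. by apply: fine_ge0; exact: multi_maximal_ge0. Qed.

End BoundedMeasurable.

(** * Dyadic cubes and disjoint families *)

Section Dyadic.
Context {R : realType} {n : nat} (hn : (0 < n)%N).
Implicit Types (c x : 'rV[R]_n) (h : R) (v w : 'I_n -> nat) (Q P : set 'rV[R]_n).

Lemma cube_inj c c' h h' : 0 < h -> 0 < h' -> cube c h = cube c' h' -> c = c' /\ h = h'.
Proof.
move=> h0 h'0 e.
have le_corner (d d' : 'rV[R]_n) (k k' : R) : 0 < k -> cube d k `<=` cube d' k' -> forall i, d' ord0 i <= d ord0 i.
  move=> k0 dd i; have /dd/(_ i)/andP[] // : cube d k d.
  by move=> j; rewrite !mxE lexx ltrDl.
have cc : c = c'.
  apply/rowP => i; apply: le_anti; apply/andP; split.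
    by apply: (le_corner c' c h' h) => //; rewrite e.
  by apply: (le_corner c c' h h') => //; rewrite e.
split => //; have le_side (k k' : R) : 0 < k -> 0 < k' -> cube c k `<=` cube c k' -> k <= k'.
  move=> k0 k'0 kk; rewrite leNgt; apply/negP => k'k.
  have /kk/(_ (Ordinal hn))/andP[_] : cube c k (c + const_mx k').
    by move=> j; rewrite !mxE ltrD2l k'k lerDl ltW.
  by rewrite !mxE ltxx.
by apply: le_anti; rewrite !le_side// e cc.
Qed.

(** The index is a vector of natural numbers and its bound [v i < 2 ^ k] is kept apart, so that
    changing the generation requires no casts between ordinals. *)
Definition dcube c h (k : nat) v : set 'rV[R]_n :=
  cube (c + \row_i (h / 2 ^+ k * (v i)%:R)) (h / 2 ^+ k).

(** After rescaling, membership places each coordinate in an integer interval, so that the dyadic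
    geometry below reduces to inequalities between natural numbers. *)
Lemma dcubeP c h k v x : 0 < h -> dcube c h k v x <->
  forall i, (v i)%:R <= (x ord0 i - c ord0 i) / h * 2 ^+ k < (v i).+1%:R.
Proof.
move=> h0; have hk : 0 < h / 2 ^+ k by rewrite divr_gt0// exprn_gt0.
have E t : t / h * 2 ^+ k = t / (h / 2 ^+ k) by rewrite invf_div mulrA mulrAC.
split => H i; have := H i; rewrite !mxE E ler_pdivlMr// ltr_pdivrMr// -natr1 => /andP[h1 h2];
  apply/andP; split; lra.
Qed.

Lemma dyadic_subcubesP c h P : 0 < h -> dyadic_subcubes (cube c h) P <->
  exists k v, (forall i, v i < 2 ^ k)%N /\ P = dcube c h k v.
Proof.
move=> h0; split.
  move=> [c' [h' [k [v [h'0 /(cube_inj h0 h'0)[<- <-] ->]]]]].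
  by exists k, (fun i => nat_of_ord (v i)); split.
move=> [k [v [vk ->]]]; exists c, h, k, (fun i => Ordinal (vk i)); split => //.
Qed.

(** A common point forces [v * 2 ^ (k' - k) <= v' < (v + 1) * 2 ^ (k' - k)] in each coordinate, the
    quantities being integers, and this is the inclusion. *)
Lemma dcube_nested c h k k' v v' : 0 < h -> (k <= k')%N ->
  (dcube c h k v `&` dcube c h k' v') !=set0 -> dcube c h k' v' `<=` dcube c h k v.
Proof.
move=> h0 kk' [x [/(dcubeP _ _ _ _ h0) xv /(dcubeP _ _ _ _ h0) xv']] y /(dcubeP _ _ _ _ h0) yv'.
apply/(dcubeP _ _ _ _ h0) => i.
have E t : t / h * 2 ^+ k' = (t / h * 2 ^+ k) * (2 ^ (k' - k))%:R.
  by rewrite natrX -[RHS]mulrA -exprD subnKC.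
have d0 : 0 < (2 ^ (k' - k))%:R :> R by rewrite ltr0n expn_gt0.
have /andP[x1 x2] := xv i; have := xv' i; have := yv' i; rewrite !E => /andP[y3 y4] /andP[x3 x4].
have h1 : (v i * 2 ^ (k' - k) <= v' i)%N.
  by rewrite -ltnS -(ltr_nat R) natrM (le_lt_trans _ x4)// ler_pM2r.
have h2 : ((v' i).+1 <= (v i).+1 * 2 ^ (k' - k))%N.
  by rewrite -(ltr_nat R) natrM (le_lt_trans x3)// ltr_pM2r.
apply/andP; split.
  by rewrite -(ler_pM2r d0) (le_trans _ y3)// -natrM ler_nat.
by rewrite -(ltr_pM2r d0) (lt_le_trans y4)// -natrM ler_nat.
Qed.

Lemma dyadic_subcubes_nested Q P1 P2 : dyadic_subcubes Q P1 -> dyadic_subcubes Q P2 ->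
  (P1 `&` P2) !=set0 -> P1 `<=` P2 \/ P2 `<=` P1.
Proof.
move=> D1 D2; have [c [h [_ [_ [h0 Qch _]]]]] := D1; move: D1 D2; rewrite Qch.
move=> /(dyadic_subcubesP _ _ h0)[k [v [_ ->]]] /(dyadic_subcubesP _ _ h0)[k' [v' [_ ->]]] vv'.
have [kk'|/ltnW kk'] := leqP k k'; first by right; exact: dcube_nested.
by left; apply: dcube_nested => //; rewrite setIC.
Qed.

Lemma dcube_subset c h k v : 0 < h -> (forall i, v i < 2 ^ k)%N ->
  dcube c h k v `<=` cube c h.
Proof.
move=> h0 vk x /(dcubeP _ _ _ _ h0) xv i; have /andP[h1 h2] := xv i.
have k0 : 0 < 2 ^+ k :> R by rewrite exprn_gt0.
have t0 : 0 <= (x ord0 i - c ord0 i) / h * 2 ^+ k by rewrite (le_trans _ h1).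
have t1 : (x ord0 i - c ord0 i) / h * 2 ^+ k < 2 ^+ k.
  by rewrite (lt_le_trans h2)// -natrX ler_nat.
move: t0; rewrite pmulr_lge0// pmulr_lge0 ?invr_gt0// subr_ge0 => ->.
by move: t1; rewrite gtr_pMl// ltr_pdivrMr// mul1r !mxE => ?; lra.
Qed.

Lemma dyadic_subcubes_is_cube Q P : dyadic_subcubes Q P -> is_cube P.
Proof.
move=> [c [h [k [v [h0 _ ->]]]]]; exists (c + \row_i (h / 2 ^+ k * (v i)%:R)), (h / 2 ^+ k).
by rewrite divr_gt0// exprn_gt0.
Qed.

Lemma dyadic_subcubes_subset Q P : dyadic_subcubes Q P -> P `<=` Q.
Proof.
move=> D; have [c [h [_ [_ [h0 Qch _]]]]] := D; move: D; rewrite Qch.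
by move=> /(dyadic_subcubesP _ _ h0)[k [v [vk ->]]]; exact: dcube_subset.
Qed.

Lemma dcube_exists c h k x : 0 < h -> cube c h x ->
  exists v, (forall i, v i < 2 ^ k)%N /\ dcube c h k v x.
Proof.
move=> h0 xQ; exists (fun i => Num.truncn ((x ord0 i - c ord0 i) / h * 2 ^+ k)).
have H i : 0 <= (x ord0 i - c ord0 i) / h * 2 ^+ k < 2 ^+ k.
  have := xQ i; rewrite !mxE => /andP[h1 h2].
  rewrite mulr_ge0 ?divr_ge0 ?subr_ge0 ?(ltW h0)//= gtr_pMl ?exprn_gt0//.
  by rewrite ltr_pdivrMr// mul1r; lra.
split.
  move=> i; have /andP[t0 t1] := H i.
  by rewrite -(ltr_nat R) natrX (le_lt_trans _ t1)// truncn_le.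
apply/dcubeP => // i; have /andP[t0 t1] := H i.
exact: truncn_itv.
Qed.

Lemma dyadic_parent Q P : dyadic_subcubes Q P -> P = Q \/
  exists P', [/\ dyadic_subcubes Q P', P `<` P' & leb P' = ((2 ^+ n)%:E * leb P)%E].
Proof.
move=> D; have [c [h [_ [_ [h0 Qch _]]]]] := D; move: D; rewrite Qch.
move=> /(dyadic_subcubesP _ _ h0)[[|k] [v [vk ->]]].
  left; rewrite /dcube expr0 divr1; congr cube; apply/rowP => i.
  by rewrite !mxE; have := vk i; rewrite ltnS leqn0 => /eqP ->; rewrite mulr0 addr0.
right; exists (dcube c h k (fun i => (v i)./2)); split.
- apply/dyadic_subcubesP => //; exists k, (fun i => (v i)./2); split => // i.
  by have := vk i; rewrite expnS; lia.
- rewrite properEneq; split.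
    apply/eqP => /cube_inj[]; rewrite ?divr_gt0 ?exprn_gt0// => _.
    move/mulfI => /(_ (lt0r_neq0 h0)) /invr_inj; rewrite exprS.
    by have : 0 < 2 ^+ k :> R; [rewrite exprn_gt0|lra].
  apply: dcube_nested => //.
  pose x := c + \row_i (h / 2 ^+ k.+1 * (v i)%:R).
  have xv : dcube c h k.+1 v x.
    by move=> i; rewrite !mxE lexx ltrDl divr_gt0// exprn_gt0.
  exists x; split => //.
  apply/dcubeP => // i; rewrite !mxE addrAC subrr add0r.
  have -> : h / 2 ^+ k.+1 * (v i)%:R / h * 2 ^+ k = (v i)%:R / 2 :> R.
    by rewrite exprS; field; rewrite gt_eqF//= gt_eqF// exprn_gt0.
  rewrite ler_pdivlMr// ltr_pdivrMr// -!natrM ler_nat ltr_nat.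
  by apply/andP; split; lia.
- rewrite !leb_cube ?divr_ge0 ?(ltW h0)// ?exprn_ge0//.
  by rewrite -EFinM -exprMn; congr ((_ ^+ _)%:E); rewrite exprS; field; rewrite gt_eqF// exprn_gt0.
Qed.

Lemma dyadic_subcubes_countable Q : countable (dyadic_subcubes Q).
Proof.
have [[P [c [h [k [v [h0 Qch _]]]]]]|] := pselect (dyadic_subcubes Q !=set0); last first.
  by move=> /set0P/negP; rewrite negbK => /eqP ->; exact: countable0.
rewrite Qch; pose F (kv : nat * {ffun 'I_n -> nat}) := dcube c h kv.1 kv.2.
apply: (@sub_countable _ _ _ (\bigcup_kv [set F kv])).
  apply: subset_card_le => _ /(dyadic_subcubesP _ _ h0)[j [w [_ ->]]].
  exists (j, [ffun i => w i]) => //.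
  by rewrite /F/=; congr dcube; apply/funext => i; rewrite ffunE.
by apply: bigcup_countable => [|a _]; [exact: countableP|exact: countable1].
Qed.

Lemma dyadic_lattice_nested (D : set (set 'rV[R]_n)) P1 P2 : dyadic_lattice D ->
  D P1 -> D P2 -> (P1 `&` P2) !=set0 -> P1 `<=` P2 \/ P2 `<=` P1.
Proof.
by move=> [_ _ DD _] D1 D2; have [Q [_]] := DD _ _ D1 D2; exact: dyadic_subcubes_nested.
Qed.

(* Every cube of the lattice is a dyadic subcube of some [Q] having a fixed
   [Q0] among its dyadic subcubes, and there are countably many such [Q]. *)
Lemma dyadic_lattice_countable (D : set (set 'rV[R]_n)) : dyadic_lattice D -> countable D.
Proof.
move=> [_ _ DD _].
have [[Q0 DQ0]|] := pselect (D !=set0); last first.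
  by move=> /set0P/negP; rewrite negbK => /eqP ->; exact: countable0.
have [Q1 [_ +  _]] := DD _ _ DQ0 DQ0; move/dyadic_subcubes_is_cube => [c [h [h0 Q0ch]]].
(* The cube in which the fixed cube has generation [a.1] and index [a.2]: its corner and side can be
   recovered from these data. *)
pose par (a : nat * {ffun 'I_n -> nat}) : set 'rV[R]_n :=
  cube (c - \row_i (h * (a.2 i)%:R)) (h * 2 ^+ a.1).
apply: (@sub_countable _ _ _ (\bigcup_(a in [set: nat * {ffun 'I_n -> nat}]) dyadic_subcubes (par a))).
  apply: subset_card_le => P DP.
  have [Q [_ QQ0 QP]] := DD _ _ DQ0 DP.
  have [c' [h' [k [v [h'0 Qch' Q0E]]]]] := QQ0.
  have h'k : 0 < h' / 2 ^+ k by rewrite divr_gt0// exprn_gt0.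
  have [cE hE] : c = c' + \row_i (h' / 2 ^+ k * (v i)%:R) /\ h = h' / 2 ^+ k.
    by apply: cube_inj => //; rewrite -Q0ch Q0E.
  exists (k, [ffun i => nat_of_ord (v i)]) => //.
  rewrite (_ : par _ = Q)// Qch' /par/=; congr cube.
    by apply/rowP => i; rewrite cE hE !mxE ffunE; lra.
  by rewrite hE divfK// gt_eqF// exprn_gt0.
by apply: bigcup_countable => [|a _]; [exact: countableP|exact: dyadic_subcubes_countable].
Qed.

End Dyadic.

Lemma measurable_countable_family d (T : measurableType d) (F : set (set T)) :
  countable F -> (forall A, F A -> measurable A) -> measurable (\bigcup_(A in F) A).
Proof.
move=> /countable_injP[f finj] mF.
pose E k := [set x | exists A, [/\ F A, f A = k & A x]].
have -> : \bigcup_(A in F) A = \bigcup_k E k.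
  apply/seteqP; split => x; first by move=> [A FA Ax]; exists (f A) => //; exists A.
  by move=> [k _ [A [FA _ Ax]]]; exists A.
apply: bigcupT_measurable => k.
have [[A [FA fA]]|nA] := pselect (exists A, F A /\ f A = k).
  have -> : E k = A; last exact: mF.
  apply/seteqP; split => x; last by exists A.
  move=> [B [FB fB Bx]]; rewrite (_ : A = B)//.
  by apply: finj; rewrite ?inE// fA fB.
have -> : E k = set0 by rewrite -subset0 => x [A [FA fA _]]; apply: nA; exists A.
exact: measurable0.
Qed.

Section DisjointFamily.
Context d (T : measurableType d) (R : realType) (mu : {measure set T -> \bar R}).

Definition disjoint_family (F : set (set T)) : Prop :=
  forall A B, F A -> F B -> (A `&` B) !=set0 -> A = B.

Lemma disjoint_family_seq (F : set (set T)) : countable F -> disjoint_family F ->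
  exists E : nat -> set T, [/\ trivIset setT E,
    forall k, F (E k) \/ E k = set0 & \bigcup_k E k = \bigcup_(A in F) A].
Proof.
move=> /countable_injP[f finj] dF.
pose E k := [set x | exists A, [/\ F A, f A = k & A x]].
have EA A : F A -> E (f A) = A.
  move=> FA; apply/seteqP; split => x; last by exists A.
  move=> [B [FB fBA Bx]]; rewrite (_ : A = B)//.
  by apply: finj; rewrite ?inE.
exists E; split.
- move=> i j _ _ [x [[A [FA <- Ax]] [B [FB <- Bx]]]]; congr f.
  by apply: dF => //; exists x.
- move=> k; have [[x [A [FA <- Ax]]]|] := pselect (E k !=set0).
    by left; rewrite EA.
  by move=> /set0P/negP; rewrite negbK => /eqP; right.
- apply/seteqP; split => x.
    by move=> [k _ [A [FA _ Ax]]]; exists A.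
  by move=> [A FA Ax]; exists (f A) => //; rewrite EA.
Qed.

Lemma le_integral_disjoint_family (F : set (set T)) (f g : T -> \bar R) :
  countable F -> disjoint_family F -> (forall A, F A -> measurable A) ->
  measurable_fun setT f -> measurable_fun setT g ->
  (forall x, 0 <= f x)%E -> (forall x, 0 <= g x)%E ->
  (forall A, F A -> \int[mu]_(x in A) f x <= \int[mu]_(x in A) g x)%E ->
  (\int[mu]_(x in \bigcup_(A in F) A) f x <= \int[mu]_(x in \bigcup_(A in F) A) g x)%E.
Proof.
move=> cF dF mF mf mg f0 g0 fg; have [E [tE FE UE]] := disjoint_family_seq cF dF.
have mE k : measurable (E k) by case: (FE k) => [/mF//|->].
rewrite -UE !ge0_integral_bigcup//; last 2 first.
- by apply: measurable_funS mg => //; exact: subsetT.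
- by apply: measurable_funS mf => //; exact: subsetT.
apply: lee_nneseries => [k _ _|k _]; first exact: integral_ge0.
by case: (FE k) => [/fg//|->]; rewrite !integral_set0.
Qed.

Lemma le_integral_bigcup (E : nat -> set T) (D : set T) (f : T -> \bar R) :
  (forall k, measurable (E k)) -> measurable_fun setT f -> (forall x, 0 <= f x)%E ->
  D `<=` \bigcup_k E k ->
  (\int[mu]_(x in D) f x <= \sum_(0 <= k <oo) \int[mu]_(x in E k) f x)%E.
Proof.
move=> mE mf f0 DE; rewrite integral_mkcond.
under eq_eseriesr do rewrite integral_mkcond.
rewrite -integral_nneseries//; last 2 first.
- by move=> k; apply/(measurable_restrictT _ (mE k)); apply: measurable_funS mf => //; exact: subsetT.
- by move=> k x _; exact: erestrict_ge0.
apply: ge0_le_integral_nomeas => x _; first exact: erestrict_ge0.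
have h0 : (0 <= \sum_(0 <= k <oo) (f \_ (E k)) x)%E.
  by apply: nneseries_ge0 => k _ _; exact: erestrict_ge0.
rewrite [leLHS]patchE; case: ifPn => [/set_mem/DE[k _ Ekx]|_]; last exact: h0.
rewrite (@nneseriesD1 _ _ k)//=; last by move=> j _; exact: erestrict_ge0.
rewrite [in leRHS]patchE mem_set// leeDl//.
by apply: nneseries_ge0 => j _ _; exact: erestrict_ge0.
Qed.

End DisjointFamily.

(* A nonnegative function whose averages over the dyadic cubes meeting [E] are
   at most [lam] is at most [lam] a.e. on [E]: [E] is covered by boxes of total
   volume close to [leb E], and each box by the dyadic cubes of a late generation
   that it meets.  This avoids the Lebesgue differentiation theorem. *)
Section DyadicCovering.
Context {R : realType} {n : nat} (hn : (0 < n)%N).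
Variables (c : 'rV[R]_n) (h : R) (f : 'rV[R]_n -> \bar R) (E : set 'rV[R]_n) (lam : R).
Hypotheses (h0 : 0 < h) (lam0 : 0 < lam) (mf : measurable_fun setT f)
  (f0 : forall x, (0 <= f x)%E) (mE : measurable E) (EQ : E `<=` cube c h)
  (avgf : forall P, dyadic_subcubes (cube c h) P -> (P `&` E) !=set0 ->
    (\int[leb]_(x in P) f x <= lam%:E * leb P)%E).

Let integral_box_le_enlarged (a b : 'rV[R]_n) (N : nat) :
  (forall i, a ord0 i <= b ord0 i) ->
  (\int[leb]_(x in E `&` box a b) f x <=
   (lam * \prod_i (b ord0 i - a ord0 i + 2 * (h / 2 ^+ N)))%:E)%E.
Proof.
move=> ab; have hN : 0 < h / 2 ^+ N by rewrite divr_gt0// exprn_gt0.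
pose F : set (set 'rV[R]_n) := [set P | (exists v, (forall i, v i < 2 ^ N)%N /\ P = dcube c h N v) /\
  (P `&` (E `&` box a b)) !=set0].
have FD : F `<=` dyadic_subcubes (cube c h).
  by move=> P [[v [vN ->]] _]; apply/dyadic_subcubesP => //; exists N, v.
have cF : countable F.
  by apply: (sub_countable (subset_card_le FD)); exact: dyadic_subcubes_countable.
have dF : disjoint_family F.
  move=> A B [[v [_ ->]] _] [[w [_ ->]] _] vw.
  apply/seteqP; split; apply: dcube_nested => //; by rewrite setIC.
have mF A : F A -> measurable A.
  by move=> /FD /dyadic_subcubes_is_cube; exact: is_cube_measurable.
have mU := measurable_countable_family cF mF.
apply: (@le_trans _ _ (\int[leb]_(x in \bigcup_(A in F) A) f x)%E).
  apply: ge0_subset_integral => //.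
  - by apply: measurableI => //; exact: measurable_box.
  - by apply: measurable_funS mf => //; exact: subsetT.
  - move=> x [Ex xab]; have [v [vN xv]] := dcube_exists N h0 (EQ Ex).
    exists (dcube c h N v) => //; split; first by exists v.
    by exists x.
apply: (@le_trans _ _ (\int[leb]_(x in \bigcup_(A in F) A) (cst lam%:E x))%E).
  apply: le_integral_disjoint_family => //.
  - by move=> x; rewrite lee_fin ltW.
  - move=> A FA; have -> : (\int[leb]_(x in A) cst lam%:E x = lam%:E * leb A)%E.
      by apply: integral_cst; exact: mF.
    apply: avgf; first exact: FD.
    by case: FA => _ [x [Ax [Ex _]]]; exists x.
have -> : (\int[leb]_(x in \bigcup_(A in F) A) cst lam%:E x = lam%:E * leb (\bigcup_(A in F) A))%E.
  exact: integral_cst.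
rewrite EFinM; apply: lee_wpmul2l; first by rewrite lee_fin ltW.
(* A cube of generation [N] that meets the box stays within one side length of it. *)
pose a' : 'rV[R]_n := a - const_mx (h / 2 ^+ N).
pose b' : 'rV[R]_n := b + const_mx (h / 2 ^+ N).
apply: (@le_trans _ _ (leb (box a' b'))).
  apply: (le_outer_measure lebesgue_outer) => x [_ [[v [_ ->]] [y [yv [_ yab]]]] xv] i.
  have := xv i; have := yv i; have := yab i; rewrite !mxE => /andP[h1 h2] /andP[h3 h4] /andP[h5 h6].
  by apply/andP; split; lra.
rewrite leb_box//; last by move=> i; rewrite !mxE; have := ab i; lra.
by rewrite lee_fin; apply: ler_prod => i _; rewrite !mxE; move: (ab i) => abi; apply/andP; split; lra.
Qed.

Let integral_box_le (a b : 'rV[R]_n) : (forall i, a ord0 i <= b ord0 i) ->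
  (\int[leb]_(x in E `&` box a b) f x <= (lam * \prod_i (b ord0 i - a ord0 i))%:E)%E.
Proof.
move=> ab.
have hN : (fun N : nat => 2 * (h / 2 ^+ N)) @ \oo --> (0 : R).
  have -> : 0 = 2 * (h * 0) :> R by rewrite !mulr0.
  apply: cvgM; first exact: cvg_cst.
  apply: cvgM; first exact: cvg_cst.
  under eq_cvg do rewrite -exprVn.
  by apply: cvg_expr; rewrite ger0_norm ?invr_ge0// invf_lt1// ltr1n.
have cv : (fun N => lam * \prod_i (b ord0 i - a ord0 i + 2 * (h / 2 ^+ N))) @ \oo -->
    lam * \prod_i (b ord0 i - a ord0 i).
  apply: cvgM; first exact: cvg_cst.
  apply: (@cvg_big R^o _ *%R 1 predT); first exact: mul_continuous.
  move=> i _; rewrite -[X in _ --> X]addr0.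
  by apply: cvgD => //; exact: cvg_cst.
have cv' : (fun N => (lam * \prod_i (b ord0 i - a ord0 i + 2 * (h / 2 ^+ N)))%:E) @ \oo -->
    (lam * \prod_i (b ord0 i - a ord0 i))%:E.
  by apply/fine_cvgP; split; [exact: nearW|exact: cv].
rewrite -(cvg_lim _ cv')//; apply: lime_ge; first by apply/cvg_ex; eexists; exact: cv'.
by apply: nearW => N; exact: integral_box_le_enlarged.
Qed.

Lemma integral_le_dyadic_avg : (\int[leb]_(x in E) f x <= lam%:E * leb E)%E.
Proof.
rewrite -lee_pdivrMl//; apply: lebesgue_outer_coverP => // a b ab Eab.
rewrite lee_pdivrMl//.
apply: (@le_trans _ _ (\sum_(0 <= k <oo) \int[leb]_(x in E `&` box (a k) (b k)) f x)%E).
  apply: le_integral_bigcup => //.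
    by move=> k; apply: measurableI => //; exact: measurable_box.
  by move=> x Ex; have [k _ xk] := Eab _ Ex; exists k.
rewrite -nneseriesZl//; last first.
  by move=> k _; rewrite lee_fin prodr_ge0// => i _; rewrite subr_ge0.
apply: lee_nneseries => k _; first by move=> _; exact: integral_ge0.
by rewrite -EFinM; exact: integral_box_le.
Qed.

End DyadicCovering.

(** On the part of [E] where [f > lam], the integral of [f] is at most [lam] times the measure,
    which is finite. Cancelling it shows that the integral of the positive function [f - lam] is 0,
    so this part is null. *)
Lemma dyadic_avg_ae_le (R : realType) (n : nat) (hn : (0 < n)%N) (c : 'rV[R]_n) (h : R)
    (f : 'rV[R]_n -> R) (E : set 'rV[R]_n) (lam : R) :
  0 < h -> 0 < lam -> measurable_fun setT f -> (forall x, 0 <= f x) ->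
  measurable E -> E `<=` cube c h ->
  (forall P, dyadic_subcubes (cube c h) P -> (P `&` E) !=set0 ->
    (avg P (EFin \o f) <= lam%:E)%E) ->
  leb (E `&` [set x | lam < f x]) = 0%E.
Proof.
move=> h0 lam0 mf f0 mE EQ avgf; set E' := E `&` _.
have mE' : measurable E'.
  rewrite /E' -[X in _ `&` X]setTI; apply: measurableI => //.
  have mf' : measurable_fun setT (EFin \o f) by exact/measurable_EFinP.
  exact: (emeasurable_fun_o_infty measurableT mf' lam%:E).
have fE x : (`|(EFin \o f) x| = (EFin \o f) x)%E by rewrite /= ger0_norm.
have E'oo : (leb E' < +oo)%E.
  apply: (@le_lt_trans _ _ (leb (cube c h))).
    by apply: (le_outer_measure lebesgue_outer) => x [/EQ].
  by rewrite leb_cube ?ltry// ltW.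
have : (\int[leb]_(x in E') (EFin \o f) x <= lam%:E * leb E')%E.
  apply: (@integral_le_dyadic_avg _ _ hn c h _ _ lam h0 lam0 _ _ mE').
  - exact/measurable_EFinP.
  - by move=> x; rewrite lee_fin.
  - by move=> x [/EQ].
  - move=> P DP [x [Px [Ex _]]].
    have /(is_cube_avg hn (EFin \o f)) e := dyadic_subcubes_is_cube DP.
    under eq_integral do rewrite -fE.
    rewrite -e muleC; apply: lee_wpmul2r; first exact: measure_ge0.
    by apply: avgf => //; exists x.
have -> : (lam%:E * leb E' = \int[leb]_(x in E') lam%:E)%E.
  by apply/esym; exact: (integral_cst leb mE' lam%:E).
have mfE' : measurable_fun E' f by apply: measurable_funS mf => //; exact: subsetT.
have -> : (\int[leb]_(x in E') (EFin \o f) x =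
    \int[leb]_(x in E') lam%:E + \int[leb]_(x in E') `|(f x - lam)%:E|)%E.
  rewrite -(ge0_integralD leb mE' (f1 := cst lam%:E) (f2 := fun x => `|(f x - lam)%:E|%E)).
  - apply: eq_integral => x /set_mem[_ /= fx]; rewrite -EFinD ger0_norm ?subr_ge0 ?ltW//.
    by congr (_%:E); lra.
  - by move=> x _; rewrite lee_fin ltW.
  - exact: measurable_cst.
  - by move=> x _; exact: abse_ge0.
  - apply: measurableT_comp; first exact: abse_measurable.
    by apply/measurable_EFinP; exact: measurable_funB.
have lamE : (\int[leb]_(x in E') lam%:E = lam%:E * leb E')%E.
  exact: (integral_cst leb mE' lam%:E).
have lamfin : (\int[leb]_(x in E') lam%:E)%E \is a fin_num.
  by rewrite lamE fin_numM// ge0_fin_numE// measure_ge0.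
rewrite -[leRHS]adde0 leeD2lE// => le0.
have /(ae_eq_integral_abs leb mE') : (\int[leb]_(x in E') `|(f x - lam)%:E| = 0)%E.
  by apply/eqP; rewrite eq_le le0 integral_ge0.
have mfl : measurable_fun E' (fun x => (f x - lam)%:E).
  by apply/measurable_EFinP; exact: measurable_funB.
move=> /(_ mfl) [N [mN N0 sub]].
apply/eqP; rewrite eq_le measure_ge0 andbT -N0.
apply: (le_outer_measure lebesgue_outer) => x E'x; apply: sub => /= /(_ E'x)[] /eqP.
by rewrite subr_eq0 => /eqP fx; case: E'x => _ /=; rewrite fx ltxx.
Qed.

(** * Integrals of nonnegative real functions *)

Section RealIntegrals.
Context d (T : measurableType d) (R : realType) (mu : {measure set T -> \bar R}).
Implicit Types (A B : set T) (f g : T -> R).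

Lemma measurable_EFin_restr A f : measurable_fun setT f -> measurable_fun A (EFin \o f).
Proof.
by move=> mf; apply/measurable_EFinP; apply: measurable_funS mf => //; exact: subsetT.
Qed.

Lemma le_integral_subset_EFin A B f : measurable A -> measurable B ->
  measurable_fun setT f -> (forall x, 0 <= f x) -> A `<=` B ->
  (\int[mu]_(x in A) (f x)%:E <= \int[mu]_(x in B) (f x)%:E)%E.
Proof.
move=> mA mB mf f0 AB; apply: (ge0_subset_integral mu mA mB _ _ AB).
  exact: measurable_EFin_restr.
by move=> x _; rewrite lee_fin.
Qed.

Lemma ge0_integralD_real A f g : measurable A -> measurable_fun setT f -> measurable_fun setT g ->
  (forall x, 0 <= f x) -> (forall x, 0 <= g x) ->
  (\int[mu]_(x in A) (f x + g x)%:E =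
   \int[mu]_(x in A) (f x)%:E + \int[mu]_(x in A) (g x)%:E)%E.
Proof.
move=> mA mf mg f0 g0.
apply: (ge0_integralD mu mA (f1 := EFin \o f) (f2 := EFin \o g)).
- by move=> x _; rewrite /= lee_fin.
- exact: measurable_EFin_restr.
- by move=> x _; rewrite /= lee_fin.
- exact: measurable_EFin_restr.
Qed.

Lemma ge0_integralZl_real A f (k : R) : measurable A -> measurable_fun setT f ->
  (forall x, 0 <= f x) -> 0 <= k ->
  (\int[mu]_(x in A) (k * f x)%:E = k%:E * \int[mu]_(x in A) (f x)%:E)%E.
Proof.
move=> mA mf f0 k0; apply: (@ge0_integralZl _ _ _ mu A mA (EFin \o f) _ k%:E).
- exact: measurable_EFin_restr.
- by move=> x _; rewrite /= lee_fin.
- by rewrite lee_fin.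
Qed.

Lemma ge0_integral_setU_real A B f : measurable A -> measurable B -> [disjoint A & B] ->
  measurable_fun setT f -> (forall x, 0 <= f x) ->
  (\int[mu]_(x in A `|` B) (f x)%:E =
   \int[mu]_(x in A) (f x)%:E + \int[mu]_(x in B) (f x)%:E)%E.
Proof.
move=> mA mB AB mf f0; apply: (ge0_integral_setU mu mA mB (f := EFin \o f)) => //.
- exact: measurable_EFin_restr.
- by move=> x _; rewrite /= lee_fin.
Qed.

Lemma integral_indic_real A B f :
  (\int[mu]_(x in A) (f x * \1_B x)%:E = \int[mu]_(x in A `&` B) (f x)%:E)%E.
Proof.
rewrite setIC [RHS]integral_mkcond [LHS]integral_mkcond.
apply: eq_integral => x _; rewrite !patchE in_setI indicE.
by case: (x \in B); case: (x \in A); rewrite ?mulr1 ?mulr0.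
Qed.

End RealIntegrals.

(** * Oscillations and iterated maximal functions *)

Section Oscillation.
Context {R : realType} {n : nat} (hn : (0 < n)%N).
Local Notation rV := 'rV[R]_n.
Implicit Types (Q P : set rV) (x : rV) (g : rV -> R).

Lemma integral_cst_set (A : set rV) (k : R) : measurable A ->
  (\int[leb]_(x in A) k%:E = k%:E * leb A)%E.
Proof. by move=> mA; exact: integral_cst. Qed.

Lemma avg_le_rmaximal_integral Q (V : set rV) g : is_cube Q -> bounded_measurable g ->
  measurable V -> V `<=` Q ->
  (avg Q (EFin \o g) * leb V <= \int[leb]_(x in V) (rmaximal g x)%:E)%E.
Proof.
move=> cQ bg mV VQ; have [_ [C gC]] := bg.
have aC : (avg Q (EFin \o g) <= C%:E)%E.
  by apply: (avg_le_cst hn cQ) => x _; rewrite /= lee_fin.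
have [a aE] : exists a, avg Q (EFin \o g) = a%:E.
  exists (fine (avg Q (EFin \o g))); rewrite fineK// ge0_fin_numE ?avg_ge0//.
  by rewrite (le_lt_trans aC)// ltry.
rewrite aE -integral_cst_set//; apply: ge0_le_integral_nomeas => x Vx.
  by rewrite -aE; exact: avg_ge0.
by rewrite -aE; apply: avg_le_rmaximal => //; exact: VQ.
Qed.

(** At every point of [V] the maximal function is at least the average over [Q]. An integral over
    [Q] can thus be charged to a large part [V] of [Q], at the price of one maximal operator. *)
Lemma integral_le_rmaximal Q (V : set rV) g : is_cube Q -> bounded_measurable g ->
  (forall x, 0 <= g x) -> measurable V -> V `<=` Q -> (leb Q <= 2%:E * leb V)%E ->
  (\int[leb]_(x in Q) (g x)%:E <= 2%:E * \int[leb]_(x in V) (rmaximal g x)%:E)%E.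
Proof.
move=> cQ bg g0 mV VQ QV.
have -> : (\int[leb]_(x in Q) (g x)%:E = avg Q (EFin \o g) * leb Q)%E.
  rewrite muleC (is_cube_avg hn _ cQ); apply: eq_integral => x _.
  by rewrite /= ger0_norm.
apply: (@le_trans _ _ (avg Q (EFin \o g) * (2%:E * leb V))%E).
  by apply: lee_wpmul2l => //; exact: avg_ge0.
rewrite muleCA; apply: lee_wpmul2l; first by rewrite lee_fin.
exact: avg_le_rmaximal_integral.
Qed.

(** Only averages over [Q] are compared with the maximal function, so the pointwise inequality
    [g <= M g] a.e., a differentiation theorem, is avoided. *)
Lemma integral_le_iter_rmaximal Q g k : is_cube Q -> bounded_measurable g ->
  (forall x, 0 <= g x) ->
  (\int[leb]_(x in Q) (g x)%:E <= \int[leb]_(x in Q) (iter k rmaximal g x)%:E)%E.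
Proof.
move=> cQ bg g0; elim: k => [//|k IH]; apply: (le_trans IH).
have bk := bounded_measurable_iter hn k bg.
have gk0 x : 0 <= iter k rmaximal g x by case: k {IH bk} => //= k; exact: rmaximal_ge0.
have -> : (\int[leb]_(x in Q) (iter k rmaximal g x)%:E =
    avg Q (EFin \o iter k rmaximal g) * leb Q)%E.
  rewrite muleC (is_cube_avg hn _ cQ); apply: eq_integral => x _.
  by rewrite /= ger0_norm.
by apply: avg_le_rmaximal_integral => //; exact: is_cube_measurable.
Qed.

Lemma iter_rmaximal_ge0 g k x : (forall x, 0 <= g x) -> 0 <= iter k rmaximal g x.
Proof. by move=> g0; case: k => //= k; exact: rmaximal_ge0. Qed.

Lemma is_cube_nonempty Q : is_cube Q -> Q !=set0.
Proof. by move=> [c [h [h0 ->]]]; exists c => i; rewrite !mxE lexx ltrDl. Qed.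

(* [psi Q] stands for [x |-> sum_s |b_s x - <b_s>_Q| / ||b_s||_BMO]; only the
   properties below of this function are used. *)
Variables (psi : set rV -> rV -> R) (L : R).
Hypotheses (L0 : 0 < L) (psi0 : forall Q x, 0 <= psi Q x)
  (mpsi : forall Q, measurable_fun setT (psi Q))
  (avg_psi : forall Q, is_cube Q -> (avg Q (EFin \o psi Q) <= L%:E)%E)
  (psi_sub : forall Q P t x, is_cube Q -> is_cube P -> P `<=` Q ->
    (avg P (EFin \o psi Q) <= t%:E)%E -> psi Q x <= psi P x + t).

(** With the factor 2 the stopping cubes fill at most half of [Q] by Chebyshev. [Lam] carries the
    factor [2 ^+ n] lost in passing from a stopping cube to its dyadic parent. *)
Let lam := 2 * L.
Let Lam := 2 ^+ n * lam.

Let lam0 : 0 < lam. Proof. by rewrite mulr_gt0. Qed.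
Let Lam0 : 0 < Lam. Proof. by rewrite mulr_gt0// exprn_gt0. Qed.

Definition stopping_cubes Q : set (set rV) :=
  [set P | [/\ dyadic_subcubes Q P, (lam%:E < avg P (EFin \o psi Q))%E &
    forall P', dyadic_subcubes Q P' -> P `<` P' -> (avg P' (EFin \o psi Q) <= lam%:E)%E]].

Definition stopping_set Q : set rV := \bigcup_(P in stopping_cubes Q) P.

(** Among the cubes containing [P] with average above [lam], one of least generation is maximal: a
    strictly larger one would have a generation no smaller, hence would be contained in it. *)
Lemma stopping_cubes_exists Q P : is_cube Q -> dyadic_subcubes Q P ->
  (lam%:E < avg P (EFin \o psi Q))%E -> exists2 P', stopping_cubes Q P' & P `<=` P'.
Proof.
move=> [c [h [h0 Qch]]] DP badP.
pose good k := `[< exists v, [/\ forall i, (v i < 2 ^ k)%N, P `<=` dcube c h k v &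
  (lam%:E < avg (dcube c h k v) (EFin \o psi Q))%E] >].
have ex : exists k, good k.
  have := DP; rewrite Qch => /(dyadic_subcubesP hn _ _ h0)[k [v [vk PE]]].
  by exists k; apply/asboolP; exists v; rewrite -PE; split.
case: (ex_minnP ex) => k /asboolP[v [vk Pv bad]] mink.
exists (dcube c h k v) => //; split => //.
  by rewrite Qch; apply/dyadic_subcubesP => //; exists k, v.
move=> P'; rewrite {1}Qch => /(dyadic_subcubesP hn _ _ h0)[j [w [wj ->]]] /[dup] /properW sub [_ nsub].
rewrite leNgt; apply/negP => bad'.
have kj : (k <= j)%N.
  by apply: mink; apply/asboolP; exists w; split => //; exact: subset_trans sub.
have [x vx] : dcube c h k v !=set0.
  by apply: is_cube_nonempty; exists (c + \row_i (h / 2 ^+ k * (v i)%:R)), (h / 2 ^+ k);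
     rewrite divr_gt0// exprn_gt0.
apply: nsub; apply: dcube_nested => //.
by exists x; split => //; exact: sub.
Qed.

Lemma stopping_cubes_subset Q : stopping_cubes Q `<=` dyadic_subcubes Q.
Proof. by move=> P []. Qed.

Lemma stopping_cubes_countable Q : countable (stopping_cubes Q).
Proof.
apply: (sub_countable (subset_card_le (@stopping_cubes_subset Q))).
exact: dyadic_subcubes_countable.
Qed.

Lemma stopping_cubes_disjoint Q : disjoint_family (stopping_cubes Q).
Proof.
have aux P1 P2 : stopping_cubes Q P1 -> stopping_cubes Q P2 -> P1 `<=` P2 -> P1 = P2.
  move=> [_ _ max1] [D2 bad2 _] P12; apply: contrapT => P1P2.
  have : (avg P2 (EFin \o psi Q) <= lam%:E)%E.
    by apply: max1 => //; rewrite properEneq; split => //; exact/eqP.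
  by rewrite leNgt bad2.
move=> P1 P2 S1 S2 P12.
have [D1 _ _] := S1; have [D2 _ _] := S2.
by have [/aux ->|/aux ->] := dyadic_subcubes_nested hn D1 D2 P12.
Qed.

Lemma stopping_cubes_cube Q P : stopping_cubes Q P -> is_cube P.
Proof. by move=> [/dyadic_subcubes_is_cube]. Qed.

Lemma stopping_cubes_measurable Q P : stopping_cubes Q P -> measurable P.
Proof. by move=> /stopping_cubes_cube; exact: is_cube_measurable. Qed.

Lemma measurable_stopping_set Q : measurable (stopping_set Q).
Proof.
apply: measurable_countable_family; first exact: stopping_cubes_countable.
exact: stopping_cubes_measurable.
Qed.

Lemma stopping_set_subset Q : stopping_set Q `<=` Q.
Proof. by move=> x [P [/(dyadic_subcubes_subset hn) PQ _ _]]; exact: PQ. Qed.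

(** The parent of a stopping cube is strictly larger, so its average is at most [lam], and its
    measure is [2 ^+ n] times that of [P]. The case [P = Q] is excluded since the average over [Q]
    is at most [L]. *)
Lemma stopping_cubes_avg Q P : is_cube Q -> stopping_cubes Q P ->
  (avg P (EFin \o psi Q) <= Lam%:E)%E.
Proof.
move=> cQ [DP bad maxP].
have [PQ|[P' [DP' PP' P'P]]] := dyadic_parent hn DP.
  move: bad; rewrite PQ => /lt_le_trans/(_ (avg_psi cQ)).
  by rewrite lte_fin ltNge /lam ler_pMl// ler1n.
have cP := dyadic_subcubes_is_cube DP; have cP' := dyadic_subcubes_is_cube DP'.
have [v v0 Pv] := is_cube_leb hn cP.
have h2n : 0 < 2 ^+ n :> R by rewrite exprn_gt0.
have := maxP _ DP' PP'; rewrite /avg P'P Pv -EFinM !inver !gt_eqF ?mulr_gt0//.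
rewrite !lee_pdivrMl ?mulr_gt0// => H.
apply: (@le_trans _ _ (\int[leb]_(x in P') `|(EFin \o psi Q) x|)%E).
  by apply: ge0_le_integral_subset => //; exact: properW.
by apply: (le_trans H); rewrite -EFinM lee_fin /Lam; nra.
Qed.

Lemma psi_stopping Q P x : is_cube Q -> stopping_cubes Q P -> psi Q x <= psi P x + Lam.
Proof.
move=> cQ SP; apply: psi_sub => //; first exact: stopping_cubes_cube SP.
  by case: SP => /(dyadic_subcubes_subset hn).
exact: stopping_cubes_avg.
Qed.

Lemma avg_lt_integral Q P f (t : R) : is_cube P -> (forall x, 0 <= f x) ->
  (t%:E < avg P (EFin \o f))%E -> (t%:E * leb P <= \int[leb]_(x in P) (f x)%:E)%E.
Proof.
move=> cP f0 tP; apply: (@le_trans _ _ (avg P (EFin \o f) * leb P)%E).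
  by apply: lee_wpmul2r; [exact: measure_ge0|exact: ltW].
rewrite muleC (is_cube_avg hn _ cP); apply: ge0_le_integral_nomeas => x _ //=.
by rewrite ger0_norm.
Qed.

(** Chebyshev on the disjoint stopping cubes: [lam] times their measure is at most the integral of
    [psi Q] over [Q], which is at most [L * |Q|]. *)
Lemma leb_stopping_set Q : is_cube Q -> (2%:E * leb (stopping_set Q) <= leb Q)%E.
Proof.
move=> cQ; have mS := measurable_stopping_set Q.
have cE k : (\int[leb]_(x in stopping_set Q) (cst k%:E) x = k%:E * leb (stopping_set Q))%E.
  exact: integral_cst_set.
rewrite -(@lee_pmul2l _ L%:E)// ?lte_fin// muleA -EFinM mulrC.
apply: (@le_trans _ _ (\int[leb]_(x in stopping_set Q) (psi Q x)%:E)%E).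
  rewrite -/lam -cE; apply: le_integral_disjoint_family.
  - exact: stopping_cubes_countable.
  - exact: stopping_cubes_disjoint.
  - exact: stopping_cubes_measurable.
  - exact: measurable_cst.
  - exact/measurable_EFinP.
  - by move=> x; rewrite lee_fin ltW.
  - by move=> x; rewrite lee_fin.
  - move=> P SP; rewrite /cst integral_cst_set; last exact: stopping_cubes_measurable SP.
    by apply: avg_lt_integral => //; [exact: stopping_cubes_cube SP|case: SP].
apply: (@le_trans _ _ (\int[leb]_(x in Q) (psi Q x)%:E)%E).
  by apply: le_integral_subset_EFin => //; [exact: is_cube_measurable|exact: stopping_set_subset].
have -> : (\int[leb]_(x in Q) (psi Q x)%:E = leb Q * avg Q (EFin \o psi Q))%E.
  rewrite (is_cube_avg hn _ cQ); apply: eq_integral => x _.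
  by rewrite /= ger0_norm.
rewrite muleC; apply: lee_wpmul2r; first exact: measure_ge0.
exact: avg_psi.
Qed.

Lemma leb_off_stopping_set Q : is_cube Q -> (leb Q <= 2%:E * leb (Q `\` stopping_set Q))%E.
Proof.
move=> cQ; have mS := measurable_stopping_set Q; have mQ := is_cube_measurable hn cQ.
have := leb_stopping_set cQ.
have [v v0 Qv] := is_cube_leb hn cQ.
have SQ : (leb (stopping_set Q) <= leb Q)%E.
  by apply: (le_outer_measure lebesgue_outer); exact: stopping_set_subset.
have [s Ss] : exists s, leb (stopping_set Q) = s%:E.
  exists (fine (leb (stopping_set Q))); rewrite fineK// ge0_fin_numE ?measure_ge0//.
  by rewrite (le_lt_trans SQ)// Qv ltry.
have -> : (leb (Q `\` stopping_set Q) = leb Q - leb (stopping_set Q))%E.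
  rewrite measureD//; last by rewrite [X in (X < _)%E]Qv ltry.
  by rewrite (setIidr (@stopping_set_subset Q)).
by rewrite Qv Ss -EFinB -!EFinM !lee_fin; lra.
Qed.

(** A point outside the stopping cubes lies in no dyadic subcube with average above [lam], so
    [dyadic_avg_ae_le] applies. *)
Lemma psi_off_stopping_set Q : is_cube Q ->
  \forall x \ae leb, (Q `\` stopping_set Q) x -> psi Q x <= lam.
Proof.
move=> cQ; have [c [h [h0 Qch]]] := cQ.
have mE : measurable (Q `\` stopping_set Q).
  by apply: measurableD; [exact: is_cube_measurable|exact: measurable_stopping_set].
exists ((Q `\` stopping_set Q) `&` [set x | lam < psi Q x]); split.
- rewrite -[X in _ `&` X]setTI; apply: measurableI => //.
  have mf' : measurable_fun setT (EFin \o psi Q) by exact/measurable_EFinP.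
  exact: (emeasurable_fun_o_infty measurableT mf' lam%:E).
- apply: (@dyadic_avg_ae_le R n hn c h) => //; first by rewrite -Qch; exact: subDsetl.
  rewrite -Qch => P DP [x [Px [Qx nSx]]]; rewrite leNgt; apply/negP => bad.
  have [P' SP' PP'] := stopping_cubes_exists cQ DP bad.
  by apply: nSx; exists P' => //; exact: PP'.
- move=> x /= /not_implyP[Ex /negP]; rewrite -ltNge => lx; split => //.
Qed.

(* The points of [Q] lying in fewer than [N] nested generations of stopping
   cubes; they exhaust [Q] up to a null set, and the truncation at [N] makes
   the recursion in [integral_good_set] well founded. *)
Fixpoint good_set (N : nat) Q : set rV :=
  if N is N'.+1 then
    (Q `\` stopping_set Q) `|` \bigcup_(P in stopping_cubes Q) good_set N' P
  else set0.

Lemma good_set_subset N Q : good_set N Q `<=` Q.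
Proof.
elim: N Q => [|N IH] Q x; first by [].
move=> [[]//|[P SP /IH Px]].
by apply: stopping_set_subset; exists P.
Qed.

Lemma disjoint_good_sets N Q P x : stopping_cubes Q P -> P x ->
  (\bigcup_(P' in stopping_cubes Q) good_set N P') x -> good_set N P x.
Proof.
move=> SP Px [P' SP' Gx]; rewrite (@stopping_cubes_disjoint Q P P')//.
by exists x; split => //; exact: good_set_subset Gx.
Qed.

Lemma good_set_nondecreasing N Q : good_set N Q `<=` good_set N.+1 Q.
Proof.
elim: N Q => [|N IH] Q x; first by [].
move=> [Ex|[P SP /IH Px]]; first by left.
by right; exists P.
Qed.

Lemma measurable_good_set N Q : is_cube Q -> measurable (good_set N Q).
Proof.
elim: N Q => [|N IH] Q cQ; first exact: measurable0.
apply: measurableU.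
  by apply: measurableD; [exact: is_cube_measurable|exact: measurable_stopping_set].
pose F := [set A | exists2 P, stopping_cubes Q P & A = good_set N P].
have -> : \bigcup_(P in stopping_cubes Q) good_set N P = \bigcup_(A in F) A.
  apply/seteqP; split => x.
    by move=> [P SP Px]; exists (good_set N P) => //; exists P.
  by move=> [_ [P SP ->] Px]; exists P.
apply: measurable_countable_family.
- apply: (@sub_countable _ _ _ (\bigcup_(P in stopping_cubes Q) [set good_set N P])).
    by apply: subset_card_le => _ [P SP ->]; exists P.
  by apply: bigcup_countable => *; [exact: stopping_cubes_countable|exact: countable1].
- by move=> _ [P /stopping_cubes_cube/IH mP ->].
Qed.

(** What is left after [N.+1] generations lies in the stopping cubes; each keeps a fraction
    [2^-1 ^+ N] by induction, and together they fill at most half of [Q]. *)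
Lemma leb_good_setC N Q : is_cube Q ->
  (leb (Q `\` good_set N Q) <= (2^-1 ^+ N)%:E * leb Q)%E.
Proof.
elim: N Q => [|N IH] Q cQ; first by rewrite setD0 expr0 mul1e.
have mS := measurable_stopping_set Q.
pose W := \bigcup_(P in stopping_cubes Q) good_set N P.
have mG : measurable (good_set N.+1 Q) by exact: measurable_good_set.
have mD : measurable (Q `\` good_set N.+1 Q).
  by apply: measurableD => //; exact: is_cube_measurable.
have DS : Q `\` good_set N.+1 Q `<=` stopping_set Q.
  by move=> x [Qx nG]; apply: contrapT => nS; apply: nG; left.
apply: (@le_trans _ _ (\int[leb]_(x in stopping_set Q) (1 * \1_(Q `\` good_set N.+1 Q) x)%:E)%E).
  rewrite integral_indic_real integral_cst_set ?mul1e; last exact: measurableI.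
  by rewrite (setIidr DS).
apply: (@le_trans _ _ (\int[leb]_(x in stopping_set Q) (2^-1 ^+ N)%:E)%E).
  apply: le_integral_disjoint_family.
  - exact: stopping_cubes_countable.
  - exact: stopping_cubes_disjoint.
  - exact: stopping_cubes_measurable.
  - by apply/measurable_EFinP; apply: measurable_funM => //; exact: measurable_indic.
  - exact: measurable_cst.
  - by move=> x; rewrite lee_fin mul1r.
  - by move=> x; rewrite lee_fin exprn_ge0.
  - move=> P SP; have mP := stopping_cubes_measurable SP.
    have cP := stopping_cubes_cube SP.
    rewrite integral_indic_real !integral_cst_set ?mul1e//; last exact: measurableI.
    apply: le_trans (IH P cP); apply: (le_outer_measure lebesgue_outer).
    move=> x [Px [Qx nG]]; split => // Gx; apply: nG; right; by exists P.
rewrite integral_cst_set// exprSr EFinM -muleA; apply: lee_wpmul2l.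
  by rewrite lee_fin exprn_ge0.
by rewrite -lee_pdivrMl// invrK; exact: leb_stopping_set.
Qed.

(** The first summand comes from the points outside the stopping cubes, the second from the error of
    degree [k] inside them, its coefficient being that of [expr_shift_le] with [t = Lam]. Both
    factors 2 are those of [integral_le_rmaximal]. *)
Fixpoint osc_const (k : nat) : R :=
  if k is k'.+1 then
    2 * (lam + Lam) ^+ k'.+1 + 2 * (k'.+1%:R * Lam * 2 ^+ k' * osc_const k')
  else 1.

Lemma osc_const_ge0 k : 0 <= osc_const k.
Proof.
elim: k => //= k IH; rewrite addr_ge0// mulr_ge0//; first by rewrite exprn_ge0// addr_ge0 ?ltW.
by rewrite !mulr_ge0 ?exprn_ge0// ltW.
Qed.

(** A mean value bound, with [y + t <= 2 * y]. It is used for [y = psi P x + Lam] and [t = Lam]: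
    adding [Lam] to the oscillation is what guarantees [t <= y] and reduces the error to a single
    power. *)
Lemma expr_shift_le (y t : R) k : 0 < t -> t <= y ->
  (y + t) ^+ k.+1 <= y ^+ k.+1 + k.+1%:R * t * 2 ^+ k * y ^+ k.
Proof.
move=> t0 ty; have y0 : 0 < y by exact: lt_le_trans ty.
elim: k => [|k IH]; first by rewrite !expr1 !expr0; lra.
rewrite exprSr; apply: (@le_trans _ _ ((y ^+ k.+1 + k.+1%:R * t * 2 ^+ k * y ^+ k) * (y + t))).
  by apply: ler_wpM2r => //; rewrite addr_ge0// ltW.
have yk : 0 <= y ^+ k by rewrite exprn_ge0// ltW.
have k2 : 1 <= 2 ^+ k.+1 :> R by rewrite exprn_ege1// ler1n.
rewrite -[k.+2%:R]natr1 exprS [y ^+ k.+2]exprS exprS (exprS 2).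
rewrite (exprS 2) in k2.
set Y := y ^+ k in yk *; set K := k.+1%:R; set T := 2 ^+ k in k2 *.
have K0 : 0 <= K by rewrite ler0n.
have T0 : 0 <= T by lra.
have e1 : K * t * T * Y * (y + t) <= K * t * T * Y * (2 * y).
  by apply: ler_wpM2l; [rewrite !mulr_ge0// ltW|lra].
have e2 : (y * Y) * t <= (y * Y) * t * (2 * T).
  by rewrite ler_peMr// !mulr_ge0// ltW.
lra.
Qed.

Lemma measurable_osc_power Q g k : bounded_measurable g ->
  measurable_fun setT (fun x => (psi Q x + Lam) ^+ k * g x).
Proof.
move=> bg; apply: measurable_funM; last exact: bg.1.
by apply: measurable_funX; apply: measurable_funD.
Qed.

(* Off the stopping set [psi Q <= lam], and the integral of [M^k g] over [Q] is
   at most twice that of [M^k.+1 g] there.  On a stopping cube [P],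
   [psi Q <= psi P + Lam], and [(y + Lam) ^+ k.+1] exceeds [y ^+ k.+1] by terms of
   degree [k] only, for which a maximal function is to spare. *)
Lemma integral_good_set k N Q g : is_cube Q -> bounded_measurable g -> (forall x, 0 <= g x) ->
  (\int[leb]_(x in good_set N Q) ((psi Q x + Lam) ^+ k * g x)%:E <=
   (osc_const k)%:E * \int[leb]_(x in Q) (iter k rmaximal g x)%:E)%E.
Proof.
move=> + bg g0; elim: k N Q => [|k IHk] N Q cQ.
  rewrite mul1e /=.
  under eq_integral do rewrite expr0 mul1r.
  apply: le_integral_subset_EFin => //; [exact: measurable_good_set|exact: is_cube_measurable| |exact: good_set_subset].
  exact: bg.1.
elim: N Q cQ => [|N IHN] Q cQ.
  rewrite integral_set0 mule_ge0// ?lee_fin ?osc_const_ge0//.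
  by apply: integral_ge0 => x _; rewrite lee_fin iter_rmaximal_ge0.
have mQ := is_cube_measurable hn cQ.
have mS := measurable_stopping_set Q.
have bM j := bounded_measurable_iter hn j bg.
have M0 j x := iter_rmaximal_ge0 j x g0.
have I0 A j : (0 <= \int[leb]_(x in A) (iter j rmaximal g x)%:E)%E.
  by apply: integral_ge0 => x _; rewrite lee_fin; exact: M0.
pose V := Q `\` stopping_set Q.
have mV : measurable V by exact: measurableD.
pose W := \bigcup_(P in stopping_cubes Q) good_set N P.
have GE : good_set N.+1 Q = V `|` W by [].
have mG : measurable (good_set N.+1 Q) by exact: measurable_good_set.
have WS : W `<=` stopping_set Q.
  by move=> x [P SP /good_set_subset Px]; exists P.
have mW : measurable W.
  have -> : W = good_set N.+1 Q `\` V.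
    rewrite GE setDUl setDv set0U; apply/seteqP; split => x [] //.
    move=> P SP Gx; split; first by exists P.
    by move=> [_]; apply; apply: WS; exists P.
  exact: measurableD.
have VS : [disjoint V & stopping_set Q] by apply/eqP; rewrite -subset0 => x [[_ nS] /nS].
have VW : [disjoint V & W].
  apply/eqP; rewrite -subset0 => x [[_ nS] Wx]; exact: nS (WS _ Wx).
pose F x := (psi Q x + Lam) ^+ k.+1 * g x.
have mF : measurable_fun setT F by exact: measurable_osc_power.
have F0 x : 0 <= F x by rewrite mulr_ge0// exprn_ge0// addr_ge0// ltW.
have HV : (\int[leb]_(x in V) (F x)%:E <=
    (2 * (lam + Lam) ^+ k.+1)%:E * \int[leb]_(x in V) (iter k.+1 rmaximal g x)%:E)%E.
  have a0 : 0 <= (lam + Lam) ^+ k.+1 by rewrite exprn_ge0// addr_ge0// ltW.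
  apply: (@le_trans _ _ (\int[leb]_(x in V) ((lam + Lam) ^+ k.+1 * g x)%:E)%E).
    apply: (ae_ge0_le_integral mV).
    - by move=> x _; rewrite lee_fin.
    - exact: measurable_EFin_restr.
    - by move=> x _; rewrite lee_fin mulr_ge0.
    - by apply: measurable_EFin_restr; apply: measurable_funM => //; exact: bg.1.
    - apply: filterS (psi_off_stopping_set cQ) => x h Vx; rewrite lee_fin ler_wpM2r//.
      by rewrite lerXn2r ?nnegrE ?addr_ge0// ?(ltW lam0) ?(ltW Lam0)// lerD2r h.
  rewrite ge0_integralZl_real//; last exact: bg.1.
  rewrite mulrC EFinM -muleA; apply: lee_wpmul2l; first by rewrite lee_fin.
  apply: (@le_trans _ _ (\int[leb]_(x in Q) (g x)%:E)%E).
    by apply: le_integral_subset_EFin => //; [exact: bg.1|exact: subDsetl].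
  apply: (le_trans (integral_le_iter_rmaximal k cQ bg g0)).
  apply: (integral_le_rmaximal cQ (bM k) (M0 k) mV); first exact: subDsetl.
  exact: leb_off_stopping_set.
pose ck := k.+1%:R * Lam * 2 ^+ k.
have ck0 : 0 <= ck by rewrite !mulr_ge0 ?exprn_ge0// ltW.
have mM j : measurable_fun setT (iter j rmaximal g) by case: (bM j).
have o0 := osc_const_ge0; have cok : 0 <= ck * osc_const k by exact: mulr_ge0.
pose G1 x := osc_const k.+1 * iter k.+1 rmaximal g x.
pose G2 x := ck * osc_const k * iter k rmaximal g x.
pose G x := G1 x + G2 x.
have G10 x : 0 <= G1 x by apply: mulr_ge0; [exact: (o0 k.+1)|exact: (M0 k.+1)].
have G20 x : 0 <= G2 x by apply: mulr_ge0.
have G0 x : 0 <= G x by exact: addr_ge0.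
have mG1 : measurable_fun setT G1 by apply: measurable_funM; [exact: measurable_cst|exact: (mM k.+1)].
have mG2 : measurable_fun setT G2 by apply: measurable_funM; [exact: measurable_cst|exact: (mM k)].
have mGf : measurable_fun setT G by exact: measurable_funD.
have intG A : measurable A -> (\int[leb]_(x in A) (G x)%:E =
    (osc_const k.+1)%:E * \int[leb]_(x in A) (iter k.+1 rmaximal g x)%:E +
    (ck * osc_const k)%:E * \int[leb]_(x in A) (iter k rmaximal g x)%:E)%E.
  move=> mA; rewrite (ge0_integralD_real leb mA mG1 mG2 G10 G20).
  by congr (_ + _)%E; apply: ge0_integralZl_real.
have HW : (\int[leb]_(x in W) (F x)%:E <= \int[leb]_(x in stopping_set Q) (G x)%:E)%E.
  rewrite -(setIidr WS) -integral_indic_real.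
  apply: le_integral_disjoint_family.
  - exact: stopping_cubes_countable.
  - exact: stopping_cubes_disjoint.
  - exact: stopping_cubes_measurable.
  - by apply/measurable_EFinP; apply: measurable_funM => //; exact: measurable_indic.
  - exact/measurable_EFinP.
  - by move=> x; rewrite lee_fin mulr_ge0.
  - by move=> x; rewrite lee_fin.
  move=> P SP; have cP := stopping_cubes_cube SP; have mP := stopping_cubes_measurable SP.
  have mGP : measurable (good_set N P) by exact: measurable_good_set.
  rewrite integral_indic_real.
  have -> : P `&` W = good_set N P.
    apply/seteqP; split => x; first by move=> [Px Wx]; exact: disjoint_good_sets Wx.
    by move=> Gx; split; [exact: good_set_subset Gx|exists P].
  apply: (@le_trans _ _ (\int[leb]_(x in good_set N P)
      ((psi P x + Lam) ^+ k.+1 * g x + ck * ((psi P x + Lam) ^+ k * g x))%:E)%E).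
    apply: ge0_le_integral_nomeas => x Gx; rewrite lee_fin// /F.
    apply: (@le_trans _ _ (((psi P x + Lam) + Lam) ^+ k.+1 * g x)).
      rewrite ler_wpM2r// lerXn2r ?nnegrE ?addr_ge0// ?(ltW Lam0)//.
      by rewrite lerD2r; exact: psi_stopping.
    rewrite mulrA -mulrDl ler_wpM2r//; apply: expr_shift_le => //.
    by rewrite lerDr.
  have pos j x : 0 <= (psi P x + Lam) ^+ j * g x.
    by rewrite mulr_ge0// exprn_ge0// addr_ge0// ltW.
  rewrite ge0_integralD_real; [|exact: mGP|exact: measurable_osc_power| |exact: pos|]; last 2 first.
  - by apply: measurable_funM; [exact: measurable_cst|exact: measurable_osc_power].
  - by move=> x; apply: mulr_ge0.
  rewrite ge0_integralZl_real; [|exact: mGP|exact: measurable_osc_power|exact: pos|exact: ck0].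
  rewrite (intG _ mP); apply: leeD; first exact: IHN.
  by rewrite (EFinM ck (osc_const k)) -muleA; apply: lee_wpmul2l; [rewrite lee_fin|exact: IHk].
(* The error of degree [k] is moved from the stopping set to [V]. The coefficient on the stopping
   set thus remains exactly [osc_const k.+1], and nothing accumulates over the generations. *)
have HM : (\int[leb]_(x in stopping_set Q) (iter k rmaximal g x)%:E <=
    2%:E * \int[leb]_(x in V) (iter k.+1 rmaximal g x)%:E)%E.
  apply: (@le_trans _ _ (\int[leb]_(x in Q) (iter k rmaximal g x)%:E)%E).
    by apply: le_integral_subset_EFin => //; exact: stopping_set_subset.
  apply: (integral_le_rmaximal cQ (bM k) (M0 k) mV); first exact: subDsetl.
  exact: leb_off_stopping_set.
rewrite GE ge0_integral_setU_real//.
have -> : (\int[leb]_(x in Q) (iter k.+1 rmaximal g x)%:E =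
    \int[leb]_(x in V) (iter k.+1 rmaximal g x)%:E +
    \int[leb]_(x in stopping_set Q) (iter k.+1 rmaximal g x)%:E)%E.
  rewrite -ge0_integral_setU_real//; congr (integral _ _ _).
  by rewrite setUC /V setDUK//; exact: stopping_set_subset.
apply: (le_trans (leeD HV HW)); rewrite (intG _ mS).
rewrite (ge0_muleDr _ (I0 _ k.+1) (I0 _ k.+1)).
set IV := (\int[leb]_(x in V) _)%E in HM *; set IS := (\int[leb]_(x in _) (iter k.+1 _ _ _)%:E)%E.
rewrite addeCA [leRHS]addeC; apply: leeD => //.
apply: (@le_trans _ _ ((2 * (lam + Lam) ^+ k.+1)%:E * IV + (ck * osc_const k)%:E * (2%:E * IV))%E).
  by apply: leeD => //; apply: lee_wpmul2l => //; rewrite lee_fin mulr_ge0// osc_const_ge0.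
rewrite muleA -EFinM -ge0_muleDl; last 2 first.
- by rewrite lee_fin mulr_ge0// exprn_ge0// addr_ge0// ltW.
- by rewrite lee_fin; apply: mulr_ge0.
rewrite -EFinD; apply: lee_wpmul2r; first exact: (I0 _ k.+1).
by rewrite lee_fin /= /ck; lra.
Qed.
(** The bound on [good_set N Q] is uniform in [N], and the increasing union of these sets is [Q] up
    to a null set. *)
Lemma integral_osc_power k Q g : is_cube Q -> bounded_measurable g -> (forall x, 0 <= g x) ->
  (\int[leb]_(x in Q) (psi Q x ^+ k * g x)%:E <=
   (osc_const k)%:E * \int[leb]_(x in Q) (iter k rmaximal g x)%:E)%E.
Proof.
move=> cQ bg g0; have mQ := is_cube_measurable hn cQ.
pose F x := (psi Q x + Lam) ^+ k * g x.
have mF : measurable_fun setT F by exact: measurable_osc_power.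
have F0 x : 0 <= F x by rewrite mulr_ge0// exprn_ge0// addr_ge0// ltW.
apply: (@le_trans _ _ (\int[leb]_(x in Q) (F x)%:E)%E).
  apply: ge0_le_integral_nomeas => x _; first by rewrite lee_fin mulr_ge0// exprn_ge0.
  by rewrite lee_fin ler_wpM2r// lerXn2r ?nnegrE ?addr_ge0 ?(ltW Lam0)// lerDl ltW.
pose U := \bigcup_N good_set N Q.
have mG N : measurable (good_set N Q) by exact: measurable_good_set.
have mU : measurable U by exact: bigcupT_measurable.
have mD : measurable (Q `\` U) by exact: measurableD.
have D0 : leb (Q `\` U) = 0%E.
  have [v v0 Qv] := is_cube_leb hn cQ.
  apply/eqP; rewrite eq_le measure_ge0 andbT.
  have cv : (fun N => (2^-1 ^+ N * v)%:E) @ \oo --> (0 * v)%:E.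
    apply/fine_cvgP; split; first exact: nearW.
    apply: cvgM; last exact: cvg_cst.
    by apply: cvg_expr; rewrite ger0_norm// invf_lt1// ltr1n.
  rewrite mul0r in cv; rewrite -[leRHS](cvg_lim _ cv)//.
  apply: lime_ge; first by apply/cvg_ex; eexists; exact: cv.
  apply: nearW => N; rewrite EFinM -Qv; apply: le_trans (leb_good_setC N cQ).
  by apply: (le_outer_measure lebesgue_outer) => x [Qx nU]; split => // Gx; apply: nU; exists N.
have mFQ : measurable_fun Q (EFin \o F) by exact: measurable_EFin_restr.
have F0' x : Q x -> (0 <= (EFin \o F) x)%E by rewrite lee_fin.
rewrite (ge0_negligible_integral mD mQ mFQ F0' D0).
have UQ : U `<=` Q by move=> x [N _ /good_set_subset].
rewrite setDD (setIidr UQ).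
have cv : (\int[leb]_(x in good_set N Q) (F x)%:E)%E @[N --> \oo] -->
    (\int[leb]_(x in U) (F x)%:E)%E.
  apply: ge0_nondecreasing_set_cvg_integral.
  - apply/nondecreasing_seqP => N; apply/subsetPset.
    exact: good_set_nondecreasing.
  - exact: mG.
  - by move=> N; exact: measurable_EFin_restr.
  - by move=> N x _; rewrite lee_fin.
rewrite -(cvg_lim _ cv)//; apply: lime_le; first by apply/cvg_ex; eexists; exact: cv.
by apply: nearW => N; exact: integral_good_set.
Qed.

End Oscillation.

(** * Products of BMO oscillations *)

Section BMOEstimates.
Context {R : realType} {n : nat} (hn : (0 < n)%N).
Local Notation rV := 'rV[R]_n.
Implicit Types (Q P : set rV) (b f : rV -> R).

Lemma cube_subset_compact Q : is_cube Q -> exists2 K : set rV, compact K & Q `<=` K.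
Proof.
move=> [c [h [h0 ->]]].
exists [set v : rV | forall i, (`[c ord0 i, c ord0 i + h]%classic : set R) (v ord0 i)].
  apply: (@rV_compact R n (fun i => `[c ord0 i, c ord0 i + h]%classic)) => i.
  exact: segment_compact.
by move=> x xQ i; have := xQ i; rewrite !mxE /= in_itv/= => /andP[-> /ltW ->].
Qed.

Lemma BMO_integrable b Q : BMO b -> is_cube Q -> leb.-integrable Q (EFin \o b).
Proof.
move=> [ib _] cQ; have [K cK QK] := cube_subset_compact cQ.
apply: integrableS QK (ib _ cK); last exact: is_cube_measurable.
rewrite -[K]setCK; apply: measurableC; apply: measurable_open => //.
by apply: closed_openC; apply: compact_closed => //; exact: norm_hausdorff.
Qed.

Lemma BMO_measurable b : BMO b -> measurable_fun setT b.
Proof.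
move=> Bb.
pose Q (k : nat) : set rV := cube (- const_mx k.+1%:R) (2 * k.+1%:R).
have cQ k : is_cube (Q k) by exists (- const_mx k.+1%:R), (2 * k.+1%:R); rewrite mulr_gt0.
have -> : [set: rV] = \bigcup_k Q k.
  apply/seteqP; split => // x _.
  have [k hk] : exists k : nat, forall i, `|x ord0 i| < k.+1%:R.
    exists (Num.truncn (\sum_i `|x ord0 i|)) => i; apply: le_lt_trans (truncnS_gt _).
    by rewrite (bigD1 i)//= lerDl sumr_ge0.
  exists k => // i; have := hk i; rewrite !mxE ltr_norml => /andP[h1 h2].
  by apply/andP; split; lra.
apply/(measurable_fun_bigcup b (fun k => is_cube_measurable hn (cQ k))) => k.
by apply/measurable_EFinP; exact: (measurable_int _ (BMO_integrable Bb (cQ k))).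
Qed.

Lemma mean_dist b P (m : R) : is_cube P -> leb.-integrable P (EFin \o b) ->
  (`|mean P b - m|%:E <= avg P (fun x => (b x - m)%:E))%E.
Proof.
move=> cP ib; have [v v0 Pv] := is_cube_leb hn cP; have mP := is_cube_measurable hn cP.
have im : leb.-integrable P (EFin \o cst m).
  apply/integrableP; split; first by apply/measurable_EFinP; exact: measurable_cst.
  have -> : (\int[leb]_(x in P) `|(EFin \o cst m) x| = `|m|%:E * leb P)%E.
    exact: (integral_cst_set `|m| mP).
  by rewrite Pv -EFinM ltry.
have Ib : (\int[leb]_(x in P) (b x)%:E \is a fin_num)%E by exact: integrable_fin_num.
have E : ((mean P b - m)%:E = v^-1%:E * \int[leb]_(x in P) (b x - m)%:E)%E.
  have -> : (\int[leb]_(x in P) (b x - m)%:E = \int[leb]_(x in P) (b x)%:E - m%:E * v%:E)%E.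
    by under eq_integral do rewrite EFinB; rewrite integralB_EFin// integral_cst_set// Pv.
  have [I IE] : exists I, (\int[leb]_(x in P) (b x)%:E = I%:E)%E.
    by exists (fine (\int[leb]_(x in P) (b x)%:E)); rewrite fineK.
  rewrite /mean /Rintegral Pv IE -[RHS]/((v^-1 * (I - m * v))%:E); congr (_%:E).
  rewrite /=.
  by field; rewrite gt_eqF.
rewrite -[leLHS]/(`|(mean P b - m)%:E|%E) E abseM /avg Pv inver gt_eqF//.
rewrite gee0_abs; last by rewrite lee_fin invr_ge0 ltW.
apply: lee_wpmul2l; first by rewrite lee_fin invr_ge0 ltW.
apply: (le_abse_integral leb mP); apply/measurable_EFinP.
apply: measurable_funB; last exact: measurable_cst.
by apply/measurable_EFinP; exact: (measurable_int _ ib).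
Qed.

Lemma avg_sum (I : Type) (r : seq I) (f : I -> rV -> R) Q : is_cube Q ->
  (forall i, measurable_fun setT (f i)) -> (forall i x, 0 <= f i x) ->
  avg Q (fun x => (\sum_(i <- r) f i x)%:E) = (\sum_(i <- r) avg Q (EFin \o f i))%E.
Proof.
move=> cQ mf f0; have [v v0 Qv] := is_cube_leb hn cQ; have mQ := is_cube_measurable hn cQ.
rewrite /avg -ge0_sume_distrr; last by move=> i _; exact: integral_ge0.
have mf' i : measurable_fun Q (fun x => `|(EFin \o f i) x|)%E.
  by apply: measurableT_comp; [exact: abse_measurable|exact: measurable_EFin_restr].
congr (_ * _)%E; rewrite -(ge0_integral_sum leb mQ mf'); last by move=> i x _; exact: abse_ge0.
apply: eq_integral => x _; rewrite -sumEFin gee0_abs ?sume_ge0// => [|i _]; last by rewrite lee_fin.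
by apply: eq_bigr => i _; rewrite /= ger0_norm.
Qed.

Lemma avgZ (k : R) f Q : is_cube Q -> 0 <= k -> measurable_fun setT f ->
  avg Q (fun x => (k * f x)%:E) = (k%:E * avg Q (EFin \o f))%E.
Proof.
move=> cQ k0 mf; rewrite /avg muleCA; congr (_ * _)%E.
have mQ := is_cube_measurable hn cQ.
have -> : (\int[leb]_(x in Q) `|(k * f x)%:E| = \int[leb]_(x in Q) (k * `|f x|)%:E)%E.
  by apply: eq_integral => x _; rewrite /= normrM ger0_norm.
have mf' : measurable_fun setT (fun x => `|f x|).
  by apply: measurableT_comp mf; exact: normr_measurable.
exact: (ge0_integralZl_real leb mQ mf' (fun x => normr_ge0 (f x)) k0).
Qed.

(** Positive upper bounds [N s] replace the BMO norms: one can divide by them even if a norm is 0,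
    and in that case let them tend to 0. *)
Variables (l : nat) (hl : (0 < l)%N) (b : 'I_l -> rV -> R) (N : 'I_l -> R).
Hypotheses (bBMO : forall s, BMO (b s)) (N0 : forall s, 0 < N s)
  (bN : forall s, (bmo_norm (b s) <= (N s)%:E)%E).

Let psi Q x := \sum_(s < l) (N s)^-1 * `|b s x - mean Q (b s)|.

Let mdiff Q s : measurable_fun setT (fun x => `|b s x - mean Q (b s)|).
Proof.
apply: measurableT_comp; first exact: normr_measurable.
by apply: measurable_funB; [exact: BMO_measurable|exact: measurable_cst].
Qed.

Let mterm Q s : measurable_fun setT (fun x => (N s)^-1 * `|b s x - mean Q (b s)|).
Proof. by apply: measurable_funM (mdiff Q s); exact: measurable_cst. Qed.

Let psi0 Q x : 0 <= psi Q x.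
Proof. by apply: sumr_ge0 => s _; rewrite mulr_ge0// invr_ge0 ltW. Qed.

Let mpsi Q : measurable_fun setT (psi Q).
Proof. exact: measurable_sum. Qed.

Let avg_psiE P Q : is_cube P -> avg P (EFin \o psi Q) =
  (\sum_(s < l) (N s)^-1%:E * avg P (fun x => (b s x - mean Q (b s))%:E))%E.
Proof.
move=> cP; rewrite [LHS]avg_sum//; last by move=> s x; rewrite mulr_ge0// invr_ge0 ltW.
apply: eq_bigr => s _; rewrite [LHS]avgZ ?invr_ge0 ?(ltW (N0 s))//; congr (_ * _)%E.
by congr (_ * _)%E; apply: eq_integral => x _; rewrite /= normr_id.
Qed.

Let avg_psi Q : is_cube Q -> (avg Q (EFin \o psi Q) <= l%:R%:E)%E.
Proof.
move=> cQ; rewrite avg_psiE//.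
apply: (@le_trans _ _ (\sum_(s < l) 1)%E); last by rewrite sumEFin sumr_const card_ord.
apply: lee_sum => s _; rewrite lee_pdivrMl// mule1.
by apply: le_trans (bN s); apply: ereal_sup_ubound; exists Q.
Qed.

Let psi_sub Q P (t : R) x : is_cube Q -> is_cube P -> P `<=` Q ->
  (avg P (EFin \o psi Q) <= t%:E)%E -> psi Q x <= psi P x + t.
Proof.
move=> cQ cP PQ; rewrite avg_psiE// => H.
apply: (@le_trans _ _ (psi P x + \sum_(s < l) (N s)^-1 * `|mean P (b s) - mean Q (b s)|)).
  rewrite -big_split/=; apply: ler_sum => s _; rewrite -mulrDr ler_wpM2l ?invr_ge0 ?(ltW (N0 s))//.
  by rewrite (le_trans _ (ler_normD _ _))// addrA subrK.
rewrite lerD2l -lee_fin; apply: le_trans H; rewrite -sumEFin.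
apply: lee_sum => s _; rewrite EFinM; apply: lee_wpmul2l.
  by rewrite lee_fin invr_ge0 ltW.
by apply: mean_dist => //; exact: BMO_integrable.
Qed.

(** Summing over [k <= l] gives one constant for all subsets of the oscillations. *)
Definition bmo_const : R := \sum_(k < l.+1) @osc_const R n l%:R k.

Lemma bmo_const_ge0 : 0 <= bmo_const.
Proof. by apply: sumr_ge0 => k _; apply: osc_const_ge0 => //; rewrite ltr0n. Qed.

(** Each oscillation divided by [N s] is one of the nonnegative summands of [psi Q], so the product
    is at most [psi Q ^+ #|A|] times the product of the [N s]. *)
Lemma integral_prod_bmo (A : pred 'I_l) Q g : is_cube Q -> bounded_measurable g ->
  (forall x, 0 <= g x) ->
  (\int[leb]_(x in Q) ((\prod_(s < l | A s) `|b s x - mean Q (b s)|) * g x)%:E <=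
   (bmo_const * \prod_(s < l | A s) N s)%:E *
     \int[leb]_(x in Q) (iter #|A| rmaximal g x)%:E)%E.
Proof.
move=> cQ bg g0; have mQ := is_cube_measurable hn cQ.
have lR : 0 < l%:R :> R by rewrite ltr0n.
have P0 : 0 <= \prod_(s < l | A s) N s by apply: prodr_ge0 => s _; exact: ltW.
apply: (@le_trans _ _ (\int[leb]_(x in Q)
    ((\prod_(s < l | A s) N s) * (psi Q x ^+ #|A| * g x))%:E)%E).
  apply: ge0_le_integral_nomeas => x _.
    by rewrite lee_fin mulr_ge0// prodr_ge0.
  rewrite lee_fin mulrA ler_wpM2r//.
  rewrite -prodr_const -big_split/=; apply: ler_prod => s _; rewrite normr_ge0/=.
  rewrite /psi (bigD1 s)//= mulrDr mulrA divff ?gt_eqF// mul1r lerDl.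
  apply: mulr_ge0; first exact: ltW.
  by apply: sumr_ge0 => j _; rewrite mulr_ge0// invr_ge0 ltW.
rewrite ge0_integralZl_real; [|exact: mQ| | |exact: P0]; last 2 first.
- by apply: measurable_funM; [exact: measurable_funX|exact: bg.1].
- by move=> x; rewrite mulr_ge0// exprn_ge0.
rewrite mulrC EFinM -muleA; apply: lee_wpmul2l; first by rewrite lee_fin.
apply: (le_trans (integral_osc_power hn lR psi0 mpsi avg_psi psi_sub #|A| cQ bg g0)).
apply: lee_wpmul2r.
  by apply: integral_ge0 => x _; rewrite lee_fin iter_rmaximal_ge0.
rewrite lee_fin /bmo_const.
have Al : (#|A| < l.+1)%N by rewrite ltnS -[X in (_ <= X)%N](card_ord l) max_card.
rewrite (bigD1 (Ordinal Al))//= lerDl; apply: sumr_ge0 => k _.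
exact: osc_const_ge0.
Qed.

End BMOEstimates.

Lemma measurable_powR_fun d (T : measurableType d) (R : realType) (f r : T -> R) :
  measurable_fun setT f -> measurable_fun setT r ->
  measurable_fun setT (fun x => f x `^ r x).
Proof.
move=> mf mr; rewrite /powR; apply: measurable_fun_ifT.
- by apply: measurable_fun_eqr => //; exact: measurable_cst.
- rewrite (_ : (fun x => _) = (fun x => if r x == 0 then 1 else 0)).
    apply: measurable_fun_ifT; [|exact: measurable_cst|exact: measurable_cst].
    by apply: measurable_fun_eqr => //; exact: measurable_cst.
  by apply/funext => x; case: (r x == 0).
- apply: measurableT_comp; first exact: measurable_expR.
  apply: measurable_funM => //.
  by apply: measurableT_comp => //; exact: measurable_ln.
Qed.

(** * Variable Lebesgue spaces *)

Section VariableLebesgue.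
Context {R : realType} {n : nat} (hn : (0 < n)%N).
Local Notation rV := 'rV[R]_n.
Implicit Types (e : rV -> \bar R) (F G : rV -> R).

Lemma leb_setT_gt0 : (0 < leb [set: rV])%E.
Proof.
apply: (@lt_le_trans _ _ (leb (cube (0 : rV) 1))).
  by rewrite leb_cube// expr1n lte_fin.
exact: (le_outer_measure lebesgue_outer).
Qed.

Let ess_part_ge0 e F : (0 <= ess_sup leb
  (fun x => `|(EFin \o F) x| * (\1_[set y | e y = +oo%E] x)%:E))%E.
Proof.
apply: ess_sup_gee; first exact: leb_setT_gt0.
by apply: aeW => x; rewrite mule_ge0// lee_fin.
Qed.

Lemma le_integral_modular e F (A : set rV) : (forall x, A x -> e x < +oo)%E ->
  (\int[leb]_(x in A) (`|F x| `^ fine (e x))%:E <= modular e (EFin \o F))%E.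
Proof.
move=> Ae; rewrite /modular -[leLHS]adde0; apply: leeD; last exact: ess_part_ge0.
by apply: ge0_le_integral_subset.
Qed.

(** A support condition on [F] takes the place of measurability of the exponent; this form serves
    the conjugate exponent. *)
Lemma modular_supportE e F (A : set rV) : (forall x, A x -> e x < +oo)%E ->
  (forall x, ~ A x -> F x = 0) -> (forall x, (1 <= e x)%E) ->
  modular e (EFin \o F) = (\int[leb]_(x in A) (`|F x| `^ fine (e x))%:E)%E.
Proof.
move=> Ae FA e1; rewrite /modular [X in (_ + X)%E](_ : _ = 0%E).
  rewrite adde0 integral_mkcond [RHS]integral_mkcond; apply: eq_integral => x _.
  rewrite !patchE; have [Ax|nAx] := pselect (A x).
    by rewrite !mem_set//=; exact: Ae.
  rewrite (@memNset _ A)//; case: ifPn => // /set_mem/= ex.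
  rewrite FA// normr0 powR0//.
  have := e1 x; case: (e x) ex => // t _; rewrite lee_fin /= => t1.
  by rewrite gt_eqF// (lt_le_trans ltr01).
apply: (ess_sup_ae_cst 0%E); first exact: leb_setT_gt0.
apply: aeW => x /=; have [Ax|nAx] := pselect (A x).
  rewrite indicE memNset ?mule0//= => ex.
  by have := Ae _ Ax; rewrite ex.
by rewrite FA// normr0 mul0e.
Qed.

Lemma modular_aeE e F (A : set rV) : measurable_fun setT e -> measurable_fun setT F ->
  measurable A -> leb (~` A) = 0%E -> (forall x, A x -> e x < +oo)%E ->
  modular e (EFin \o F) = (\int[leb]_(x in A) (`|F x| `^ fine (e x))%:E)%E.
Proof.
move=> me mF mA A0 Ae; rewrite /modular [X in (_ + X)%E](_ : _ = 0%E).
  have mfin : measurable [set x | (e x < +oo)%E].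
    rewrite -[X in measurable X]setTI.
    exact: (emeasurable_fun_infty_o measurableT me +oo%E).
  have mf : measurable_fun setT (EFin \o (fun x => `|F x| `^ fine (e x))).
    apply/measurable_EFinP; apply: measurable_powR_fun.
      by apply: measurableT_comp => //; exact: normr_measurable.
    by apply: measurableT_comp => //; exact: fine_measurable.
  rewrite adde0 (ge0_negligible_integral (measurableC mA) mfin _ _ A0).
  - congr (integral _ _ _); apply/seteqP; split => x.
      by move=> [_ /=]; exact: contrapT.
    by move=> Ax; split; [exact: Ae|move=> /(_ Ax)].
  - by apply: measurable_funS mf => //; exact: subsetT.
  - by move=> x _; rewrite lee_fin powR_ge0.
apply: (ess_sup_ae_cst 0%E); first exact: leb_setT_gt0.
exists (~` A); split => //; first exact: measurableC.
move=> x /= H Ax; apply: H; rewrite indicE memNset ?mule0//= => ex.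
by have := Ae _ Ax; rewrite ex.
Qed.

Lemma Lvar_norm_ge0 e f : (0 <= Lvar_norm e f)%E.
Proof. by apply: le_ereal_inf_tmp => _ [k [k0 _] <-]; rewrite lee_fin ltW. Qed.

Lemma Lvar_norm_le e F (k : R) : 0 < k ->
  (modular e (EFin \o (fun x => F x / k)%R) <= 1)%E -> (Lvar_norm e (EFin \o F) <= k%:E)%E.
Proof.
move=> k0 h; apply: ereal_inf_lbound; exists k => //; split => //.
rewrite [X in modular e X](_ : _ = EFin \o (fun x => F x / k)%R)//.
by apply/funext => x /=; rewrite inver gt_eqF// -EFinM.
Qed.

Lemma Lvar_norm_lt e F (a : R) : (Lvar_norm e (EFin \o F) < a%:E)%E ->
  exists k, [/\ 0 < k, k < a & (modular e (EFin \o (fun x => F x / k)%R) <= 1)%E].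
Proof.
move=> /ereal_inf_lt[_ [k [k0 h] <-]]; rewrite lte_fin => ka; exists k; split => //.
rewrite [X in modular e X](_ : _ = (fun x => (EFin \o F) x / k%:E)%E)//.
by apply/funext => x /=; rewrite inver gt_eqF// -EFinM.
Qed.

Variables (p : rV -> \bar R).

Definition regular_exponent : Prop := [/\ measurable_fun setT p, forall x, (1 <= p x)%E &
  exists P : R, \forall x \ae leb, (1 < p x)%E /\ (p x <= P%:E)%E].

Hypothesis pr : regular_exponent.

Lemma regular_exponentP : exists (P : R) (A : set rV), [/\ measurable A, leb (~` A) = 0%E &
  forall x, A x -> [/\ 1 < fine (p x), fine (p x) <= P, (p x < +oo)%E,
    (conjugate_exponent p x < +oo)%E &
    fine (conjugate_exponent p x) = fine (p x) / (fine (p x) - 1)]].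
Proof.
have [mp p1 [P aeP]] := pr.
pose A := [set x | (1%:E < p x)%E] `&` [set x | (p x <= P%:E)%E].
have mA : measurable A.
  rewrite /A -[X in X `&` _]setTI -[X in _ `&` X]setTI; apply: measurableI.
    exact: emeasurable_fun_o_infty.
  exact: emeasurable_fun_infty_c.
exists P, A; split => //.
  have [N [mN N0 sub]] := aeP.
  apply/eqP; rewrite eq_le measure_ge0 andbT -N0.
  by apply: (le_outer_measure lebesgue_outer) => x nA; apply: sub => -[h1 h2]; apply: nA; split.
move=> x [/= h1 h2]; rewrite /conjugate_exponent /hoelder_conjugate.
move: h1 h2; case: (p x) => // t; rewrite lte_fin lee_fin => t1 tP /=.
have t10 : 0 < t - 1 by rewrite subr_gt0.
rewrite eqe gt_eqF ?(lt_trans ltr01)//.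
by rewrite -EFinB inver gt_eqF// -EFinM/= !ltry.
Qed.

Lemma conjugate_exponent_ge1 x : (1 <= conjugate_exponent p x)%E.
Proof.
have [_ p1 _] := pr; have := p1 x; rewrite /conjugate_exponent /hoelder_conjugate.
case: (p x) => [t||]//=; rewrite lee_fin => t1.
rewrite eqe gt_eqF ?(lt_le_trans ltr01)// -EFinB inver.
have [->|tn1] := eqVneq t 1; first by rewrite subrr eqxx mul1e leey.
have t10 : 0 < t - 1 by rewrite subr_gt0 lt_neqAle eq_sym tn1.
by rewrite subr_eq0 (negbTE tn1) -EFinM lee_fin ler_pdivlMr// mul1r lerBlDr lerDl.
Qed.

(** Young's inequality is integrated after normalising both functions. The weights 1/p and 1/p' are
    bounded by 1, which gives the constant 2. *)
Lemma Lvar_hoelder F G (a b : R) : measurable_fun setT F -> measurable_fun setT G ->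
  0 <= a -> 0 <= b ->
  (Lvar_norm p (EFin \o F) <= a%:E)%E ->
  (Lvar_norm (conjugate_exponent p) (EFin \o G) <= b%:E)%E ->
  (\int[leb]_x (`|F x| * `|G x|)%:E <= (2 * (a * b))%:E)%E.
Proof.
move=> mF mG a0 b0 Fa Gb; have [mp _ _] := pr.
have [P [A [mA A0 AP]]] := regular_exponentP.
have mr : measurable_fun setT (fun x => fine (p x)).
  by apply: measurableT_comp mp; exact: fine_measurable.
(* On [A] this is the conjugate exponent; written with a power it is visibly measurable
   everywhere. *)
pose s x := fine (p x) * (fine (p x) - 1) `^ (-1).
have sE x : A x -> s x = fine (p x) / (fine (p x) - 1).
  by move=> /AP[r1 _ _ _ _]; rewrite /s powR_inv1// subr_ge0 ltW.
have ms : measurable_fun setT s.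
  apply: (measurable_funM mr); apply: measurable_powR_fun; last exact: measurable_cst.
  by apply: (measurable_funB mr); exact: measurable_cst.
have main (k1 k2 : R) : 0 < k1 -> 0 < k2 ->
    (modular p (EFin \o (fun x => F x / k1)%R) <= 1)%E ->
    (modular (conjugate_exponent p) (EFin \o (fun x => G x / k2)%R) <= 1)%E ->
    (\int[leb]_x (`|F x| * `|G x|)%:E <= (2 * (k1 * k2))%:E)%E.
  move=> k10 k20 hF hG.
  have mnF : measurable_fun setT (fun x => `|F x|).
    by apply: measurableT_comp mF; exact: normr_measurable.
  have mnG : measurable_fun setT (fun x => `|G x|).
    by apply: measurableT_comp mG; exact: normr_measurable.
  have mFG : measurable_fun [set: rV] (EFin \o (fun x => `|F x| * `|G x|)).
    by apply/measurable_EFinP; exact: measurable_funM.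
  have FG0 (x : rV) : [set: rV] x -> (0 <= (EFin \o (fun x => `|F x| * `|G x|)%R) x)%E.
    by move=> _; rewrite /= lee_fin mulr_ge0.
  rewrite (ge0_negligible_integral (measurableC mA) measurableT mFG FG0 A0).
  rewrite setTD setCK.
  pose f1 x := `|F x / k1| `^ fine (p x).
  pose f2 x := `|G x / k2| `^ s x.
  have mf1 : measurable_fun setT f1.
    apply: measurable_powR_fun mr; apply: measurableT_comp; first exact: normr_measurable.
    by apply: measurable_funM; [exact: mF|exact: measurable_cst].
  have mf2 : measurable_fun setT f2.
    apply: measurable_powR_fun ms; apply: measurableT_comp; first exact: normr_measurable.
    by apply: measurable_funM; [exact: mG|exact: measurable_cst].
  have f10 x : 0 <= f1 x by exact: powR_ge0.
  have f20 x : 0 <= f2 x by exact: powR_ge0.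
  have k12 : 0 <= k1 * k2 by rewrite mulr_ge0 ?ltW.
  apply: (@le_trans _ _ (\int[leb]_(x in A) ((k1 * k2) * (f1 x + f2 x))%:E)%E).
    apply: ge0_le_integral_nomeas => x Ax; first by rewrite /= lee_fin mulr_ge0.
    have [r1 _ _ _ _] := AP _ Ax; rewrite /= lee_fin.
    have r0 : 0 < fine (p x) by exact: lt_trans r1.
    have r10 : 0 < fine (p x) - 1 by rewrite subr_gt0.
    have -> : `|F x| * `|G x| = (k1 * k2) * (`|F x / k1| * `|G x / k2|).
      rewrite !normrM !normfV (gtr0_norm k10) (gtr0_norm k20); field.
      by rewrite !gt_eqF.
    rewrite ler_wpM2l//.
    have s0 : 0 < s x by rewrite sE// divr_gt0.
    have rs : (fine (p x))^-1 + (s x)^-1 = 1.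
      by rewrite sE// invf_div; field; rewrite gt_eqF.
    apply: (le_trans (conjugate_powR (normr_ge0 _) (normr_ge0 _) r0 s0 rs)).
    apply: lerD; rewrite ler_pdivrMr// ler_peMr//; first exact: ltW.
    by rewrite sE// ler_pdivlMr// mul1r lerBlDr lerDl.
  rewrite ge0_integralZl_real; [|exact: mA|exact: measurable_funD|by move=> x; exact: addr_ge0|exact: k12].
  rewrite (ge0_integralD_real leb mA mf1 mf2 f10 f20).
  have I1 : (\int[leb]_(x in A) (f1 x)%:E <= 1)%E.
    apply: le_trans hF; apply: le_integral_modular => x /AP[]//.
  have I2 : (\int[leb]_(x in A) (f2 x)%:E <= 1)%E.
    apply: le_trans hG.
    have -> : (\int[leb]_(x in A) (f2 x)%:E =
        \int[leb]_(x in A) (`|G x / k2| `^ fine (conjugate_exponent p x))%:E)%E.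
      by apply: eq_integral => x /set_mem Ax; rewrite /f2 sE//; have [_ _ _ _ ->] := AP _ Ax.
    by apply: le_integral_modular => x /AP[].
  rewrite [leRHS]EFinM muleC; apply: lee_wpmul2r; first by rewrite lee_fin.
  by apply: (le_trans (leeD I1 I2)); rewrite -EFinD lee_fin.
(* The infimum in the norm need not be attained and may be 0, so both norms are approached from
   above. *)
have cv : (fun k : nat => (2 * ((a + k.+1%:R^-1) * (b + k.+1%:R^-1)))%:E) @ \oo -->
    (2 * (a * b))%:E.
  apply/fine_cvgP; split; first exact: nearW.
  apply: cvgM; first exact: cvg_cst.
  rewrite -[X in X * _]addr0 -[X in _ * X]addr0.
  apply: cvgM; apply: cvgD; try exact: cvg_cst; exact: cvg_harmonic.
rewrite -(cvg_lim _ cv)//; apply: lime_ge; first by apply/cvg_ex; eexists; exact: cv.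
apply: nearW => k.
have k0 : 0 < k.+1%:R^-1 :> R by rewrite invr_gt0.
have [k1 [k10 k1a h1]] : exists k1, [/\ 0 < k1, k1 < a + k.+1%:R^-1 &
    (modular p (EFin \o (fun x => F x / k1)%R) <= 1)%E].
  by apply: Lvar_norm_lt; rewrite (le_lt_trans Fa)// lte_fin ltrDl.
have [k2 [k20 k2b h2]] : exists k2, [/\ 0 < k2, k2 < b + k.+1%:R^-1 &
    (modular (conjugate_exponent p) (EFin \o (fun x => G x / k2)%R) <= 1)%E].
  by apply: Lvar_norm_lt; rewrite (le_lt_trans Gb)// lte_fin ltrDl.
apply: (le_trans (main k1 k2 k10 k20 h1 h2)); rewrite lee_fin ler_pM2l//.
by apply: ler_pM; exact: ltW.
Qed.

(* For [k > a] the test function is [f ^ (p - 1) / rho] with [f = |F| / k], cut off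
   to the part of [B] where [f <= N], [rho] being the modular of [f] there. *)
Lemma Lvar_norm_dual F (B : set rV) (a : R) : measurable_fun setT F ->
  measurable B -> (leb B < +oo)%E -> 0 <= a ->
  (forall g, bounded_measurable g -> (forall x, 0 <= g x) -> (forall x, ~ B x -> g x = 0) ->
     (Lvar_norm (conjugate_exponent p) (EFin \o g) <= 1)%E ->
     (\int[leb]_x (`|F x| * g x)%:E <= a%:E)%E) ->
  (Lvar_norm p (EFin \o (fun x => F x * \1_B x)%R) <= a%:E)%E.
Proof.
move=> mF mB Boo a0 dual; have [mp p1 _] := pr.
have [P [A [mA A0 AP]]] := regular_exponentP.
have mr : measurable_fun setT (fun x => fine (p x)).
  by apply: measurableT_comp mp; exact: fine_measurable.
have mr1 : measurable_fun setT (fun x => fine (p x) - 1).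
  by apply: (measurable_funB mr); exact: measurable_cst.
suff H (k : R) : a < k -> (Lvar_norm p (EFin \o (fun x => F x * \1_B x)%R) <= k%:E)%E.
  by apply/lee_addgt0Pr => eps eps0; rewrite -EFinD; apply: H; rewrite ltrDl.
move=> ak; have k0 : 0 < k by exact: le_lt_trans ak.
apply: Lvar_norm_le => //.
have mFB : measurable_fun setT (fun x => F x * \1_B x / k).
  by apply: measurable_funM; [apply: measurable_funM mF _; exact: measurable_indic|exact: measurable_cst].
have Apoo x : A x -> (p x < +oo)%E by move=> /AP[].
rewrite (modular_aeE mp mFB mA A0 Apoo).
pose f x := `|F x / k|.
have f0 x : 0 <= f x by exact: normr_ge0.
have mf : measurable_fun setT f.
  apply: measurableT_comp; first exact: normr_measurable.
  by apply: measurable_funM mF _; exact: measurable_cst.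
pose fp x := f x `^ fine (p x).
have mfp : measurable_fun setT fp by exact: measurable_powR_fun.
have fp0 x : 0 <= fp x by exact: powR_ge0.
pose D N := (B `&` A) `&` [set x | f x <= N%:R].
have mD N : measurable (D N).
  apply: measurableI; first exact: measurableI.
  rewrite -[X in measurable X]setTI.
  have mf' : measurable_fun setT (EFin \o f) by exact/measurable_EFinP.
  exact: (emeasurable_fun_infty_c measurableT mf' N%:R%:E).
have DU : \bigcup_N D N = B `&` A.
  apply/seteqP; split => x; first by move=> [N _ []].
  move=> BA; exists (Num.truncn (f x)).+1 => //; split => //=.
  by apply: ltW; exact: truncnS_gt.
have -> : (\int[leb]_(x in A) (`|F x * \1_B x / k| `^ fine (p x))%:E =
    \int[leb]_(x in B `&` A) (fp x)%:E)%E.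
  rewrite setIC -integral_indic_real; apply: eq_integral => x /set_mem/AP[r1 _ _ _ _].
  congr (_%:E); rewrite /fp /f indicE; case: (x \in B); rewrite ?mulr1// !mulr0 mul0r normr0.
  by rewrite powR0// gt_eqF// (lt_trans ltr01).
have cv : (\int[leb]_(x in D N) (fp x)%:E)%E @[N --> \oo] -->
    (\int[leb]_(x in \bigcup_N D N) (fp x)%:E)%E.
  apply: ge0_nondecreasing_set_cvg_integral.
  - apply/nondecreasing_seqP => N; apply/subsetPset => x [BA /= fN]; split => //=.
    by apply: (le_trans fN); rewrite ler_nat.
  - exact: mD.
  - by move=> N; exact: measurable_EFin_restr.
  - by move=> N x _; rewrite lee_fin.
rewrite -DU -(cvg_lim _ cv)//; apply: lime_le; first by apply/cvg_ex; eexists; exact: cv.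
apply: nearW => N; rewrite leNgt; apply/negP => rho1.
have P1 : 0 <= Num.max P 0 by rewrite le_max lexx orbT.
(* One bound on [D N] for the powers of [f] with exponents between 0 and [p]; it serves for [p] and
   for [p - 1]. *)
pose C := (Num.max N%:R 1) `^ Num.max P 0 : R.
have max1 : 1 <= Num.max N%:R 1 :> R by rewrite le_max lexx orbT.
have fpC x (t : R) : D N x -> 0 <= t -> t <= fine (p x) -> f x `^ t <= C.
  move=> [[_ Ax] /= fN] t0 tp; have [_ rP _ _ _] := AP _ Ax.
  apply: (@le_trans _ _ (Num.max N%:R 1 `^ t)).
    apply: ge0_ler_powR; rewrite ?nnegrE ?f0 ?t0 ?(le_trans ler01 max1)//.
    by rewrite le_max fN.
  by apply: ler_powR => //; rewrite (le_trans tp)// le_max rP.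
have Boo' : (leb (D N) < +oo)%E.
  apply: le_lt_trans Boo; apply: (le_outer_measure lebesgue_outer).
  by move=> x [[]].
have rhoE : exists2 rho : R, 1 < rho & (\int[leb]_(x in D N) (fp x)%:E = rho%:E)%E.
  have : (\int[leb]_(x in D N) (fp x)%:E < +oo)%E.
    apply: (@le_lt_trans _ _ (\int[leb]_(x in D N) C%:E)%E).
      apply: ge0_le_integral_nomeas => x Dx; first by rewrite lee_fin.
      rewrite lee_fin; apply: (fpC _ _ Dx) => //.
      by case: Dx => -[_ /AP[r1 _ _ _ _] _]; rewrite ltW// (lt_trans ltr01).
    by rewrite integral_cst_set// lte_mul_pinfty// lee_fin powR_ge0.
  move: rho1; case: (\int[leb]_(x in D N) (fp x)%:E)%E => // rho; rewrite lte_fin => h _.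
  by exists rho.
have [rho rho_gt1 rhoI] := rhoE; have rho0 : 0 < rho by exact: lt_trans rho_gt1.
pose g x := \1_(D N) x * (f x `^ (fine (p x) - 1) / rho).
have g0 x : 0 <= g x by rewrite mulr_ge0// divr_ge0 ?powR_ge0// ltW.
have mg : measurable_fun setT g.
  apply: measurable_funM; first exact: measurable_indic.
  by apply: measurable_funM; [exact: measurable_powR_fun|exact: measurable_cst].
have gC x : `|g x| <= C / rho.
  rewrite ger0_norm// /g indicE; have [/set_mem Dx|_] := boolP (x \in D N); last first.
    by rewrite mul0r divr_ge0 ?powR_ge0// ltW.
  rewrite mul1r ler_pM2r ?invr_gt0//; apply: fpC => //; last by rewrite gerBl.
  by case: Dx => -[_ /AP[r1 _ _ _ _] _]; rewrite subr_ge0 ltW.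
have gD x : ~ D N x -> g x = 0 by move=> nD; rewrite /g indicE memNset// mul0r.
have fpM x : f x * f x `^ (fine (p x) - 1) = fp x :> R \/ ~ D N x.
  have [Dx|] := pselect (D N x); last by right.
  left; have [[_ /AP[r1 _ _ _ _]] _] := Dx.
  by rewrite mulr_powRB1// (lt_trans ltr01).
have : (\int[leb]_x (`|F x| * g x)%:E <= a%:E)%E.
  apply: dual => //; first by split => //; exists (C / rho).
    by move=> x nB; apply: gD => -[[]].
  apply: Lvar_norm_le => //.
  under [X in modular _ (EFin \o X)]eq_fun do rewrite divr1.
  have DNoo x : D N x -> (conjugate_exponent p x < +oo)%E by move=> [[_ /AP[]]].
  rewrite (modular_supportE DNoo gD conjugate_exponent_ge1).
  apply: (@le_trans _ _ (\int[leb]_(x in D N) (rho^-1 * fp x)%:E)%E); last first.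
    by rewrite ge0_integralZl_real ?rhoI -?EFinM ?mulVf ?gt_eqF ?invr_ge0// ltW.
  apply: ge0_le_integral_nomeas => x Dx; first by rewrite lee_fin powR_ge0.
  rewrite lee_fin ger0_norm// /g indicE mem_set// mul1r.
  have [[_ /AP[r1 _ _ _ ->]] _] := Dx; set r := fine (p x) in r1 *.
  have r10 : 0 < r - 1 by rewrite subr_gt0.
  have r0 : 0 < r by rewrite (lt_trans ltr01).
  rewrite powRM ?powR_ge0 ?invr_ge0 ?(ltW rho0)// -powRrM.
  have -> : (r - 1) * (r / (r - 1)) = r by field; rewrite gt_eqF.
  rewrite mulrC ler_wpM2r ?powR_ge0//.
  (* Since [rho > 1] and the conjugate exponent is at least 1, the power of [rho^-1] is at most
     [rho^-1]; this makes the modular of [g] at most 1. *)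
  apply: ge1r_powR; first by rewrite invr_gt0 rho0 invf_le1 ?ltW.
  by rewrite ler_pdivlMr// mul1r lerBlDr lerDl.
rewrite leNgt => /negP; apply.
apply: (@lt_le_trans _ _ k%:E); first by rewrite lte_fin.
(* The test function pairs with [|F|] to at least [k], against the assumed bound [a < k]. *)
have -> : (k%:E = \int[leb]_(x in D N) ((k / rho) * fp x)%:E)%E.
  rewrite ge0_integralZl_real ?rhoI// -?EFinM; last by rewrite divr_ge0 ?ltW.
  by congr (_%:E); field; rewrite gt_eqF.
rewrite integral_mkcond; apply: ge0_le_integral_nomeas => x _.
  by apply: erestrict_ge0 => y _; rewrite lee_fin mulr_ge0// divr_ge0 ?ltW.
rewrite patchE; case: ifPn => [/set_mem Dx|_]; last by rewrite lee_fin mulr_ge0.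
have [fpE|//] := fpM x; rewrite lee_fin /g indicE mem_set// mul1r -fpE.
have -> : `|F x| = k * f x.
  by rewrite /f normrM normfV (gtr0_norm k0); field; rewrite gt_eqF.
by rewrite le_eqVlt; apply/orP; left; apply/eqP; field; rewrite gt_eqF.
Qed.

End VariableLebesgue.

(** * Morrey and block spaces *)

Section MorreyBlockTheory.
Context {R : realType} {n : nat} (hn : (0 < n)%N).
Local Notation rV := 'rV[R]_n.
Implicit Types (e p : rV -> \bar R) (F G : rV -> R) (u : rV -> R -> R).

Lemma le_Lvar_norm e F G : (forall x, (0 <= e x)%E) ->
  (forall x, `|F x| <= `|G x|) -> (Lvar_norm e (EFin \o F) <= Lvar_norm e (EFin \o G))%E.
Proof.
move=> e0 FG; apply: le_ereal_inf => _ [k [k0 h] <-]; exists k; last by [].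
split; first exact: k0.
apply: le_trans h; apply: leeD.
  apply: ge0_le_integral_nomeas => x _; first by rewrite poweR_ge0.
  rewrite /= inver gt_eqF// -!EFinM lee_fin.
  apply: ge0_ler_powR; rewrite ?nnegrE//; first by exact: fine_ge0.
  by rewrite !normrM ler_wpM2r.
apply: le_ess_sup; apply: aeW => x; apply: lee_wpmul2r; first by rewrite lee_fin.
by rewrite /= inver gt_eqF// -!EFinM lee_fin !normrM ler_wpM2r.
Qed.

Lemma Lvar_norm_indicE e F (B : set rV) :
  Lvar_norm e (fun y => (EFin \o F) y * (\1_B y)%:E)%E =
  Lvar_norm e (EFin \o (fun y => F y * \1_B y)).
Proof. by []. Qed.

Lemma le_morrey_norm e u F G : (forall x, (0 <= e x)%E) -> (forall x r, 0 < r -> 0 < u x r) ->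
  (forall x, `|F x| <= `|G x|) ->
  (morrey_norm (Lvar_norm e) u (EFin \o F) <= morrey_norm (Lvar_norm e) u (EFin \o G))%E.
Proof.
move=> e0 u0 FG; apply: ge_ereal_sup => _ [x [r [r0 ->]]].
apply: (@le_trans _ _ ((u x r)^-1%:E * Lvar_norm e (fun y => (EFin \o G) y * (\1_(eball x r) y)%:E))%E).
  apply: lee_wpmul2l; first by rewrite lee_fin invr_ge0 ltW// u0.
  rewrite !Lvar_norm_indicE; apply: le_Lvar_norm => // y.
  by rewrite !normrM ler_wpM2r.
by apply: ereal_sup_ubound; exists x, r.
Qed.

Lemma morrey_norm_ge0 e u f : (forall x r, 0 < r -> 0 < u x r) ->
  (0 <= morrey_norm (Lvar_norm e) u f)%E.
Proof.
move=> u0; apply: (@le_trans _ _ ((u 0 1)^-1%:E *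
   Lvar_norm e (fun y => f y * (\1_(eball 0 1) y)%:E))%E).
  by rewrite mule_ge0 ?Lvar_norm_ge0// lee_fin invr_ge0 ltW// u0.
by apply: ereal_sup_ubound; exists 0, 1.
Qed.

Lemma Lvar_norm_le_morrey e u F (a : R) x r : (forall x r, 0 < r -> 0 < u x r) -> 0 < r ->
  (morrey_norm (Lvar_norm e) u (EFin \o F) <= a%:E)%E ->
  (Lvar_norm e (EFin \o (fun y => F y * \1_(eball x r) y)%R) <= (a * u x r)%:E)%E.
Proof.
move=> u0 r0 Fa; have ur := u0 x r r0.
rewrite -Lvar_norm_indicE mulrC EFinM -lee_pdivrMl//; apply: le_trans Fa.
by apply: ereal_sup_ubound; exists x, r.
Qed.

Lemma block_norm_ge0 e u f : (0 <= block_norm (Lvar_norm e) u f)%E.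
Proof.
apply: le_ereal_inf_tmp => _ [lam [g [_ ->]]].
by apply: nneseries_ge0 => k _ _; rewrite lee_fin.
Qed.

Lemma measurable_eball (x : rV) (r : R) : measurable (eball x r).
Proof. by apply: measurable_open => //; exact: open_eball. Qed.

(** On the ball of the block the Morrey bound gives a factor u(x0, r) and the block its inverse;
    they cancel in Hoelder's inequality. *)
Lemma integral_block_le p u F g (a : R) : regular_exponent p ->
  (forall x r, 0 < r -> 0 < u x r) -> measurable_fun setT F -> 0 <= a ->
  (morrey_norm (Lvar_norm p) u (EFin \o F) <= a%:E)%E ->
  is_block (Lvar_norm (conjugate_exponent p)) u g ->
  (\int[leb]_x (`|F x| * `|g x|)%:E <= (2 * a)%:E)%E.
Proof.
move=> pr u0 mF a0 Fa [mg [x0 [r [r0 g0 gu]]]]; have ur := u0 x0 r r0.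
have FB := Lvar_norm_le_morrey x0 u0 r0 Fa.
have mFB : measurable_fun setT (fun y => F y * \1_(eball x0 r) y).
  by apply: (measurable_funM mF); apply: measurable_indic; exact: measurable_eball.
have au : 0 <= a * u x0 r by rewrite mulr_ge0// ltW.
have ui : 0 <= (u x0 r)^-1 by rewrite invr_ge0 ltW.
have := Lvar_hoelder hn pr mFB mg au ui FB gu.
rewrite mulfK ?gt_eqF//; apply: le_trans; apply: ge0_le_integral_nomeas => x _.
  by rewrite lee_fin mulr_ge0.
rewrite lee_fin; have [xB|xB] := pselect (eball x0 r x).
  by rewrite indicE mem_set// mulr1.
by rewrite (g0 _ xB) normr0 !mulr0.
Qed.

Lemma le_norm_lim_series (a : nat -> R) (s : R) :
  (fun N => \sum_(0 <= k < N) a k) @ \oo --> s ->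
  (`|s|%:E <= \sum_(0 <= k <oo) `|a k|%:E)%E.
Proof.
move=> as_; have cv : (fun N => `|\sum_(0 <= k < N) a k|%:E) @ \oo --> `|s|%:E.
  by apply/fine_cvgP; split; [exact: nearW|exact: cvg_norm].
rewrite -(cvg_lim _ cv)//; apply: lime_le; first by apply/cvg_ex; eexists; exact: cv.
apply: nearW => N; apply: (@le_trans _ _ (\sum_(0 <= k < N) `|a k|%:E)%E).
  by rewrite sumEFin lee_fin ler_norm_sum.
by apply: nneseries_lim_ge => k _ _; rewrite lee_fin.
Qed.

Lemma morrey_block_pairing p u F G (a : R) : regular_exponent p ->
  (forall x r, 0 < r -> 0 < u x r) -> measurable_fun setT F -> measurable_fun setT G ->
  0 < a -> (morrey_norm (Lvar_norm p) u (EFin \o F) <= a%:E)%E ->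
  (\int[leb]_x (`|F x| * `|G x|)%:E <=
   (2 * a)%:E * block_norm (Lvar_norm (conjugate_exponent p)) u (EFin \o G))%E.
Proof.
(* Dividing by the positive constant reduces the claim to a lower bound for each decomposition in
   the infimum. *)
move=> pr u0 mF mG a0 Fa; rewrite -lee_pdivrMl ?mulr_gt0//.
apply: le_ereal_inf_tmp => _ [lam [g [[gb lamoo Gae] ->]]].
rewrite lee_pdivrMl ?mulr_gt0//.
have mnF : measurable_fun setT (fun x => `|F x|).
  by apply: measurableT_comp mF; exact: normr_measurable.
have mg k : measurable_fun setT (g k) by case: (gb k).
have mng k : measurable_fun setT (fun x => `|g k x|).
  by apply: measurableT_comp (mg k); exact: normr_measurable.
have mFg k : measurable_fun setT (fun x => `|F x| * `|g k x|) by exact: measurable_funM.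
have mterm k : measurable_fun setT (fun x => (`|lam k| * (`|F x| * `|g k x|))%:E).
  by apply/measurable_EFinP; apply: (measurable_funM _ (mFg k)); exact: measurable_cst.
have term0 k (x : rV) : [set: rV] x -> (0 <= (`|lam k| * (`|F x| * `|g k x|))%:E)%E.
  by move=> _; rewrite lee_fin !mulr_ge0.
apply: (@le_trans _ _ (\int[leb]_x \sum_(0 <= k <oo) (`|lam k| * (`|F x| * `|g k x|))%:E)%E).
  apply: (ae_ge0_le_integral measurableT).
  - by move=> x _; rewrite lee_fin mulr_ge0.
  - apply/measurable_EFinP; apply: (measurable_funM mnF).
    by apply: measurableT_comp mG; exact: normr_measurable.
  - by move=> x _; apply: nneseries_ge0 => k _ _; exact: term0.
  - by apply: ge0_emeasurable_sum => k => [x _ _|_]; [exact: term0|exact: mterm].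
  - apply: filterS Gae => x [_ /le_norm_lim_series /= H] _.
    under eq_eseriesr do rewrite mulrCA EFinM -normrM.
    rewrite nneseriesZl; last by move=> k _; rewrite lee_fin.
    by rewrite EFinM; apply: lee_wpmul2l => //; rewrite lee_fin.
rewrite (integral_nneseries leb measurableT mterm term0).
rewrite -nneseriesZl; last by move=> k _; rewrite lee_fin.
apply: lee_nneseries => k _; first by move=> _; apply: integral_ge0 => x; exact: term0.
have Fg0 x : 0 <= `|F x| * `|g k x| by rewrite mulr_ge0.
rewrite (ge0_integralZl_real leb measurableT (mFg k) Fg0 (normr_ge0 (lam k))).
rewrite muleC; apply: lee_wpmul2r; first by rewrite lee_fin.
exact: (integral_block_le pr u0 mF (ltW a0) Fa (gb k)).
Qed.

(** A decomposition of [G] is multiplied by the quotient [F / G], of modulus at most 1: blocks stay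
    blocks and the coefficients do not change. *)
Lemma le_block_norm e u F G : (forall x, (0 <= e x)%E) -> measurable_fun setT F ->
  measurable_fun setT G -> (forall x, `|F x| <= G x) ->
  (block_norm (Lvar_norm e) u (EFin \o F) <= block_norm (Lvar_norm e) u (EFin \o G))%E.
Proof.
move=> e0 mF mG FG; apply: le_ereal_inf => _ [lam [g [[gb lamoo Gae] ->]]].
pose w x := F x * (G x) `^ (-1).
have G0 x : 0 <= G x by exact: le_trans (FG x).
have wE x : w x = F x / G x by rewrite /w powR_inv1.
have w1 x : `|w x| <= 1.
  rewrite wE normrM normfV (ger0_norm (G0 x)).
  have [->|Gx0] := eqVneq (G x) 0; first by rewrite invr0 mulr0 ler01.
  by rewrite ler_pdivrMr ?mul1r ?FG// lt_neqAle eq_sym Gx0 G0.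
have wG x : w x * G x = F x.
  rewrite wE; have [Gx0|Gx0] := eqVneq (G x) 0; last by rewrite divfK.
  by rewrite Gx0 mulr0; apply/esym/eqP; rewrite -normr_le0 -Gx0.
have mw : measurable_fun setT w.
  by apply: (measurable_funM mF); apply: measurable_powR_fun mG _; exact: measurable_cst.
exists lam, (fun k x => w x * g k x); split; last by [].
split; [|exact: lamoo|].
  move=> k; have [mg [x0 [r [r0 g0 gu]]]] := gb k; split; first exact: measurable_funM.
  exists x0, r; split; [exact: r0|by move=> y /g0 ->; rewrite mulr0|].
  apply: le_trans gu; apply: le_Lvar_norm => // x.
  by rewrite normrM ler_piMl.
apply: filterS Gae => x [_ /= H]; split; first by [].
rewrite /=.
have -> : (fun N => \sum_(0 <= k < N) lam k * (w x * g k x)) =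
    (fun N => w x * \sum_(0 <= k < N) lam k * g k x).
  by apply/funext => N; rewrite mulr_sumr; apply: eq_bigr => k _; rewrite mulrCA.
by rewrite -wG; apply: cvgM H; exact: cvg_cst.
Qed.

(** The decomposition has the single coefficient [k * u x r]. The hypothesis is on the modular, so
    that [k] itself bounds the norm of [F]. *)
Lemma block_norm_block e u F (k : R) x r : (forall x r, 0 < r -> 0 < u x r) ->
  measurable_fun setT F -> 0 < r -> 0 < k -> (forall y, ~ eball x r y -> F y = 0) ->
  (modular e (EFin \o (fun y => F y / k)%R) <= 1)%E ->
  (block_norm (Lvar_norm e) u (EFin \o F) <= (k * u x r)%:E)%E.
Proof.
move=> u0 mF r0 k0 FB Fk; have ur := u0 x r r0.
pose lam (j : nat) : R := if j is 0%N then k * u x r else 0.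
have slam : (\sum_(0 <= j <oo) `|lam j|%:E = (k * u x r)%:E)%E.
  rewrite (@nneseriesD1 _ _ 0%N)//= eseries0 ?adde0 ?ger0_norm ?mulr_ge0 ?(ltW k0) ?(ltW ur)//.
  by move=> [|j]//= _ _; rewrite normr0.
apply: ereal_inf_lbound; exists lam, (fun _ y => F y / (k * u x r)); split; last by rewrite slam.
split; last 1 first.
- apply: aeW => y; split => //=.
  have FyE : \sum_(0 <= j < 1) lam j * (F y / (k * u x r)) = F y.
    by rewrite big_nat1 /= mulrC divfK// mulf_neq0 ?gt_eqF.
  apply: cvg_near_cst; near=> N.
  have N1 : (1 <= N)%N by near: N; exact: nbhs_infty_ge.
  rewrite [LHS](@big_cat_nat _ _ _ 1%N)//= FyE big_nat_cond big1 ?addr0//.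
  by move=> [|j]//= _; rewrite mul0r.
- move=> _; split; first by apply: (measurable_funM mF); exact: measurable_cst.
  exists x, r; split; [exact: r0|by move=> y /FB ->; rewrite mul0r|].
  apply: Lvar_norm_le; rewrite ?invr_gt0//.
  rewrite [X in modular e X](_ : _ = EFin \o (fun y => F y / k)%R)//.
  by apply/funext => y /=; congr (_%:E); field; rewrite !gt_eqF.
- by rewrite slam ltry.
Unshelve. all: by end_near. Qed.

End MorreyBlockTheory.

Lemma indic_div_powR_le (R : realType) (T : Type) (B : set T) (K t : R) (x : T) :
  1 <= K -> 1 <= t -> `|\1_B x / K| `^ t <= \1_B x / K.
Proof.
move=> K1 t1; have K0 : 0 < K by exact: lt_le_trans K1.
rewrite indicE ger0_norm ?divr_ge0 ?(ltW K0)//; case: (x \in B); last first.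
  by rewrite mul0r powR0// gt_eqF// (lt_le_trans ltr01).
by rewrite mul1r; apply: ge1r_powR => //; rewrite invr_gt0 K0 invf_le1.
Qed.

(** * Lower bounds for the operator norms, tested on the unit cube *)

Section TestFunctions.
Context {R : realType} {n : nat} (hn : (0 < n)%N).
Local Notation rV := 'rV[R]_n.
Variables (p : rV -> \bar R) (u : rV -> R -> R).
Hypotheses (pr : regular_exponent p) (W : W0 (Lvar_norm p) u).

Let Q0 : set rV := cube 0 1.
Let B0 : set rV := eball 0 n.+1%:R.

Let cQ0 : is_cube Q0. Proof. by exists 0, 1. Qed.
Let mQ0 : measurable Q0. Proof. exact: is_cube_measurable. Qed.
Let Q0B0 : Q0 `<=` B0.
Proof. by have := @cube_subset_eball R n 0 1 ltr01; rewrite mulr1. Qed.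

Let lebQ0 : leb Q0 = 1%E.
Proof. by rewrite leb_cube// expr1n. Qed.

Let u0 x r : 0 < r -> 0 < u x r. Proof. by have [[u0 _] _] := W; exact: u0. Qed.

Let p0 x : (0 <= p x)%E.
Proof. by have [_ p1 _] := pr; exact: le_trans (p1 x). Qed.

Let q0 x : (0 <= conjugate_exponent p x)%E.
Proof. exact: le_trans (conjugate_exponent_ge1 pr x). Qed.

Lemma measurable_indic_real (B : set rV) : measurable B ->
  measurable_fun setT (fun x => \1_B x : R).
Proof. by move=> mB; exact: measurable_indic. Qed.

Let integral_indic_div_le (A B : set rV) (K : R) : measurable A -> measurable B ->
  1 <= K -> (leb B <= K%:E)%E -> (\int[leb]_(x in A) (\1_B x / K)%:E <= 1)%E.
Proof.
move=> mA mB K1 BK; have K0 : 0 < K by exact: lt_le_trans K1.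
have -> : (\int[leb]_(x in A) (\1_B x / K)%:E = \int[leb]_(x in A) (K^-1 * \1_B x)%:E)%E.
  by apply: eq_integral => x _; rewrite mulrC.
rewrite integral_indic_real integral_cst_set; last exact: measurableI.
rewrite lee_pdivrMl// mule1; apply: le_trans BK.
by apply: (le_outer_measure lebesgue_outer); exact: subIsetr.
Qed.

Let lebK (B : set rV) : (leb B < +oo)%E -> exists2 K : R, 1 <= K & (leb B <= K%:E)%E.
Proof.
move=> Boo; have Bf : leb B \is a fin_num by rewrite ge0_fin_numE ?measure_ge0.
exists (Num.max 1 (fine (leb B))); first by rewrite le_max lexx.
by rewrite -(fineK Bf) lee_fin le_max lexx orbT.
Qed.

Lemma Lvar_norm_indic_fin (B : set rV) : measurable B -> (leb B < +oo)%E ->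
  exists K : R, (Lvar_norm p (EFin \o \1_B) <= K%:E)%E.
Proof.
move=> mB Boo; have [K K1 BK] := lebK Boo; have K0 : 0 < K by exact: lt_le_trans K1.
have [mp p1 _] := pr; have [P [A [mA A0 AP]]] := regular_exponentP pr.
exists K; apply: Lvar_norm_le => //.
have mBK : measurable_fun setT (fun x => \1_B x / K).
  by apply: measurable_funM; [exact: measurable_indic_real|exact: measurable_cst].
have Ap x : A x -> (p x < +oo)%E by move=> /AP[].
rewrite (modular_aeE hn mp mBK mA A0 Ap).
apply: le_trans (integral_indic_div_le mA mB K1 BK).
apply: ge0_le_integral_nomeas => x Ax; first by rewrite lee_fin powR_ge0.
by rewrite lee_fin; apply: indic_div_powR_le => //; have [/ltW] := AP _ Ax.
Qed.

(** The null set where the conjugate exponent may be infinite is removed from [B]. That exponent may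
    still be unbounded on [E]; the modular is controlled because [K >= 1] gives [K ^ (- t) <= K^-1]
    for every [t >= 1]. *)
Lemma conjugate_test_set (B : set rV) : measurable B -> (leb B < +oo)%E ->
  exists (E : set rV) (K : R), [/\ measurable E, E `<=` B, leb E = leb B, 0 < K &
    (modular (conjugate_exponent p) (EFin \o (fun x => \1_E x / K)%R) <= 1)%E].
Proof.
move=> mB Boo; have [K K1 BK] := lebK Boo; have K0 : 0 < K by exact: lt_le_trans K1.
have [P [A [mA A0 AP]]] := regular_exponentP pr.
have mE : measurable (B `&` A) by exact: measurableI.
have EB : (leb (B `&` A) <= leb B)%E.
  by apply: (le_outer_measure lebesgue_outer); exact: subIsetl.
exists (B `&` A), K; split => //.
- apply/eqP; rewrite eq_le EB/=.
  apply: (@le_trans _ _ (leb ((B `&` A) `|` ~` A))).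
    apply: (le_outer_measure lebesgue_outer) => x Bx.
    by have [Ax|nAx] := pselect (A x); [left|right].
  apply: (le_trans (outer_measureU2 lebesgue_outer _ _)).
  by rewrite [X in (_ + X)%E]A0 adde0.
- have Aq x : A x -> (conjugate_exponent p x < +oo)%E by move=> /AP[].
  rewrite (modular_supportE hn Aq _ (conjugate_exponent_ge1 pr)); last first.
    by move=> x nAx; rewrite indicE memNset ?mul0r// => -[].
  apply: le_trans (integral_indic_div_le mA mE K1 (le_trans EB BK)).
  apply: ge0_le_integral_nomeas => x Ax; first by rewrite lee_fin powR_ge0.
  rewrite lee_fin; apply: indic_div_powR_le => //.
  have [r1 _ _ _ ->] := AP _ Ax; rewrite ler_pdivlMr ?subr_gt0// mul1r lerBlDr lerDl ?ltr01 ?ler01//.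
Qed.

Lemma integral_indic_sq (E F : set rV) : measurable E -> E `<=` F ->
  (\int[leb]_x (`|\1_F x : R| * `|\1_E x : R|)%:E = leb E)%E.
Proof.
move=> mE EF; transitivity (\int[leb]_x ((1 : R) * \1_E x)%:E)%E.
  apply: eq_integral => x _; rewrite !indicE; congr (_%:E).
  have [/set_mem Ex|nEx] := boolP (x \in E); last by rewrite normr0 !mulr0.
  by rewrite mem_set ?normr1//; exact: EF.
by rewrite integral_indic_real setTI integral_cst_set// mul1e.
Qed.

(** If the norm were 0, Hoelder's inequality against the indicator of the set of
    [conjugate_test_set] would give [B] measure 0. *)
Lemma Lvar_norm_indic_gt0 (B : set rV) : measurable B -> (leb B < +oo)%E -> (0 < leb B)%E ->
  (0 < Lvar_norm p (EFin \o \1_B))%E.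
Proof.
move=> mB Boo B0'; rewrite lt_neqAle Lvar_norm_ge0 andbT; apply/eqP => H.
have [E [K [mE EB EBl K0 hK]]] := conjugate_test_set mB Boo.
have := Lvar_hoelder hn pr (measurable_indic_real mB) (measurable_indic_real mE)
  (lexx 0) (ltW K0) _ (Lvar_norm_le K0 hK).
rewrite -H => /(_ (lexx _)); rewrite integral_indic_sq// EBl mul0r mulr0.
by rewrite leNgt B0'.
Qed.

Lemma morrey_norm_indic_fin :
  exists2 a : R, 0 < a & (morrey_norm (Lvar_norm p) u (EFin \o \1_Q0) <= a%:E)%E.
Proof.
have [_ [C [C0 uC _]]] := W.
have mB x r : measurable (eball x r : set rV) by exact: measurable_eball.
have B0oo : (leb B0 < +oo)%E.
  apply: (@le_lt_trans _ _ (leb (cube (0 - const_mx n.+1%:R : rV) (2 * n.+1%:R)))).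
    by apply: (le_outer_measure lebesgue_outer); exact: eball_subset_cube.
  by rewrite leb_cube ?ltry// mulr_ge0.
have [K hK] := Lvar_norm_indic_fin (mB 0 n.+1%:R) B0oo.
have n0 : 0 < n.+1%:R :> R by rewrite ltr0n.
have uB := u0 0 n0; set t := u 0 n.+1%:R in uB.
exists (Num.max (K / t) (C * (K / t)) + 1).
  rewrite ltr_wpDl// le_max; apply/orP; left; rewrite divr_ge0 ?(ltW uB)//.
  by rewrite -lee_fin; apply: le_trans hK; exact: Lvar_norm_ge0.
apply: ge_ereal_sup => _ [x [r [r0 ->]]]; have ur := u0 x r0.
rewrite Lvar_norm_indicE; apply: (@le_trans _ _ (Num.max (K / t) (C * (K / t)))%:E); last first.
  by rewrite lee_fin lerDl.
(* If the weight is at least [t], the norm of the indicator of [Q0] suffices. If it is smaller, the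
   first condition of [W0] compares the ball with the reference ball [B0]. *)
have [tu|ut] := leP t (u x r).
  apply: (@le_trans _ _ (K / t)%:E); last by rewrite lee_fin le_max lexx.
  apply: (@le_trans _ _ ((u x r)^-1%:E * K%:E)%E).
    apply: lee_wpmul2l; first by rewrite lee_fin invr_ge0 ltW.
    apply: le_trans hK; apply: le_Lvar_norm => // y.
    rewrite !indicE; have [/set_mem Qy|_] := boolP (y \in Q0).
      by rewrite mul1r [y \in B0]mem_set ?normr1; [case: (_ \in _); rewrite ?normr1 ?normr0|exact: Q0B0].
    by rewrite mul0r normr0.
  rewrite -EFinM lee_fin mulrC ler_wpM2l ?lef_pV2//.
  by rewrite -lee_fin; apply: le_trans hK; exact: Lvar_norm_ge0.
apply: (@le_trans _ _ (C * (K / t))%:E); last by rewrite lee_fin le_max lexx orbT.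
apply: (@le_trans _ _ (indic_norm (Lvar_norm p) x r / (u x r)%:E)%E).
  rewrite muleC inver (gt_eqF ur); apply: lee_wpmul2r; first by rewrite lee_fin invr_ge0 ltW.
  apply: le_Lvar_norm => // y.
  by rewrite normrM ler_piMl// indicE; case: (_ \in _); rewrite ?normr1 ?normr0.
apply: (le_trans (uC _ 0 _ _ r0 n0 (ltW ut))).
rewrite EFinM; apply: lee_wpmul2l; first by rewrite lee_fin ltW.
rewrite -/t inver (gt_eqF uB) EFinM; apply: lee_wpmul2r; last exact: hK.
by rewrite lee_fin invr_ge0 ltW.
Qed.

Let indicQ0B0 : (fun y => \1_Q0 y * \1_B0 y) = \1_Q0 :> (rV -> R).
Proof.
apply/funext => y; rewrite !indicE; have [/set_mem Qy|_] := boolP (y \in Q0).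
  by rewrite [y \in B0]mem_set ?mulr1//; exact: Q0B0.
by rewrite mul0r.
Qed.

Lemma morrey_norm_indic_gt0 : (0 < morrey_norm (Lvar_norm p) u (EFin \o \1_Q0))%E.
Proof.
have n0 : 0 < n.+1%:R :> R by rewrite ltr0n.
apply: (@lt_le_trans _ _ ((u 0 n.+1%:R)^-1%:E * Lvar_norm p (EFin \o \1_Q0))%E).
  rewrite mule_gt0 ?lte_fin ?invr_gt0 ?u0//.
  by apply: Lvar_norm_indic_gt0; rewrite ?lebQ0 ?ltry.
apply: ereal_sup_ubound; exists 0, n.+1%:R; split; first exact: n0.
by rewrite Lvar_norm_indicE -/B0 indicQ0B0.
Qed.

Lemma bounded_measurable_indic (E : set rV) : measurable E ->
  bounded_measurable (\1_E : rV -> R).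
Proof.
move=> mE; split; first exact: measurable_indic_real.
by exists 1 => x; rewrite indicE; case: (_ \in _); rewrite ?normr1 ?normr0.
Qed.

Let indic_le_rmaximal (E : set rV) : measurable E -> E `<=` Q0 -> leb E = leb Q0 ->
  forall x, `|\1_E x : R| <= rmaximal (\1_E) x.
Proof.
move=> mE EQ EQl x; rewrite indicE; have [/set_mem Ex|_] := boolP (x \in E); last first.
  by rewrite normr0; exact: rmaximal_ge0.
rewrite normr1 -lee_fin; apply: le_trans (avg_le_rmaximal hn (bounded_measurable_indic mE) cQ0 (EQ _ Ex)).
rewrite /avg lebQ0 inver oner_eq0 invr1 mul1e.
have -> : (\int[leb]_(x in Q0) `|(EFin \o \1_E) x| = \int[leb]_(x in Q0) ((1 : R) * \1_E x)%:E)%E.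
  by apply: eq_integral => y _; rewrite /= mul1r ger0_norm.
by rewrite integral_indic_real integral_cst_set ?(setIidr EQ) ?mul1e ?EQl ?lebQ0//.
Qed.

Lemma op_norm_ge1 (N : (rV -> \bar R) -> \bar R) (F : rV -> R) : bounded_measurable F ->
  (0 < N (EFin \o F))%E -> (N (EFin \o F) < +oo)%E ->
  (N (EFin \o F) <= N (EFin \o rmaximal F))%E -> (1 <= op_norm N N maximal)%E.
Proof.
move=> bF N0 Noo NM; apply: le_ereal_inf_tmp => _ [c [c0 hc] <-].
have [v v0 Fv] : exists2 v : R, 0 < v & N (EFin \o F) = v%:E.
  by move: N0 Noo; case: (N _) => // v; rewrite lte_fin; exists v.
have := le_trans NM; rewrite (rmaximalE hn bF) => /(_ _ (hc _ bF.1 Noo)).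
by rewrite Fv -EFinM !lee_fin -[leLHS]mul1r ler_pM2r.
Qed.

Lemma op_norm_morrey_ge1 :
  (1 <= op_norm (morrey_norm (Lvar_norm p) u) (morrey_norm (Lvar_norm p) u) maximal)%E.
Proof.
have [a a0 ha] := morrey_norm_indic_fin.
apply: (@op_norm_ge1 _ (\1_Q0)); first exact: bounded_measurable_indic.
- exact: morrey_norm_indic_gt0.
- by apply: le_lt_trans ha _; rewrite ltry.
- apply: le_morrey_norm => // x; rewrite [leRHS]ger0_norm ?rmaximal_ge0//.
  exact: indic_le_rmaximal.
Qed.

Lemma block_norm_indic_fin : exists (E : set rV) (k : R),
  [/\ measurable E, E `<=` Q0, leb E = 1%E, 0 < k &
  (block_norm (Lvar_norm (conjugate_exponent p)) u (EFin \o \1_E) <= k%:E)%E].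
Proof.
have Q0oo : (leb Q0 < +oo)%E by rewrite lebQ0 ltry.
have [E [K [mE EQ EQl K0 hK]]] := conjugate_test_set mQ0 Q0oo.
have n0 : 0 < n.+1%:R :> R by rewrite ltr0n.
exists E, (K * u 0 n.+1%:R); split => //; first by rewrite EQl lebQ0.
  by rewrite mulr_gt0// u0.
apply: (block_norm_block u0 _ n0 K0 _ hK); first exact: measurable_indic_real.
by move=> y nB; rewrite indicE memNset// => /EQ/Q0B0.
Qed.

Lemma op_norm_block_ge1 :
  (1 <= op_norm (block_norm (Lvar_norm (conjugate_exponent p)) u)
                (block_norm (Lvar_norm (conjugate_exponent p)) u) maximal)%E.
Proof.
have [E [K [mE EQ EQl K0 hK]]] := block_norm_indic_fin.
have bE := bounded_measurable_indic mE.
apply: (op_norm_ge1 bE).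
- have [a a0 ha] := morrey_norm_indic_fin.
  have := morrey_block_pairing hn pr u0 (measurable_indic_real mQ0) (measurable_indic_real mE) a0 ha.
  rewrite integral_indic_sq// EQl => H; rewrite lt_neqAle block_norm_ge0 andbT.
  by apply/eqP => E0; move: H; rewrite -E0 mule0 lee_fin ler10.
- by apply: (le_lt_trans hK); exact: ltry.
- apply: le_block_norm.
  + exact: q0.
  + exact: measurable_indic_real.
  + by case: (bounded_measurable_rmaximal hn bE).
  + by apply: (indic_le_rmaximal mE EQ); rewrite EQl lebQ0.
Qed.

End TestFunctions.

(** Positivity is needed to deduce from a finite right-hand side that its other factors are finite.
    For indicators of the unit cube the multilinear maximal function is bounded below on the cube,
    and pairing with an indicator of finite block norm bounds its Morrey norm from below. *)
Lemma multi_op_norm_gt0 (R : realType) (n m : nat) (hn : (0 < n)%N)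
    (p : 'rV[R]_n -> \bar R) (ps : 'I_m -> 'rV[R]_n -> \bar R)
    (u : 'rV[R]_n -> R -> R) (us : 'I_m -> 'rV[R]_n -> R -> R) :
  regular_exponent p -> W0 (Lvar_norm p) u ->
  (forall i, regular_exponent (ps i)) -> (forall i, W0 (Lvar_norm (ps i)) (us i)) ->
  (0 < multi_op_norm (fun i => morrey_norm (Lvar_norm (ps i)) (us i))
     (morrey_norm (Lvar_norm p) u) (@multi_maximal R n m))%E.
Proof.
move=> pr W psr Ws; pose Q0 : set 'rV[R]_n := cube 0 1.
have cQ0 : is_cube Q0 by exists 0, 1.
have mQ0 : measurable Q0 by exact: is_cube_measurable.
have lebQ0 : leb Q0 = 1%E by rewrite leb_cube// expr1n.
have /choice[a ha] i : exists a : R, 0 < a /\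
    (morrey_norm (Lvar_norm (ps i)) (us i) (EFin \o \1_Q0) <= a%:E)%E.
  by have [a a0 ha] := morrey_norm_indic_fin hn (psr i) (Ws i); exists a.
have P0 : 0 < \prod_i a i by apply: prodr_gt0 => i _; case: (ha i).
have u0 x r : 0 < r -> 0 < u x r by have [[u0 _] _] := W; exact: u0.
pose c : R := (@ball_cube_ratio R n) ^+ m.
have c0 : 0 < c by rewrite exprn_gt0// ball_cube_ratio_gt0.
have bf (i : 'I_m) : bounded_measurable (\1_Q0 : 'rV[R]_n -> R).
  exact: bounded_measurable_indic.
have [E [k [mE EQ E1 k0 hk]]] := block_norm_indic_fin hn pr W.
pose P := \prod_i a i.
(* Chosen so that [2 * ((del + del) * P) * k = c^-1]. Using [t + del] instead of [t] keeps the
   Morrey bound positive, as the pairing requires. *)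
pose del := c^-1 / (4 * (P * k)).
have del0 : 0 < del by rewrite divr_gt0 ?invr_gt0// !mulr_gt0.
apply: (@lt_le_trans _ _ del%:E); first by rewrite lte_fin.
apply: le_ereal_inf_tmp => _ [t [t0 ht] <-]; rewrite lee_fin leNgt; apply/negP => tdel.
have Mle : (morrey_norm (Lvar_norm p) u
    (EFin \o rmulti_maximal (fun _ : 'I_m => \1_Q0 : 'rV[R]_n -> R)) <= ((t + del) * P)%:E)%E.
  rewrite (rmulti_maximalE hn bf); apply: le_trans (ht (fun=> \1_Q0) _ _) _.
  - by move=> i; exact: (bf i).1.
  - by move=> i; apply: le_lt_trans (ha i).2 _; exact: ltry.
  rewrite EFinM; apply: lee_pmul.
  - by rewrite lee_fin.
  - by apply: prode_ge0 => i _; apply: morrey_norm_ge0 => x r; have [[h _] _] := Ws i; exact: h.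
  - by rewrite lee_fin lerDl ltW.
  - rewrite -prodEFin; apply: lee_prode => i _; last by case: (ha i).
    by apply: morrey_norm_ge0 => x r; have [[h _] _] := Ws i; exact: h.
have tP0 : 0 < (t + del) * P by rewrite mulr_gt0// ltr_wpDl.
have := morrey_block_pairing hn pr u0 (measurable_rmulti_maximal hn bf)
  (measurable_indic_real mE) tP0 Mle.
apply/negP; rewrite -ltNge.
apply: (@le_lt_trans _ _ ((2 * ((t + del) * P))%:E * k%:E)%E).
  by apply: lee_wpmul2l => //; rewrite lee_fin mulr_ge0// ltW.
apply: (@lt_le_trans _ _ (c^-1)%:E).
  rewrite -EFinM lte_fin.
  have -> : c^-1 = 2 * ((del + del) * P) * k.
    by rewrite /del; field; rewrite !gt_eqF.
  by rewrite ltr_pM2r// ltr_pM2l// ltr_pM2r// ltrD2r.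
have -> : ((c^-1)%:E = \int[leb]_x (c^-1 * \1_E x)%:E)%E.
  by rewrite integral_indic_real setTI integral_cst_set// E1 mule1.
apply: ge0_le_integral_nomeas => x _; first by rewrite lee_fin mulr_ge0// invr_ge0 ltW.
rewrite lee_fin indicE; have [/set_mem Ex|_] := boolP (x \in E); last by rewrite normr0 !mulr0.
rewrite normr1 !mulr1 ger0_norm ?rmulti_maximal_ge0//.
rewrite -[leLHS]mulr1 ler_pdivrMl// -lee_fin EFinM.
have /= -> := congr1 (fun F => F x) (rmulti_maximalE hn bf).
apply: le_trans (cube_avg_le_multi_maximal hn _ cQ0 (EQ _ Ex)).
have av1 : avg Q0 (EFin \o (\1_Q0 : 'rV[R]_n -> R)) = 1%E.
  rewrite /avg lebQ0 inver oner_eq0 invr1 mul1e.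
  have -> : (\int[leb]_(x in Q0) `|(EFin \o \1_Q0) x| = \int[leb]_(x in Q0) ((1 : R) * \1_Q0 x)%:E)%E.
    by apply: eq_integral => y _; rewrite /= mul1r ger0_norm.
  by rewrite integral_indic_real setIid integral_cst_set// mul1e lebQ0.
by rewrite big1.
Qed.

(** * Sparse families *)

(** The enumeration is fixed before the summand [a], so the same one serves at every point [x] and
    after integration. The predicate [P] marks the indices in use. *)
Lemma countable_esum (R : realType) (T : pointedType) (S : set T) : countable S ->
  exists (e : nat -> T) (P : pred nat), [/\ forall k, P k -> S (e k),
    forall i j, P i -> P j -> e i = e j -> i = j &
    forall a : T -> \bar R, (forall t, S t -> (0 <= a t)%E) ->
      (\esum_(t in S) a t = \sum_(0 <= k <oo) (if P k then a (e k) else 0))%E].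
Proof.
move=> /countable_injP[f finj].
pose e k := xget point [set t | S t /\ f t = k].
pose P k := `[< exists t, S t /\ f t = k >].
have eP k : P k -> S (e k) /\ f (e k) = k by move=> /asboolP/(xgetPex point).
exists e, P; split.
- by move=> k /eP[].
- by move=> i j /eP[_ fi] /eP[_ fj] eij; rewrite -fi -fj eij.
move=> a a0; rewrite -eseries_mkcond nneseries_esum; last by move=> k /eP[/a0].
apply: reindex_esum; split.
- by move=> k /eP[].
- by move=> i j /set_mem/eP[_ fi] /set_mem/eP[_ fj] eij; rewrite -fi -fj eij.
- move=> t St; have Pt : P (f t) by apply/asboolP; exists t.
  by exists (f t) => //; have [Se fe] := eP _ Pt; apply: finj; rewrite ?inE.
Qed.

Lemma op_norm_le (R : realType) (n : nat) (NA NB : ('rV[R]_n -> \bar R) -> \bar R) S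
    (F : 'rV[R]_n -> R) : measurable_fun setT F -> (0 <= NA (EFin \o F))%E ->
  (NA (EFin \o F) < +oo)%E -> (op_norm NA NB S < +oo)%E ->
  (NB (S (EFin \o F)) <= op_norm NA NB S * NA (EFin \o F))%E.
Proof.
move=> mF NA0 NAoo opoo.
have [v v0 vE] : exists2 v : R, 0 <= v & NA (EFin \o F) = v%:E.
  by move: NA0 NAoo; case: (NA _) => // v; rewrite lee_fin; exists v.
have op0 : (0 <= op_norm NA NB S)%E.
  by apply: le_ereal_inf_tmp => _ [c [c0 _] <-]; rewrite lee_fin.
have [w wE] : exists w : R, op_norm NA NB S = w%:E.
  by move: op0 opoo; case: (op_norm _ _ _) => // w; exists w.
rewrite wE vE -EFinM; apply/lee_addgt0Pr => eps eps0.
(* Dividing by [v + 1] instead of [v] allows a norm equal to 0. *)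
have v10 : 0 < v + 1 by rewrite ltr_wpDl.
have : (op_norm NA NB S < (w + eps / (v + 1))%:E)%E.
  by rewrite wE lte_fin ltrDl divr_gt0.
move=> /ereal_inf_lt[_ [c [c0 hc] <-]]; rewrite lte_fin => cw.
apply: (le_trans (hc F mF NAoo)); rewrite vE -EFinM -EFinD lee_fin.
have : c * v <= (w + eps / (v + 1)) * v by rewrite ler_wpM2r// ltW.
move=> /le_trans; apply; rewrite mulrDl lerD2l.
by rewrite -mulrA ler_piMr ?(ltW eps0)// mulrC ler_pdivrMr// mul1r lerDl.
Qed.

Lemma multi_op_norm_le (R : realType) (n m : nat)
    (NAs : 'I_m -> ('rV[R]_n -> \bar R) -> \bar R) (NB : ('rV[R]_n -> \bar R) -> \bar R) S
    (F : 'I_m -> 'rV[R]_n -> R) (w : R) (v : 'I_m -> R) :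
  (forall i, measurable_fun setT (F i)) -> (forall i, (0 <= NAs i (EFin \o F i))%E) ->
  (forall i, (NAs i (EFin \o F i) <= (v i)%:E)%E) -> multi_op_norm NAs NB S = w%:E ->
  (NB (S (fun i => EFin \o F i)) <= (w * \prod_i v i)%:E)%E.
Proof.
move=> mF NA0 NAv wE.
have v0 i : 0 <= v i by rewrite -lee_fin; exact: le_trans (NA0 i) (NAv i).
have V0 : 0 <= \prod_i v i by exact: prodr_ge0.
apply/lee_addgt0Pr => eps eps0; set V := \prod_i v i in V0 *.
have V10 : 0 < V + 1 by rewrite ltr_wpDl.
have : (multi_op_norm NAs NB S < (w + eps / (V + 1))%:E)%E.
  by rewrite wE lte_fin ltrDl divr_gt0.
move=> /ereal_inf_lt[_ [c [c0 hc] <-]]; rewrite lte_fin => cw.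
have NAoo i : (NAs i (EFin \o F i) < +oo)%E by apply: le_lt_trans (NAv i) _; exact: ltry.
apply: (le_trans (hc F mF NAoo)).
apply: (@le_trans _ _ (c * V)%:E).
  rewrite EFinM; apply: lee_wpmul2l; first by rewrite lee_fin.
  by rewrite -prodEFin; apply: lee_prode.
rewrite -EFinD lee_fin.
have : c * V <= (w + eps / (V + 1)) * V by rewrite ler_wpM2r// ltW.
move=> /le_trans; apply; rewrite mulrDl lerD2l.
by rewrite -mulrA ler_piMr ?(ltW eps0)// mulrC ler_pdivrMr// mul1r lerDl.
Qed.

(** * Measurability of the iterated commutator *)

Section Commutator.
Context {R : realType} {n : nat} (l m : nat) (hlm : (l <= m)%N).
Variables (D : 'I_m -> set ('rV[R]_n -> R))
  (T : ('I_m -> 'rV[R]_n -> R) -> 'rV[R]_n -> R) (b : 'I_l -> 'rV[R]_n -> R).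
Hypotheses (hT : multilinear_operator D T) (hD : forall i g, bounded_csupp g -> D i g)
  (mb : forall s, measurable_fun setT (b s))
  (hb : forall s g, bounded_csupp g -> D (widen_ord hlm s) (fun x => b s x * g x)).

(** Each commutator replaces one slot by its product with [b s], which need not be bounded. The
    induction therefore asks boundedness only of the slots still to be treated, and membership in
    the domain of all slots. *)
Lemma measurable_iterated_commutator f : (forall i, bounded_csupp (f i)) ->
  measurable_fun setT (iterated_commutator hlm b T f).
Proof.
move=> bf; rewrite /iterated_commutator.
have : forall i, D i (f i) by move=> i; exact: hD.
have : forall s, s \in enum 'I_l -> bounded_csupp (f (widen_ord hlm s)) by move=> s _.
have := enum_uniq 'I_l; move: {bf} f; elim: (enum 'I_l) => [|t r IH] f /=.
  by move=> _ _ Df; case: hT => _ + _; apply.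
move=> /andP[tr ur] bf Df; apply: measurable_funB.
  apply: (measurable_funM (mb t)); apply: IH => // s sr.
  by apply: bf; rewrite inE sr orbT.
apply: (IH _ ur).
  move=> s sr; rewrite dfwithout; first by apply: bf; rewrite inE sr orbT.
  apply/eqP => /(congr1 val) /= ts; move: tr; rewrite (_ : t = s) ?sr//.
  exact: val_inj.
move=> i; have [<-|ti] := eqVneq (widen_ord hlm t) i; last by rewrite dfwithout.
by rewrite dfwithin; apply: hb; apply: bf; rewrite inE eqxx.
Qed.

End Commutator.

Section SparseFamily.
Context {R : realType} {n : nat} (hn : (0 < n)%N).
Local Notation rV := 'rV[R]_n.
Variables (eta : R) (S : set (set rV)).
Hypotheses (eta01 : 0 < eta < 1) (sS : sparse eta S).

(* For distinct [Q] in [S] these sets are disjoint, and [eta |Q| <= |sparse_major Q|]. *)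
Definition sparse_major (Q : set rV) : set rV :=
  Q `\` \bigcup_(Q' in [set Q' | S Q' /\ Q' `<` Q]) Q'.

Lemma sparse_is_cube Q : S Q -> is_cube Q.
Proof. by have [[D [Dc _ _ _] SD] _] := sS; move=> /SD/Dc. Qed.

Lemma sparse_countable : countable S.
Proof.
have [[D Dl SD] _] := sS.
exact: sub_countable (subset_card_le SD) (dyadic_lattice_countable hn Dl).
Qed.

Lemma measurable_sparse_major Q : S Q -> measurable (sparse_major Q).
Proof.
move=> SQ; apply: measurableD.
  by apply: is_cube_measurable => //; exact: sparse_is_cube.
apply: measurable_countable_family.
  by apply: sub_countable sparse_countable; apply: subset_card_le => Q' [].
by move=> Q' [/sparse_is_cube cQ' _]; exact: is_cube_measurable.
Qed.

Lemma leb_sparse_major Q : S Q -> (eta%:E * leb Q <= leb (sparse_major Q))%E.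
Proof.
move=> SQ; have [_ /(_ Q SQ) h] := sS.
have [v v0 Qv] := is_cube_leb hn (sparse_is_cube SQ).
set U := \bigcup_(_ in _) _ in h.
have : (leb Q <= leb (sparse_major Q) + leb U)%E.
  apply: (@le_trans _ _ (leb (sparse_major Q `|` U))).
    apply: (le_outer_measure lebesgue_outer) => x Qx.
    by have [Ux|nU] := pselect (U x); [right|left].
  exact: (outer_measureU2 lebesgue_outer).
move=> /le_trans/(_ (leeD2l _ h)); rewrite Qv -!EFinM.
have : (0 <= leb (sparse_major Q))%E by exact: measure_ge0.
case: (leb (sparse_major Q)) => [w||]//; rewrite ?leey// -EFinD !lee_fin.
by move=> _; lra.
Qed.

Lemma sparse_major_disjoint Q Q' : S Q -> S Q' ->
  (sparse_major Q `&` sparse_major Q') !=set0 -> Q = Q'.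
Proof.
have [[D Dl SD] _] := sS.
have aux A B x : S A -> A x -> sparse_major B x -> A `<=` B -> A = B.
  move=> SA Ax [_ nU] AB; apply: contrapT => nAB; apply: nU; exists A => //=; split => //.
  by rewrite properEneq; split => //; apply/eqP.
move=> SQ SQ' [x [xQ xQ']].
have QQ' : (Q `&` Q') !=set0 by exists x; split; [case: xQ|case: xQ'].
have [sub|sub] := dyadic_lattice_nested hn Dl (SD _ SQ) (SD _ SQ') QQ'.
  by apply: (aux _ _ x SQ _ xQ' sub); case: xQ.
by apply/esym; apply: (aux _ _ x SQ' _ xQ sub); case: xQ'.
Qed.

Lemma sparse_sum_integral_le (e : nat -> set rV) (P : pred nat) (h : rV -> R) :
  (forall k, P k -> S (e k)) -> (forall i j, P i -> P j -> e i = e j -> i = j) ->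
  measurable_fun setT h -> (forall x, 0 <= h x) ->
  (\sum_(0 <= k <oo) (if P k then \int[leb]_(x in sparse_major (e k)) (h x)%:E else 0) <=
   \int[leb]_x (h x)%:E)%E.
Proof.
move=> eS einj mh h0.
pose E k := if P k then sparse_major (e k) else set0.
have mE k : measurable (E k).
  by rewrite /E; case: ifP => // Pk; apply: measurable_sparse_major; exact: eS.
have tE : trivIset setT E.
  move=> i j _ _ [x []]; rewrite /E; case: ifP => // Pi xi; case: ifP => // Pj xj.
  by apply: einj => //; apply: sparse_major_disjoint; [exact: eS|exact: eS|exists x].
rewrite (@eq_eseriesr _ _ (fun k => \int[leb]_(x in E k) (h x)%:E)%E); last first.
  by move=> k _; rewrite /E; case: ifP => // _; rewrite integral_set0.
have mhU : measurable_fun (\bigcup_k E k) (EFin \o h) by exact: measurable_EFin_restr.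
rewrite -(ge0_integral_bigcup leb mE mhU)//; last by move=> x _; rewrite lee_fin.
by apply: le_integral_subset_EFin => //; exact: bigcupT_measurable.
Qed.

End SparseFamily.

(** * Estimates for a single cube of a sparse family *)

Section SparseTerm.
Context {R : realType} {n : nat} (hn : (0 < n)%N).
Local Notation rV := 'rV[R]_n.

Lemma avg_bounded_fin (Q : set rV) (f : rV -> R) : is_cube Q -> bounded_measurable f ->
  avg Q (EFin \o f) = (fine (avg Q (EFin \o f)))%:E.
Proof.
move=> cQ [_ [C fC]]; rewrite fineK// ge0_fin_numE ?avg_ge0//.
apply: (@le_lt_trans _ _ C%:E); last exact: ltry.
by apply: (avg_le_cst hn cQ) => x _; rewrite /= lee_fin.
Qed.

Lemma avg_norm (Q : set rV) (f : rV -> R) :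
  avg Q (EFin \o (fun x => `|f x|)) = avg Q (EFin \o f).
Proof. by congr (_ * _)%E; apply: eq_integral => x _; rewrite /= normr_id. Qed.

Lemma bounded_measurable_norm (f : rV -> R) :
  bounded_measurable f -> bounded_measurable (fun x => `|f x|).
Proof.
move=> [mf [C fC]]; split; last by exists C => x; rewrite normr_id.
by apply: measurableT_comp mf; exact: normr_measurable.
Qed.

Variables (l m : nat) (hl : (0 < l)%N) (hlm : (l <= m)%N) (b : 'I_l -> rV -> R)
  (f : 'I_m -> rV -> R).
Hypotheses (bBMO : forall s, BMO (b s)) (bf : forall i, bounded_measurable (f i)).

(* [<|(b - <b>_Q) f|>_Q] is at most a constant times [<M f>_Q ||b||_BMO]. *)
Definition majorant (gamma : 'I_l -> bool) (i : 'I_m) : rV -> R :=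
  if [exists s : 'I_l, (widen_ord hlm s == i) && gamma s] then rmaximal (fun x => `|f i x|)
  else f i.

Lemma bounded_measurable_majorant gamma i : bounded_measurable (majorant gamma i).
Proof.
rewrite /majorant; case: ifP => _; last exact: bf.
by apply: (bounded_measurable_rmaximal hn); exact: bounded_measurable_norm.
Qed.

Lemma majorant_widen gamma s : majorant gamma (widen_ord hlm s) =
  if gamma s then rmaximal (fun x => `|f (widen_ord hlm s) x|) else f (widen_ord hlm s).
Proof.
rewrite /majorant; congr (if _ then _ else _); apply/existsP/idP => [[t /andP[/eqP ts gt]]|gs].
  by rewrite (_ : s = t)//; apply: val_inj; move/(congr1 val): ts.
by exists s; rewrite eqxx.
Qed.

Lemma majorant_ge gamma (i : 'I_m) : (l <= i)%N -> majorant gamma i = f i.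
Proof.
move=> li; rewrite /majorant ifF//; apply/negbTE/existsPn => s.
by rewrite negb_and; apply/orP; left; apply/eqP => /(congr1 val)/= si; have := ltn_ord s; lia.
Qed.

(** The part of a sparse term that is constant in [x]; the oscillations with [gamma s] false, which
    depend on [x], form [oscillation_prod]. *)
Definition sparse_coef (gamma : 'I_l -> bool) (Q : set rV) : R :=
  \prod_(s < l | gamma s)
    fine (avg Q (fun y => ((b s y - mean Q (b s)) * f (widen_ord hlm s) y)%:E)) *
  \prod_(s < l | ~~ gamma s) fine (avg Q (EFin \o f (widen_ord hlm s))) *
  \prod_(i < m | (l <= i)%N) fine (avg Q (EFin \o f i)).

Definition oscillation_prod (gamma : 'I_l -> bool) (Q : set rV) (x : rV) : R :=
  \prod_(s < l | ~~ gamma s) `|b s x - mean Q (b s)|.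

Lemma sparse_coef_ge0 gamma Q : 0 <= sparse_coef gamma Q.
Proof. by rewrite !mulr_ge0//; apply: prodr_ge0 => i _; apply: fine_ge0; exact: avg_ge0. Qed.

Lemma oscillation_prod_ge0 gamma Q x : 0 <= oscillation_prod gamma Q x.
Proof. by apply: prodr_ge0. Qed.

Lemma measurable_oscillation_prod gamma Q : measurable_fun setT (oscillation_prod gamma Q).
Proof.
rewrite (_ : oscillation_prod gamma Q = fun x => \prod_(s < l)
    (if gamma s then 1 else `|b s x - mean Q (b s)|)); last first.
  apply/funext => x; rewrite /oscillation_prod big_mkcond; apply: eq_bigr => s _.
  by case: (gamma s).
apply: measurable_prod => s _; case: (gamma s); first exact: measurable_cst.
apply: measurableT_comp; first exact: normr_measurable.
by apply: (measurable_funB (BMO_measurable hn (bBMO s))); exact: measurable_cst.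
Qed.

(** Being at least 1, its powers increase with the exponent, so all [gamma] share the power
    [l.+1]. *)
Definition bmo_const1 : R := Num.max 1 (@bmo_const R n l).

Lemma bmo_const1_ge1 : 1 <= bmo_const1. Proof. by rewrite le_max lexx. Qed.

Section WithBounds.
Variable N : 'I_l -> R.
Hypotheses (N0 : forall s, 0 < N s) (bN : forall s, (bmo_norm (b s) <= (N s)%:E)%E).

(** The estimate [integral_prod_bmo] for one oscillation, [|h|] taking the place of the test
    function [g]. *)
Lemma avg_bmo_mul_le s Q (h : rV -> R) : is_cube Q -> bounded_measurable h ->
  (avg Q (fun y => ((b s y - mean Q (b s)) * h y)%:E) <=
   (bmo_const1 * N s)%:E * avg Q (EFin \o rmaximal (fun x => `|h x|)%R))%E.
Proof.
move=> cQ bh; have bnh := bounded_measurable_norm bh.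
have nh0 x : 0 <= `|h x| by [].
have := integral_prod_bmo hn hl bBMO N0 bN (pred1 s) cQ bnh nh0.
rewrite card1 /= big_pred1_eq => H.
rewrite /avg [leRHS]muleCA; apply: lee_wpmul2l; first by rewrite inve_ge0; exact: measure_ge0.
have -> : (\int[leb]_(x in Q) `|((b s x - mean Q (b s)) * h x)%:E| =
    \int[leb]_(x in Q) ((\prod_(s0 < l | pred1 s s0) `|b s0 x - mean Q (b s0)|) * `|h x|)%:E)%E.
  by apply: eq_integral => x _; rewrite big_pred1_eq /= normrM.
apply: (le_trans H); apply: lee_pmul.
- by rewrite lee_fin mulr_ge0 ?(ltW (N0 s))//; exact: bmo_const_ge0.
- by apply: integral_ge0 => x _; rewrite lee_fin rmaximal_ge0.
- by rewrite lee_fin ler_wpM2r ?(ltW (N0 s))// le_max lexx orbT.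
- by apply: ge0_le_integral_nomeas => x _; rewrite /= ?ger0_norm ?lee_fin ?rmaximal_ge0.
Qed.

Lemma avg_bmo_mul_fin s Q (h : rV -> R) : is_cube Q -> bounded_measurable h ->
  avg Q (fun y => ((b s y - mean Q (b s)) * h y)%:E) =
  (fine (avg Q (fun y => ((b s y - mean Q (b s)) * h y)%:E)))%:E.
Proof.
move=> cQ bh; rewrite fineK// ge0_fin_numE ?avg_ge0//.
apply: (le_lt_trans (avg_bmo_mul_le s cQ bh)).
rewrite (avg_bounded_fin cQ (bounded_measurable_rmaximal hn (bounded_measurable_norm bh))).
by rewrite -EFinM ltry.
Qed.

Lemma sparse_termE gamma Q x : is_cube Q ->
  ((\prod_(s < l) sparse_factor (b s) (f (widen_ord hlm s)) Q (gamma s) x) *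
   (\prod_(i < m | (l <= i)%N) avg Q (EFin \o f i)) * (\1_Q x)%:E =
   (sparse_coef gamma Q * oscillation_prod gamma Q x * \1_Q x)%:E)%E.
Proof.
move=> cQ; rewrite [in RHS]EFinM; congr (_ * _)%E.
rewrite [X in (_ * X)%E](eq_bigr (fun i => (fine (avg Q (EFin \o f i)))%:E)); last first.
  by move=> i _; exact: avg_bounded_fin.
rewrite prodEFin /sparse_coef -mulrA [X in _ * X]mulrC mulrA EFinM; congr (_ * _)%E.
rewrite (bigID gamma)/= -mulrA EFinM; congr (_ * _)%E.
  rewrite -prodEFin; apply: eq_bigr => s ->; exact: avg_bmo_mul_fin.
rewrite /oscillation_prod -big_split/= -prodEFin; apply: eq_bigr => s /negbTE ->.
by rewrite /sparse_factor avg_bounded_fin// muleC.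
Qed.

Lemma sparse_coef_le gamma Q : is_cube Q -> sparse_coef gamma Q <=
  \prod_(s < l | gamma s) (bmo_const1 * N s) *
  \prod_(i < m) fine (avg Q (EFin \o majorant gamma i)).
Proof.
move=> cQ; rewrite [X in _ <= _ * X](bigID (fun i : 'I_m => (i < l)%N))/=.
rewrite [X in _ <= _ * (X * _)]big_ord_narrow mulrA.
rewrite [X in _ <= _ * X](eq_big (fun i : 'I_m => (l <= i)%N)
  (fun i => fine (avg Q (EFin \o f i)))); last 2 first.
- by move=> i; rewrite -leqNgt.
- by move=> i; rewrite -leqNgt => li; rewrite majorant_ge.
rewrite /sparse_coef ler_wpM2r//.
  by apply: prodr_ge0 => i _; apply: fine_ge0; exact: avg_ge0.
rewrite [X in _ <= _ * X](bigID gamma)/= mulrA -big_split/=.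
rewrite [X in _ <= _ * X](eq_bigr (fun s => fine (avg Q (EFin \o f (widen_ord hlm s))))); last first.
  by move=> s /negbTE gs; rewrite majorant_widen gs.
rewrite ler_wpM2r//.
  by apply: prodr_ge0 => i _; apply: fine_ge0; exact: avg_ge0.
apply: ler_prod => s gs; rewrite fine_ge0 ?avg_ge0//= majorant_widen gs.
have bM : bounded_measurable (rmaximal (fun x => `|f (widen_ord hlm s) x|)).
  by apply: (bounded_measurable_rmaximal hn); exact: bounded_measurable_norm.
have := avg_bmo_mul_le s cQ (bf (widen_ord hlm s)).
by rewrite (avg_bmo_mul_fin s cQ (bf _)) (avg_bounded_fin cQ bM) -EFinM lee_fin.
Qed.

Lemma integral_sparse_term_le gamma Q g : is_cube Q -> bounded_measurable g ->
  (forall x, 0 <= g x) ->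
  (\int[leb]_x (sparse_coef gamma Q * oscillation_prod gamma Q x * \1_Q x * g x)%:E <=
   (bmo_const1 ^+ l.+1 * \prod_s N s * \prod_(i < m) fine (avg Q (EFin \o majorant gamma i)))%:E *
   \int[leb]_(x in Q) (iter #|[pred s | ~~ gamma s]| rmaximal g x)%:E)%E.
Proof.
move=> cQ bg g0; have mQ := is_cube_measurable hn cQ.
have alpha0 : 0 <= \prod_(i < m) fine (avg Q (EFin \o majorant gamma i)).
  by apply: prodr_ge0 => i _; apply: fine_ge0; exact: avg_ge0.
have c1 := bmo_const1_ge1; have c0 : 0 <= bmo_const1 by exact: le_trans c1.
have -> : (\int[leb]_x (sparse_coef gamma Q * oscillation_prod gamma Q x * \1_Q x * g x)%:E =
    \int[leb]_x ((sparse_coef gamma Q * (oscillation_prod gamma Q x * g x)) * \1_Q x)%:E)%E.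
  by apply: eq_integral => x _; congr (_%:E); ring.
rewrite integral_indic_real setTI.
have mog : measurable_fun setT (fun x => oscillation_prod gamma Q x * g x).
  by apply: (measurable_funM (measurable_oscillation_prod gamma Q)); case: bg.
have og0 x : 0 <= oscillation_prod gamma Q x * g x by rewrite mulr_ge0// oscillation_prod_ge0.
rewrite (ge0_integralZl_real leb mQ mog og0 (sparse_coef_ge0 gamma Q)).
have := integral_prod_bmo hn hl bBMO N0 bN [pred s | ~~ gamma s] cQ bg g0.
set I := (\int[leb]_(x in Q) (iter _ _ _ _)%:E)%E => H.
have I0 : (0 <= I)%E by apply: integral_ge0 => x _; rewrite lee_fin iter_rmaximal_ge0.
apply: (@le_trans _ _ ((sparse_coef gamma Q)%:E *
  ((bmo_const1 * \prod_(s < l | ~~ gamma s) N s)%:E * I))%E).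
  apply: lee_wpmul2l; first by rewrite lee_fin sparse_coef_ge0.
  apply: (le_trans H); apply: lee_wpmul2r => //.
  rewrite lee_fin ler_wpM2r//; first by apply: prodr_ge0 => s _; exact: ltW.
  by rewrite le_max lexx orbT.
rewrite muleA -EFinM; apply: lee_wpmul2r => //; rewrite lee_fin.
apply: (@le_trans _ _ ((\prod_(s < l | gamma s) (bmo_const1 * N s) *
  \prod_(i < m) fine (avg Q (EFin \o majorant gamma i))) *
  (bmo_const1 * \prod_(s < l | ~~ gamma s) N s))).
  rewrite ler_wpM2r//; last exact: sparse_coef_le.
  by rewrite mulr_ge0//; apply: prodr_ge0 => s _; exact: ltW.
rewrite big_split/= prodr_const [X in _ <= _ * X * _](bigID gamma)/=.
set G := \prod_(i < l | gamma i) N i; set G' := \prod_(s < l | ~~ gamma s) N s.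
set al := \prod_(i < m) _ in alpha0 *.
have -> : bmo_const1 ^+ #|[pred i | gamma i]| * G * al * (bmo_const1 * G') =
    bmo_const1 ^+ #|[pred i | gamma i]|.+1 * (G * G' * al) by rewrite exprS; ring.
have -> : bmo_const1 ^+ l.+1 * (G * G') * al = bmo_const1 ^+ l.+1 * (G * G' * al) by ring.
apply: ler_wpM2r.
  by rewrite !mulr_ge0//; apply: prodr_ge0 => s _; exact: ltW.
(* One factor of the constant for each true [gamma s], and one for the joint estimate of the
   remaining oscillations: at most [l.+1] in all. *)
by apply: ler_weXn2l => //; rewrite ltnS -[X in (_ <= X)%N](card_ord l) max_card.
Qed.

End WithBounds.

(** The left side is a constant times [|Q|], and [|Q|] is at most [eta^-1 * |sparse_major S Q|]. At
    each point of [sparse_major S Q], a subset of [Q], the averages are dominated by the maximal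
    functions, the product with the loss [ball_cube_ratio ^+ m]. *)
Lemma sparse_avg_prod_le (eta : R) (S : set (set rV)) (k : nat) gamma Q g :
  0 < eta < 1 -> sparse eta S -> S Q -> bounded_measurable g -> (forall x, 0 <= g x) ->
  ((\prod_(i < m) fine (avg Q (EFin \o majorant gamma i)))%:E *
   \int[leb]_(x in Q) (iter k rmaximal g x)%:E <=
   (eta^-1)%:E * \int[leb]_(x in sparse_major S Q)
     ((@ball_cube_ratio R n) ^+ m * (rmulti_maximal (majorant gamma) x * iter k.+1 rmaximal g x))%:E)%E.
Proof.
move=> eta01 sS SQ bg g0; have /andP[eta0 eta1] := eta01.
have cQ := sparse_is_cube sS SQ; have mE := measurable_sparse_major hn sS SQ.
have bk := bounded_measurable_iter hn k bg.
set al := \prod_(i < m) _; pose h := iter k rmaximal g.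
have al0 : 0 <= al by apply: prodr_ge0 => i _; apply: fine_ge0; exact: avg_ge0.
have -> : (\int[leb]_(x in Q) (h x)%:E = leb Q * avg Q (EFin \o h))%E.
  rewrite (is_cube_avg hn _ cQ); apply: eq_integral => x _.
  by rewrite /= ger0_norm// iter_rmaximal_ge0.
rewrite (avg_bounded_fin cQ bk); set a := fine _.
have a0 : 0 <= a by apply: fine_ge0; exact: avg_ge0.
rewrite lee_pdivlMl//.
apply: (@le_trans _ _ ((al * a)%:E * (eta%:E * leb Q))%E).
  rewrite le_eqVlt; apply/orP; left; apply/eqP.
  have [v _ ->] := is_cube_leb hn cQ; rewrite -!EFinM; congr (_%:E); ring.
apply: (@le_trans _ _ ((al * a)%:E * leb (sparse_major S Q))%E).
  by apply: lee_wpmul2l; [rewrite lee_fin mulr_ge0|exact: (leb_sparse_major hn sS)].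
rewrite -(integral_cst_set _ mE); apply: ge0_le_integral_nomeas => x [Qx _].
  by rewrite lee_fin mulr_ge0.
rewrite lee_fin mulrA; apply: ler_pM => //; last first.
  by rewrite -lee_fin /a -(avg_bounded_fin cQ bk); exact: avg_le_rmaximal.
have bM i := bounded_measurable_majorant gamma i.
rewrite -lee_fin /al -prodEFin [leRHS]EFinM.
have /= -> := congr1 (fun F => F x) (rmulti_maximalE hn bM).
apply: le_trans (cube_avg_le_multi_maximal hn _ cQ Qx).
apply: lee_prode => i _; first by rewrite lee_fin fine_ge0// avg_ge0.
by rewrite -(avg_bounded_fin cQ (bM i)).
Qed.

End SparseTerm.

Lemma bmo_norm_ge0 (R : realType) (n : nat) (b : 'rV[R]_n -> R) : (0 <= bmo_norm b)%E.
Proof.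
apply: (@le_trans _ _ (avg (cube 0 1) (fun x => (b x - mean (cube 0 1) b)%:E))).
  exact: avg_ge0.
by apply: ereal_sup_ubound; exists (cube 0 1) => //; exists 0, 1.
Qed.

(** * The sparse bound integrated against a test function *)

Section SparseDual.
Context {R : realType} {n : nat} (hn : (0 < n)%N).
Local Notation rV := 'rV[R]_n.
Variables (l m : nat) (hl : (0 < l)%N) (hlm : (l <= m)%N) (b : 'I_l -> rV -> R)
  (f : 'I_m -> rV -> R) (C0 eta : R) (F : rV -> R) (J : nat) (S : 'I_J -> set (set rV)).
Hypotheses (bBMO : forall s, BMO (b s)) (bf : forall i, bounded_measurable (f i))
  (mF : measurable_fun setT F) (sS : forall j, sparse eta (S j))
  (dom : \forall x \ae leb,
      (`|F x|%:E <= C0%:E *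
        \sum_(j < J) \sum_(gamma : {ffun 'I_l -> bool})
          \esum_(Q in S j)
            ((\prod_(s < l)
                sparse_factor (b s) (f (widen_ord hlm s)) Q (gamma s) x) *
             (\prod_(i < m | (l <= i)%N) avg Q (EFin \o f i)) *
             (\1_Q x)%:E))%E).

Lemma BMO_bounds : exists N : 'I_l -> R, (forall s, 0 < N s) /\
  forall s, (bmo_norm (b s) <= (N s)%:E)%E.
Proof.
have bmo0 s := bmo_norm_ge0 (b s).
exists (fun s => fine (bmo_norm (b s)) + 1); split => s.
  by rewrite ltr_wpDl// fine_ge0.
by rewrite EFinD fineK ?leeDl ?lee_fin// ge0_fin_numE//; case: (bBMO s).
Qed.

Lemma sparse_domination_dual : exists (e : 'I_J -> nat -> set rV) (P : 'I_J -> pred nat),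
  [/\ forall j k, P j k -> S j (e j k),
      forall j k k', P j k -> P j k' -> e j k = e j k' -> k = k' &
      forall g, bounded_measurable g -> (forall x, 0 <= g x) ->
      (\int[leb]_x (`|F x| * g x)%:E <=
       `|C0|%:E * \sum_(j < J) \sum_(gamma : {ffun 'I_l -> bool})
         \sum_(0 <= k <oo) (if P j k then
           \int[leb]_x (sparse_coef hlm b f gamma (e j k) * oscillation_prod b gamma (e j k) x *
             \1_(e j k) x * g x)%:E else 0))%E].
Proof.
have [N [N0 bN]] := BMO_bounds.
have /choice[e /choice[P eP]] := fun j => countable_esum R (sparse_countable hn (sS j)).
exists e, P; split; [by move=> j; case: (eP j)|by move=> j; case: (eP j)|].
have eS j k : P j k -> S j (e j k) by case: (eP j) => + _ _; apply.
have ec j k : P j k -> is_cube (e j k) by move=> /eS; exact: (sparse_is_cube (sS j)).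
move=> g bg g0.
pose h j (gamma : {ffun 'I_l -> bool}) k x : R := if P j k then
  sparse_coef hlm b f gamma (e j k) * oscillation_prod b gamma (e j k) x * \1_(e j k) x else 0.
have h0 j gamma k x : 0 <= h j gamma k x.
  rewrite /h; case: ifP => // _; apply: mulr_ge0 => //.
  by apply: mulr_ge0; [exact: sparse_coef_ge0|exact: oscillation_prod_ge0].
have hg0 j gamma k x : 0 <= h j gamma k x * g x by rewrite mulr_ge0.
have mh j gamma k : measurable_fun setT (fun x => h j gamma k x * g x).
  apply: measurable_funM; last by case: bg.
  rewrite /h; case: (boolP (P j k)) => Pjk; last exact: measurable_cst.
  apply: measurable_funM.
    apply: measurable_funM; first exact: measurable_cst.
    exact: measurable_oscillation_prod.
  by apply: measurable_indic; apply: (is_cube_measurable hn); exact: ec.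
have mhE j gamma k : measurable_fun [set: rV] (fun x => (h j gamma k x * g x)%:E).
  exact/measurable_EFinP.
have esumE j (gamma : {ffun 'I_l -> bool}) x : (\esum_(Q in S j)
    ((\prod_(s < l) sparse_factor (b s) (f (widen_ord hlm s)) Q (gamma s) x) *
     (\prod_(i < m | (l <= i)%N) avg Q (EFin \o f i)) * (\1_Q x)%:E) =
    \sum_(0 <= k <oo) (h j gamma k x)%:E)%E.
  have [_ _ ->] := eP j.
    apply: eq_eseriesr => k _; rewrite /h; case: ifP => // Pjk.
    by rewrite (sparse_termE hn hl hlm bBMO bf N0 bN _ _ (ec _ _ Pjk)).
  move=> Q SQ; rewrite (sparse_termE hn hl hlm bBMO bf N0 bN _ _ (sparse_is_cube (sS j) SQ)).
  rewrite lee_fin; apply: mulr_ge0 => //.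
  by apply: mulr_ge0; [exact: sparse_coef_ge0|exact: oscillation_prod_ge0].
pose H x : \bar R := (\sum_(j < J) \sum_(gamma : {ffun 'I_l -> bool})
  \sum_(0 <= k <oo) (h j gamma k x * g x)%:E)%E.
have Hk0 j (gamma : {ffun 'I_l -> bool}) x : (0 <= \sum_(0 <= k <oo) (h j gamma k x * g x)%:E)%E.
  by apply: nneseries_ge0 => k _ _; rewrite lee_fin.
have Hj0 j x : (0 <= \sum_(gamma : {ffun 'I_l -> bool}) \sum_(0 <= k <oo) (h j gamma k x * g x)%:E)%E.
  by apply: sume_ge0.
have H0 x : (0 <= H x)%E by apply: sume_ge0.
have mHk j (gamma : {ffun 'I_l -> bool}) :
    measurable_fun [set: rV] (fun x => \sum_(0 <= k <oo) (h j gamma k x * g x)%:E)%E.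
  by apply: ge0_emeasurable_sum => k => [x _ _|_]; [rewrite lee_fin|exact: mhE].
have mHj j : measurable_fun [set: rV] (fun x => \sum_(gamma : {ffun 'I_l -> bool})
    \sum_(0 <= k <oo) (h j gamma k x * g x)%:E)%E.
  by apply: emeasurable_sum => gamma; exact: mHk.
have mH : measurable_fun [set: rV] H by apply: emeasurable_sum => j; exact: mHj.
apply: (@le_trans _ _ (\int[leb]_x (`|C0|%:E * H x))%E).
  apply: (ae_ge0_le_integral measurableT).
  - by move=> x _; rewrite lee_fin mulr_ge0.
  - apply/measurable_EFinP; apply: measurable_funM; last by case: bg.
    by apply: measurableT_comp mF; exact: normr_measurable.
  - by move=> x _; rewrite mule_ge0.
  - by apply: emeasurable_funM mH; exact: measurable_cst.
  - apply: filterS dom => x domx _.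
    have -> : H x = ((\sum_(j < J) \sum_(gamma : {ffun 'I_l -> bool})
        \sum_(0 <= k <oo) (h j gamma k x)%:E) * (g x)%:E)%E.
      rewrite ge0_sume_distrl; last first.
        by move=> j _; apply: sume_ge0 => gamma _; apply: nneseries_ge0 => k _ _; rewrite lee_fin.
      apply: eq_bigr => j _; rewrite ge0_sume_distrl; last first.
        by move=> gamma _; apply: nneseries_ge0 => k _ _; rewrite lee_fin.
      apply: eq_bigr => gamma _; rewrite muleC -nneseriesZl; last by move=> k _; rewrite lee_fin.
      by apply: eq_eseriesr => k _; rewrite EFinM muleC.
    rewrite muleA EFinM; apply: lee_wpmul2r; first by rewrite lee_fin.
    apply: (le_trans domx).
    under eq_bigr do under eq_bigr do rewrite esumE.
    (* [C0] may be negative; the sum being nonnegative, it can be replaced by its absolute value. *)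
    apply: lee_wpmul2r; last by rewrite lee_fin ler_norm.
    by apply: sume_ge0 => j _; apply: sume_ge0 => gamma _; apply: nneseries_ge0 => k _ _; rewrite lee_fin.
have C00 : (0 <= `|C0|%:E)%E by rewrite lee_fin.
rewrite (ge0_integralZl leb measurableT mH (fun x _ => H0 x) C00).
apply: lee_wpmul2l => //.
rewrite (ge0_integral_sum leb measurableT mHj); last by move=> j x _; exact: Hj0.
apply: lee_sum => j _.
rewrite (ge0_integral_sum leb measurableT (mHk j)); last by move=> gamma x _; exact: Hk0.
apply: lee_sum => gamma _.
rewrite (integral_nneseries leb measurableT (mhE j gamma)); last by move=> k x _; rewrite lee_fin.
apply: lee_nneseries => k _; first by move=> _; apply: integral_ge0 => x _; rewrite lee_fin.
rewrite /h; case: ifP => // _.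
by under eq_integral do rewrite mul0r; rewrite integral0.
Qed.

End SparseDual.

(** * Vanishing BMO or Morrey norms *)

Section Degenerate.
Context {R : realType} {n : nat} (hn : (0 < n)%N).
Local Notation rV := 'rV[R]_n.

(** The pairing asks for a positive Morrey bound, so the zero norm is bounded by arbitrarily small
    ones. The partner is the indicator of a subset of [Q] of full measure whose block norm is
    finite. *)
Lemma morrey_eq0_avg (p : rV -> \bar R) (u : rV -> R -> R) (f : rV -> R) (Q : set rV) :
  regular_exponent p -> (forall x r, 0 < r -> 0 < u x r) -> measurable_fun setT f ->
  morrey_norm (Lvar_norm p) u (EFin \o f) = 0%E -> is_cube Q -> avg Q (EFin \o f) = 0%E.
Proof.
move=> pr u0 mf f0 cQ; have mQ := is_cube_measurable hn cQ.
have [v v0 Qv] := is_cube_leb hn cQ.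
have Qoo : (leb Q < +oo)%E by rewrite Qv ltry.
have [E [K [mE EQ EQl K0 hK]]] := conjugate_test_set hn pr mQ Qoo.
have [c [r [r0 QB _]]] := cube_eball hn cQ.
have mfn : measurable_fun setT (fun x => `|f x|).
  by apply: measurableT_comp mf; exact: normr_measurable.
have bE : (block_norm (Lvar_norm (conjugate_exponent p)) u (EFin \o \1_E) <= (K * u c r)%:E)%E.
  apply: (block_norm_block u0 (measurable_indic_real mE) r0 K0 _ hK).
  by move=> y nB; rewrite indicE memNset// => /EQ/QB.
have b0 : 0 < K * u c r by rewrite mulr_gt0// u0.
have D0 : leb (Q `\` E) = 0%E.
  have -> : (leb (Q `\` E) = leb Q - leb E)%E.
    by rewrite (measureD mQ mE Qoo) (setIidr EQ).
  by rewrite EQl Qv subee.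
have I0 : (\int[leb]_(x in Q) (`|f x|)%:E = 0)%E.
  have mfQ : measurable_fun Q (EFin \o (fun x => `|f x|)) by exact: measurable_EFin_restr.
  have pos x : Q x -> (0 <= (EFin \o (fun x => `|f x|)%R) x)%E by rewrite lee_fin.
  rewrite (ge0_negligible_integral (measurableD mQ mE) mQ mfQ pos D0).
  rewrite setDD (setIidr EQ).
  have -> : (\int[leb]_(x in E) (`|f x|)%:E = \int[leb]_x (`|f x| * `|\1_E x : R|)%:E)%E.
    rewrite -[X in integral _ X _]setTI -integral_indic_real; apply: eq_integral => x _.
    by congr (_%:E); congr (_ * _); rewrite ger0_norm.
  apply/eqP; rewrite eq_le integral_ge0 ?andbT; last by move=> x _; rewrite lee_fin mulr_ge0.
  apply/lee_addgt0Pr => eps eps0; rewrite add0e.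
  have a0 : 0 < eps / (2 * (K * u c r)) by rewrite divr_gt0// mulr_gt0.
  have fa : (morrey_norm (Lvar_norm p) u (EFin \o f) <= (eps / (2 * (K * u c r)))%:E)%E.
    by rewrite f0 lee_fin ltW.
  apply: (le_trans (morrey_block_pairing hn pr u0 mf (measurable_indic_real mE) a0 fa)).
  apply: (@le_trans _ _ ((2 * (eps / (2 * (K * u c r))))%:E * (K * u c r)%:E)%E).
    by apply: lee_wpmul2l => //; rewrite lee_fin mulr_ge0// ltW.
  rewrite -EFinM lee_fin le_eqVlt; apply/orP; left; apply/eqP; field.
  by rewrite !gt_eqF ?u0.
by rewrite /avg I0 mule0.
Qed.

Lemma avg_rmaximal_eq0 (f : rV -> R) (Q : set rV) : bounded_measurable f ->
  (forall Q, is_cube Q -> avg Q (EFin \o f) = 0%E) -> is_cube Q ->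
  avg Q (EFin \o rmaximal (fun x => `|f x|)) = 0%E.
Proof.
move=> bf f0 cQ; have M0 x : rmaximal (fun x => `|f x|) x = 0.
  apply/eqP; rewrite eq_le rmaximal_ge0 andbT -lee_fin.
  have /= -> := congr1 (fun F => F x) (rmaximalE hn (bounded_measurable_norm bf)).
  by apply: ge_ereal_sup => _ [P [cP _] <-]; rewrite avg_norm f0.
rewrite /avg (_ : (\int[leb]_(x in Q) _)%E = 0%E) ?mule0//.
by apply: integral0_eq => x _; rewrite /= M0 normr0.
Qed.

Variables (l m : nat) (hl : (0 < l)%N) (hlm : (l <= m)%N) (b : 'I_l -> rV -> R)
  (f : 'I_m -> rV -> R).
Hypotheses (bBMO : forall s, BMO (b s)) (bf : forall i, bounded_measurable (f i)).

Lemma integral_sparse_term_eq0 gamma Q g :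
  (exists s, bmo_norm (b s) = 0%E) \/
  (exists i, forall P, is_cube P -> avg P (EFin \o f i) = 0%E) ->
  is_cube Q -> bounded_measurable g -> (forall x, 0 <= g x) ->
  (\int[leb]_x (sparse_coef hlm b f gamma Q * oscillation_prod b gamma Q x * \1_Q x * g x)%:E <= 0)%E.
Proof.
move=> H cQ bg g0; have [N [N0 bN]] := BMO_bounds bBMO.
case: H => [[s0 bs0]|[i fi0]]; last first.
  apply: (le_trans (integral_sparse_term_le hn hl hlm bBMO bf N0 bN gamma cQ bg g0)).
  rewrite (_ : \prod_(i < m) _ = 0) ?mulr0 ?mul0e//.
  rewrite (bigD1 i)//= /majorant; case: ifP => _; rewrite ?fi0 ?mul0r//.
  by rewrite avg_rmaximal_eq0 ?mul0r.
set I := (\int[leb]_x _)%E.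
pose k := #|[pred s | ~~ gamma s]|.
have bk := bounded_measurable_iter hn k bg.
pose A := \prod_(i < m) fine (avg Q (EFin \o majorant hlm f gamma i)).
have A0 : 0 <= A by apply: prodr_ge0 => i _; apply: fine_ge0; exact: avg_ge0.
have [z [z0 zE]] : exists z : R, 0 <= z /\ (\int[leb]_(x in Q) (iter k rmaximal g x)%:E = z%:E)%E.
  have [v v0 Qv] := is_cube_leb hn cQ.
  exists (v * fine (avg Q (EFin \o iter k rmaximal g))); split.
    by rewrite mulr_ge0 ?(ltW v0)// fine_ge0// avg_ge0.
  rewrite EFinM -(avg_bounded_fin hn cQ bk) -Qv (is_cube_avg hn _ cQ).
  by apply: eq_integral => x _; rewrite /= ger0_norm// iter_rmaximal_ge0.
pose N' := \prod_(s < l | s != s0) N s.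
have N'0 : 0 <= N' by apply: prodr_ge0 => s _; exact: ltW.
pose c := (@bmo_const1 R n l) ^+ l.+1 * N' * A * z.
have c1 := @bmo_const1_ge1 R n l.
have c0 : 0 <= c by rewrite !mulr_ge0// exprn_ge0// (le_trans ler01).
have c10 : 0 < c + 1 by rewrite ltr_wpDl.
apply/lee_addgt0Pr => eps eps0; rewrite add0e.
(* Any positive number bounds a zero BMO norm. This one makes the whole estimate at most [eps], and
   [c + 1] avoids a division by 0. *)
pose Ne s := if s == s0 then eps / (c + 1) else N s.
have Ne0 s : 0 < Ne s by rewrite /Ne; case: ifP => // _; rewrite divr_gt0.
have bNe s : (bmo_norm (b s) <= (Ne s)%:E)%E.
  by rewrite /Ne; case: eqP => [->|_]; [rewrite bs0 lee_fin divr_ge0 ?ltW|exact: bN].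
apply: (le_trans (integral_sparse_term_le hn hl hlm bBMO bf Ne0 bNe gamma cQ bg g0)).
rewrite -/k zE -EFinM lee_fin -/A (bigD1 s0)//= [X in _ * (_ * X)](_ : _ = N'); last first.
  by apply: eq_bigr => s /negbTE ss0; rewrite /Ne ss0.
rewrite /Ne eqxx.
have -> : (@bmo_const1 R n l) ^+ l.+1 * (eps / (c + 1) * N') * A * z = c * (eps / (c + 1)).
  by rewrite /c; ring.
by rewrite mulrCA ler_piMr ?(ltW eps0)// ler_pdivrMr// mul1r lerDl.
Qed.

End Degenerate.

(** * Summation over a sparse family and use of the operator norms *)

Section Assembly.
Context {R : realType} {n : nat} (hn : (0 < n)%N).
Local Notation rV := 'rV[R]_n.
Variables (l m : nat) (hl : (0 < l)%N) (hlm : (l <= m)%N) (f : 'I_m -> rV -> R).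
Hypothesis bf : forall i, bounded_measurable (f i).

Lemma measurable_iter_rmaximal k (g : rV -> R) : bounded_measurable g ->
  measurable_fun setT (iter k rmaximal g).
Proof. by move=> bg; case: (bounded_measurable_iter hn k bg). Qed.

Lemma sparse_sum_le (b : 'I_l -> rV -> R) (N : 'I_l -> R) (eta : R) (S : set (set rV))
    (e : nat -> set rV) (P : pred nat) (gamma : {ffun 'I_l -> bool}) g :
  (forall s, BMO (b s)) -> (forall s, 0 < N s) ->
  (forall s, (bmo_norm (b s) <= (N s)%:E)%E) -> 0 < eta < 1 -> sparse eta S ->
  (forall k, P k -> S (e k)) -> (forall i j, P i -> P j -> e i = e j -> i = j) ->
  bounded_measurable g -> (forall x, 0 <= g x) ->
  (\sum_(0 <= k <oo) (if P k then
     \int[leb]_x (sparse_coef hlm b f gamma (e k) * oscillation_prod b gamma (e k) x *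
       \1_(e k) x * g x)%:E else 0) <=
   (@bmo_const1 R n l ^+ l.+1 * \prod_s N s * (eta^-1 * @ball_cube_ratio R n ^+ m))%:E *
   \int[leb]_x (`|rmulti_maximal (majorant hlm f gamma) x| *
     `|iter #|[pred s | ~~ gamma s]|.+1 rmaximal g x|)%:E)%E.
Proof.
move=> bBMO N0 bN eta01 sS eS einj bg g0.
set K := #|_|; pose A := @bmo_const1 R n l ^+ l.+1 * \prod_s N s.
pose h x := rmulti_maximal (majorant hlm f gamma) x * iter K.+1 rmaximal g x.
have c1 := @bmo_const1_ge1 R n l.
have A0 : 0 <= A.
  apply: mulr_ge0; first by rewrite exprn_ge0// (le_trans ler01).
  by apply: prodr_ge0 => s _; exact: ltW.
have etaV : 0 <= eta^-1 by case/andP: eta01 => e0 _; rewrite invr_ge0 ltW.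
have rm0 : 0 <= @ball_cube_ratio R n ^+ m by rewrite exprn_ge0// ltW// ball_cube_ratio_gt0.
have h0 x : 0 <= h x by rewrite mulr_ge0 ?rmulti_maximal_ge0 ?rmaximal_ge0.
have mh : measurable_fun setT h.
  apply: measurable_funM; last exact: measurable_iter_rmaximal.
  by apply: (measurable_rmulti_maximal hn) => i; exact: bounded_measurable_majorant.
have rh0 x : 0 <= @ball_cube_ratio R n ^+ m * h x by exact: mulr_ge0.
have mrh : measurable_fun setT (fun x => @ball_cube_ratio R n ^+ m * h x).
  by apply: measurable_funM mh; exact: measurable_cst.
apply: (@le_trans _ _ (\sum_(0 <= k <oo) ((A * eta^-1)%:E * (if P k then
  \int[leb]_(x in sparse_major S (e k)) (@ball_cube_ratio R n ^+ m * h x)%:E else 0)))%E).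
  apply: lee_nneseries => k _.
    move=> _; case: ifP => // _; apply: integral_ge0 => x _; rewrite lee_fin.
    apply: mulr_ge0 => //; apply: mulr_ge0 => //.
    by apply: mulr_ge0; [exact: sparse_coef_ge0|exact: oscillation_prod_ge0].
  case: ifP => Pk; last by rewrite mule0.
  have cQ := sparse_is_cube sS (eS _ Pk).
  apply: (le_trans (integral_sparse_term_le hn hl hlm bBMO bf N0 bN gamma cQ bg g0)).
  rewrite -/A -/K EFinM -muleA [leRHS](_ : _ = A%:E * (eta^-1%:E *
    \int[leb]_(x in sparse_major S (e k)) (@ball_cube_ratio R n ^+ m * h x)%:E))%E; last first.
    by rewrite EFinM muleA.
  by apply: lee_wpmul2l => //; exact: (sparse_avg_prod_le hn hlm bf K gamma eta01 sS (eS _ Pk) bg g0).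
rewrite nneseriesZl; last first.
  by move=> k _; case: ifP => // _; apply: integral_ge0 => x _; rewrite lee_fin.
have -> : (\int[leb]_x (`|rmulti_maximal (majorant hlm f gamma) x| *
    `|iter K.+1 rmaximal g x|)%:E = \int[leb]_x (h x)%:E)%E.
  by apply: eq_integral => x _; rewrite !ger0_norm ?rmulti_maximal_ge0 ?rmaximal_ge0.
rewrite -/A mulrA [X in (_ <= X * _)%E]EFinM -muleA.
apply: lee_wpmul2l; first by rewrite lee_fin mulr_ge0.
rewrite -(ge0_integralZl_real leb measurableT mh h0 rm0).
exact: (sparse_sum_integral_le hn sS eS einj mrh rh0).
Qed.

Variables (p : rV -> \bar R) (ps : 'I_m -> rV -> \bar R) (u : rV -> R -> R)
  (us : 'I_m -> rV -> R -> R) (w v : R) (w_ a_ : 'I_m -> R).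
Local Notation NX := (block_norm (Lvar_norm (conjugate_exponent p)) u).
Local Notation M := (morrey_norm (Lvar_norm p) u).
Local Notation M_ i := (morrey_norm (Lvar_norm (ps i)) (us i)).
Hypotheses (pr : regular_exponent p) (psr : forall i, regular_exponent (ps i))
  (u0 : forall x r, 0 < r -> 0 < u x r) (us0 : forall i x r, 0 < r -> 0 < us i x r)
  (w1 : 1 <= w) (v0 : 0 < v) (w_1 : forall i, 1 <= w_ i) (a0 : forall i, 0 < a_ i)
  (wE : op_norm NX NX maximal = w%:E)
  (vE : multi_op_norm (fun i => M_ i) M (@multi_maximal R n m) = v%:E)
  (w_E : forall i, op_norm (M_ i) (M_ i) maximal = (w_ i)%:E)
  (aE : forall i, M_ i (EFin \o f i) = (a_ i)%:E).

Lemma block_norm_iter_le k (g : rV -> R) (d : R) : bounded_measurable g ->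
  (NX (EFin \o g) <= d%:E)%E -> (NX (EFin \o iter k rmaximal g) <= (w ^+ k * d)%:E)%E.
Proof.
move=> bg gd; elim: k => [|k IH]; first by rewrite expr0 mul1r.
rewrite iterS (rmaximalE hn (bounded_measurable_iter hn k bg)).
have NXoo : (NX (EFin \o iter k rmaximal g) < +oo)%E by apply: le_lt_trans IH (ltry _).
have opoo : (op_norm NX NX maximal < +oo)%E by rewrite wE ltry.
apply: (le_trans (op_norm_le (measurable_iter_rmaximal k bg) (block_norm_ge0 _ _ _) NXoo opoo)).
rewrite wE exprS -mulrA [leRHS]EFinM; apply: lee_wpmul2l => //.
by rewrite lee_fin (le_trans ler01).
Qed.

(** Since [w_ i >= 1], the same bound covers the slots where a maximal function appears and those
    left unchanged. *)
Lemma morrey_norm_majorant_le gamma i :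
  (M_ i (EFin \o majorant hlm f gamma i) <= (w_ i * a_ i)%:E)%E.
Proof.
have w0 : 0 <= w_ i by rewrite (le_trans ler01).
rewrite /majorant; case: ifP => _; last first.
  by rewrite aE lee_fin ler_peMl// ltW.
have p0 x : (0 <= ps i x)%E by have [_ + _] := psr i => /(_ x); exact: le_trans.
have fa : (M_ i (EFin \o (fun x => `|f i x|)%R) <= (a_ i)%:E)%E.
  by rewrite -aE; apply: (le_morrey_norm p0 (@us0 i)) => x; rewrite normr_id.
have foo : (M_ i (EFin \o (fun x => `|f i x|)%R) < +oo)%E by apply: le_lt_trans fa (ltry _).
have opoo : (op_norm (M_ i) (M_ i) maximal < +oo)%E by rewrite w_E ltry.
have bn := bounded_measurable_norm (bf i); have [mn _] := bn.
rewrite (rmaximalE hn bn).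
apply: (le_trans (op_norm_le mn (morrey_norm_ge0 _ _ (@us0 i)) foo opoo)).
by rewrite w_E EFinM; apply: lee_wpmul2l.
Qed.

Lemma integral_maximal_product_le gamma k (g : rV -> R) (d : R) : (k <= l)%N -> 0 <= d ->
  bounded_measurable g -> (NX (EFin \o g) <= d%:E)%E ->
  (\int[leb]_x (`|rmulti_maximal (majorant hlm f gamma) x| * `|iter k.+1 rmaximal g x|)%:E <=
   (2 * (v * \prod_i (w_ i * a_ i)) * (w ^+ (2 + l) * d))%:E)%E.
Proof.
move=> kl d0 bg gd; have bM i := bounded_measurable_majorant hn hlm bf gamma i.
have wa0 : 0 < \prod_i (w_ i * a_ i).
  by apply: prodr_gt0 => i _; rewrite mulr_gt0// (lt_le_trans ltr01).
have mle : (M (EFin \o rmulti_maximal (majorant hlm f gamma)) <=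
    (v * \prod_i (w_ i * a_ i))%:E)%E.
  rewrite (rmulti_maximalE hn bM).
  apply: (multi_op_norm_le (F := majorant hlm f gamma) _ _ _ vE).
  - by move=> i; case: (bM i).
  - by move=> i; exact: (morrey_norm_ge0 _ _ (@us0 i)).
  - by move=> i; exact: morrey_norm_majorant_le.
have va0 : 0 < v * \prod_i (w_ i * a_ i) by rewrite mulr_gt0.
apply: (le_trans (morrey_block_pairing hn pr u0 (measurable_rmulti_maximal hn bM)
  (measurable_iter_rmaximal k.+1 bg) va0 mle)).
rewrite [leRHS]EFinM; apply: lee_wpmul2l; first by rewrite lee_fin mulr_ge0// ltW.
apply: (le_trans (block_norm_iter_le k.+1 bg gd)); rewrite lee_fin ler_wpM2r//.
(* Here [k.+1 <= 2 + l], and [1 <= w] makes its powers nondecreasing. *)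
by apply: ler_weXn2l => //; rewrite add2n ltnS leqW.
Qed.

End Assembly.

(** * Exponent bounds, finiteness of factors and duality for the Morrey norm *)

Lemma Plog_regular_exponent (R : realType) (n : nat) (p : 'rV[R]_n -> \bar R) :
  Plog p -> (1 < p_minus p)%E -> (p_plus p < +oo)%E -> regular_exponent p.
Proof.
move=> [[mp p1] _] pm pp; split => //.
exists (fine (p_plus p)); near=> x.
have pmx : (p_minus p <= p x)%E by near: x; exact: ess_inf_le.
have ppx : (p x <= p_plus p)%E by near: x; exact: ess_sup_ge.
split; first exact: lt_le_trans pm pmx.
by rewrite fineK// ge0_fin_numE//; apply: le_trans ppx; exact: le_trans (p1 x).
Unshelve. all: by end_near. Qed.

Lemma mule_gt0_lty (R : realDomainType) (x y : \bar R) : (0 < x -> 0 < y -> x * y < +oo ->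
  x < +oo /\ y < +oo)%E.
Proof.
case: x y => [x||] [y||]//; rewrite ?lte_fin => x0 y0; rewrite ?ltry//.
- by rewrite gt0_muley ?lte_fin// ltxx.
- by rewrite gt0_mulye ?lte_fin// ltxx.
Qed.

Lemma prode_gt0 (R : realDomainType) (I : Type) (r : seq I) (P : pred I) (x : I -> \bar R) :
  (forall i, P i -> 0 < x i)%E -> (0 < \prod_(i <- r | P i) x i)%E.
Proof.
move=> x0; elim/big_ind: _ => [|y z|//]; first by rewrite lte_fin.
by move=> y0 z0; exact: mule_gt0.
Qed.

Lemma prode_gt0_lty (R : realDomainType) (m : nat) (x : 'I_m -> \bar R) : (forall i, 0 < x i)%E ->
  (\prod_(i < m) x i < +oo)%E -> forall i, (x i < +oo)%E.
Proof.
move=> x0 + i; rewrite (bigD1 i)//= => h.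
by have [] := mule_gt0_lty (x0 i) (prode_gt0 _ (fun j _ => x0 j)) h.
Qed.

Lemma expe_gt0 (R : realDomainType) (x : \bar R) k : (0 < x -> 0 < x ^+ k)%E.
Proof.
move=> x0; elim: k => [|k IH]; first by rewrite expe0 lte_fin.
by rewrite expeS mule_gt0.
Qed.

Lemma bounded_csupp_bounded_measurable (R : realType) (n : nat) (f : 'rV[R]_n -> R) :
  bounded_csupp f -> bounded_measurable f.
Proof. by case. Qed.

Lemma leb_eball_lty (R : realType) (n : nat) (hn : (0 < n)%N) (x : 'rV[R]_n) (r : R) : 0 < r ->
  (leb (eball x r) < +oo)%E.
Proof.
move=> r0; apply: (@le_lt_trans _ _ (leb (cube (x - const_mx r) (2 * r)))).
  by apply: (le_outer_measure lebesgue_outer); exact: eball_subset_cube.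
by rewrite (leb_cube hn) ?ltry// mulr_ge0// ltW.
Qed.

Section MorreyDual.
Context {R : realType} {n : nat} (hn : (0 < n)%N) (p : 'rV[R]_n -> \bar R)
  (u : 'rV[R]_n -> R -> R) (pr : regular_exponent p) (u0 : forall x r, 0 < r -> 0 < u x r).
Local Notation rV := 'rV[R]_n.

(** [d] stands for the weight of the ball in which [g] lives. A norm at most 1 is an infimum and
    only yields some [k < 2] for which [g / k] has modular at most 1, whence the factor 2. *)
Lemma morrey_norm_dual (F : rV -> R) (a : R) : measurable_fun setT F -> 0 <= a ->
  (forall (g : rV -> R) (d : R), bounded_measurable g -> (forall x, 0 <= g x) -> 0 <= d ->
     (block_norm (Lvar_norm (conjugate_exponent p)) u (EFin \o g) <= (2 * d)%:E)%E ->
     (\int[leb]_x (`|F x| * g x)%:E <= (a * d)%:E)%E) ->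
  (morrey_norm (Lvar_norm p) u (EFin \o F) <= a%:E)%E.
Proof.
move=> mF a0 Fg; apply: ge_ereal_sup => _ [x [r [r0 ->]]].
have ur := u0 x r0.
rewrite lee_pdivrMl// -EFinM Lvar_norm_indicE.
apply: (Lvar_norm_dual hn pr mF (measurable_eball hn x r) (leb_eball_lty hn x r0)).
  by rewrite mulr_ge0// ltW.
move=> g bg g0 gB g1; rewrite mulrC; apply: (Fg _ _ bg g0 (ltW ur)).
have [|k [k0 k2 gk]] := @Lvar_norm_lt R n (conjugate_exponent p) g 2.
  by apply: le_lt_trans g1 _; rewrite lte_fin ltr1n.
have [mg _] := bg.
apply: (le_trans (block_norm_block u0 mg r0 k0 gB gk)).
by rewrite lee_fin ler_wpM2r// ltW.
Qed.

End MorreyDual.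

Theorem theorem6p6 (R : realType) (n l m : nat) (hn : (0 < n)%N)
    (hl : (1 <= l)%N) (hlm : (l <= m)%N)
    (p : 'rV[R]_n -> \bar R) (ps : 'I_m -> 'rV[R]_n -> \bar R)
    (u : 'rV[R]_n -> R -> R) (us : 'I_m -> 'rV[R]_n -> R -> R)
    (hpps : forall x, ((p x)^-1 = \sum_(i < m) (ps i x)^-1)%E)
    (hps : forall i, Plog (ps i))
    (hps_bd : forall i, [/\ (1 < p_minus (ps i))%E,
                            (p_minus (ps i) <= p_plus (ps i))%E &
                            (p_plus (ps i) < +oo)%E])
    (huus : forall x r, 0 < r -> u x r = \prod_(i < m) us i x r)
    (hus : forall i, W0 (Lvar_norm (ps i)) (us i))
    (hp : Plog p)
    (hp_bd : [/\ (1 < p_minus p)%E, (p_minus p <= p_plus p)%E &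
                 (p_plus p < +oo)%E])
    (hu : W0 (Lvar_norm p) u)
    (D : 'I_m -> set ('rV[R]_n -> R))
    (T : ('I_m -> 'rV[R]_n -> R) -> 'rV[R]_n -> R)
    (hT : multilinear_operator D T)
    (hD : forall i g, bounded_csupp g -> D i g)
    (C0 eta : R) (heta : 0 < eta < 1) :
  exists C : R, 0 < C /\
    forall b : 'I_l -> 'rV[R]_n -> R,
      (forall s, BMO (b s)) ->
      (forall s g, bounded_csupp g ->
         D (widen_ord hlm s) (fun x => b s x * g x)) ->
      sparse_domination hlm C0 eta b (iterated_commutator hlm b T) ->
    forall f : 'I_m -> 'rV[R]_n -> R,
      (forall i, bounded_csupp (f i)) ->
      (morrey_norm (Lvar_norm p) u (EFin \o iterated_commutator hlm b T f) <=
       C%:E *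
       (\prod_(s < l) bmo_norm (b s)) *
       op_norm (block_norm (Lvar_norm (conjugate_exponent p)) u)
               (block_norm (Lvar_norm (conjugate_exponent p)) u)
               maximal ^+ (2 + l) *
       multi_op_norm (fun i => morrey_norm (Lvar_norm (ps i)) (us i))
                     (morrey_norm (Lvar_norm p) u)
                     (@multi_maximal R n m) *
       \prod_(i < m)
         (op_norm (morrey_norm (Lvar_norm (ps i)) (us i))
                  (morrey_norm (Lvar_norm (ps i)) (us i)) maximal *
          morrey_norm (Lvar_norm (ps i)) (us i) (EFin \o f i)))%E.
Proof.
have pr : regular_exponent p by case: hp_bd => pm _ pp; exact: Plog_regular_exponent.
have psr i : regular_exponent (ps i).
  by case: (hps_bd i) => pm _ pp; exact: Plog_regular_exponent.
have [[u0 _] _] := hu.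
have us0 i : forall x r, 0 < r -> 0 < us i x r by case: (hus i) => [[]].
pose c2 := @bmo_const1 R n l ^+ l.+1 * (eta^-1 * @ball_cube_ratio R n ^+ m).
(* The counts of sparse families and of the [gamma]; in the 4, one factor 2 is from the pairing and
   one from the bound [2 * d] in [morrey_norm_dual]. The final [+ 1] makes [C] positive. *)
pose C := `|C0| * ((3 ^ n)%N%:R * (#|{ffun 'I_l -> bool}|%:R * (4 * c2))) + 1.
have c20 : 0 <= c2.
  have [eta0 _] := andP heta.
  apply: mulr_ge0; first by rewrite exprn_ge0// (le_trans ler01)// bmo_const1_ge1.
  by rewrite mulr_ge0 ?invr_ge0 ?(ltW eta0)// exprn_ge0// ltW// ball_cube_ratio_gt0.
have C_gt0 : 0 < C.
  apply: ltr_wpDl => //; apply: mulr_ge0 => //; apply: mulr_ge0 => //.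
  by apply: mulr_ge0 => //; exact: mulr_ge0.
exists C; split => // b bBMO hb dom f bcf.
have bf i := bounded_csupp_bounded_measurable (bcf i).
have mF := measurable_iterated_commutator hT hD (fun s => BMO_measurable hn (bBMO s)) hb bcf.
have [S [sS domS]] := dom f bcf.
have [e [P [eS einj dual]]] := sparse_domination_dual hn hl bBMO bf mF sS domS.
set F := iterated_commutator hlm b T f in mF domS dual *.
have opB := op_norm_block_ge1 hn pr hu.
have opM i := op_norm_morrey_ge1 hn (psr i) (hus i).
have multiM := multi_op_norm_gt0 hn pr hu psr hus.
have opB0 := lt_le_trans lte01 opB.
have opM0 i := lt_le_trans lte01 (opM i).
have Mf0 i := morrey_norm_ge0 (ps i) (EFin \o f i) (us0 i).
(* In the degenerate case the right-hand side may be a product of 0 and [+oo], that is 0, so the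
   left side has to be shown to vanish. *)
have [deg|nondeg] := pselect ((exists s, bmo_norm (b s) = 0%E) \/
  exists i, morrey_norm (Lvar_norm (ps i)) (us i) (EFin \o f i) = 0%E).
  apply: (@le_trans _ _ 0%E); last first.
    apply: mule_ge0; last by apply: prode_ge0 => i _; rewrite mule_ge0// ltW.
    apply: mule_ge0; last exact: ltW.
    apply: mule_ge0; last by apply: ltW; exact: expe_gt0.
    apply: mule_ge0; first by rewrite lee_fin ltW.
    by apply: prode_ge0 => s _; exact: bmo_norm_ge0.
  apply: (morrey_norm_dual hn pr u0 mF (lexx 0)) => g d bg g0 d0 _; rewrite mul0r.
  apply: (le_trans (dual g bg g0)).
  rewrite big1 ?mule0// => j _; rewrite big1// => gamma _; rewrite eseries0// => k _ _.
  case: ifP => // Pk; apply/eqP; rewrite eq_le; apply/andP; split.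
    apply: (integral_sparse_term_eq0 hn hl hlm bBMO bf) => //.
    - case: deg => [[s bs0]|[i fi0]]; [by left; exists s|right; exists i => Q cQ].
      by have [mfi _] := bf i; exact: (morrey_eq0_avg hn (psr i) (us0 i) mfi fi0 cQ).
    - exact: (sparse_is_cube (sS j) (eS _ _ Pk)).
  apply: integral_ge0 => x _; rewrite lee_fin; apply: mulr_ge0 => //; apply: mulr_ge0 => //.
  by apply: mulr_ge0; [exact: sparse_coef_ge0|exact: oscillation_prod_ge0].
have bmo0 s : (0 < bmo_norm (b s))%E.
  rewrite lt_neqAle bmo_norm_ge0 andbT eq_sym; apply/eqP => bs0.
  by apply: nondeg; left; exists s.
have Mf_gt0 i : (0 < morrey_norm (Lvar_norm (ps i)) (us i) (EFin \o f i))%E.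
  rewrite lt_neqAle Mf0 andbT eq_sym; apply/eqP => fi0.
  by apply: nondeg; right; exists i.
pose N s := fine (bmo_norm (b s)).
have NE s : bmo_norm (b s) = (N s)%:E.
  by rewrite fineK// ge0_fin_numE ?bmo_norm_ge0//; case: (bBMO s).
have N0 s : 0 < N s by rewrite -lte_fin -NE.
have bN s : (bmo_norm (b s) <= (N s)%:E)%E by rewrite NE.
set RHS := (X in (_ <= X)%E).
(* All factors being positive from here on, a finite product makes each of them finite; they are
   peeled off one by one and replaced by reals. *)
have [|fin] := leP +oo%E RHS; first by rewrite leye_eq => /eqP ->; rewrite leey.
have opMf0 i : (0 < op_norm (morrey_norm (Lvar_norm (ps i)) (us i))
    (morrey_norm (Lvar_norm (ps i)) (us i)) maximal *
    morrey_norm (Lvar_norm (ps i)) (us i) (EFin \o f i))%E by exact: mule_gt0.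
have CN0 : (0 < C%:E * \prod_(s < l) bmo_norm (b s))%E.
  by apply: mule_gt0; [rewrite lte_fin|exact: prode_gt0].
have CNw0 := mule_gt0 CN0 (expe_gt0 (2 + l) opB0).
have [fin1 /(prode_gt0_lty opMf0) fin2] :=
  mule_gt0_lty (mule_gt0 CNw0 multiM) (prode_gt0 _ (fun i _ => opMf0 i)) fin.
have [fin3 multi_lty] := mule_gt0_lty CNw0 multiM fin1.
have [_] := mule_gt0_lty CN0 (expe_gt0 (2 + l) opB0) fin3.
rewrite (expeS _ (1 + l)) => fin4.
have [opB_lty _] := mule_gt0_lty opB0 (expe_gt0 (1 + l) opB0) fin4.
have opMf_lty i := mule_gt0_lty (opM0 i) (Mf_gt0 i) (fin2 i).
have pos_fineK (x : \bar R) : (0 < x)%E -> (x < +oo)%E -> x = (fine x)%:E.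
  by move=> x0 xoo; rewrite fineK// ge0_fin_numE// ltW.
have wE := pos_fineK _ opB0 opB_lty; have vE := pos_fineK _ multiM multi_lty.
have w_E i := pos_fineK _ (opM0 i) (opMf_lty i).1.
have aE i := pos_fineK _ (Mf_gt0 i) (opMf_lty i).2.
rewrite /RHS (eq_bigr _ (fun s _ => NE s)) prodEFin wE vE.
under [X in (_ * X)%E]eq_bigr => i _ do rewrite w_E aE -EFinM.
rewrite prodEFin -EFin_expe -!EFinM.
set w := fine _ in wE *; set v := fine _ in vE *.
pose w_ i := fine (op_norm (morrey_norm (Lvar_norm (ps i)) (us i))
    (morrey_norm (Lvar_norm (ps i)) (us i)) maximal).
pose a_ i := fine (morrey_norm (Lvar_norm (ps i)) (us i) (EFin \o f i)).
have w1 : 1 <= w by rewrite -lee_fin -wE.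
have v0 : 0 < v by rewrite -lte_fin -vE.
have w_1 i : 1 <= w_ i by rewrite -lee_fin -w_E.
have a0 i : 0 < a_ i by rewrite -lte_fin -aE.
set PN := \prod_s N s; set Pwa := \prod_i _.
have PN0 : 0 <= PN by apply: prodr_ge0 => s _; exact: ltW.
have Pwa0 : 0 <= Pwa.
  apply: prodr_ge0 => i _; apply: mulr_ge0; last exact: ltW (a0 i).
  exact: le_trans ler01 (w_1 i).
have Z0 : 0 <= PN * w ^+ (2 + l) * v * Pwa.
  apply: mulr_ge0 => //; apply: mulr_ge0; last exact: ltW.
  by apply: mulr_ge0 => //; apply: exprn_ge0; exact: le_trans w1.
apply: (morrey_norm_dual hn pr u0 mF) => [|g d bg g0 d0 gd].
  have -> : C * PN * w ^+ (2 + l) * v * Pwa = C * (PN * w ^+ (2 + l) * v * Pwa) by ring.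
  by rewrite mulr_ge0// ltW.
apply: (le_trans (dual g bg g0)).
pose B := @bmo_const1 R n l ^+ l.+1 * PN * (eta^-1 * @ball_cube_ratio R n ^+ m) *
  (2 * (v * Pwa) * (w ^+ (2 + l) * (2 * d))).
apply: (@le_trans _ _ (`|C0|%:E * \sum_(j < 3 ^ n) \sum_(gamma : {ffun 'I_l -> bool}) B%:E)%E).
  apply: lee_wpmul2l; first by rewrite lee_fin.
  apply: lee_sum => j _; apply: lee_sum => gamma _.
  apply: (le_trans (sparse_sum_le hn hl hlm bf gamma bBMO N0 bN heta (sS j) (eS j) (einj j) bg g0)).
  rewrite /B [leRHS]EFinM; apply: lee_wpmul2l.
    rewrite lee_fin; have -> : @bmo_const1 R n l ^+ l.+1 * PN *
      (eta^-1 * @ball_cube_ratio R n ^+ m) = PN * c2 by rewrite /c2; ring.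
    exact: mulr_ge0.
  apply: (integral_maximal_product_le hn hlm bf pr psr u0 us0 w1 v0 w_1 a0 wE vE w_E aE) => //.
    by rewrite -[X in (_ <= X)%N](card_ord l) max_card.
  by rewrite mulr_ge0.
under eq_bigr do rewrite sumEFin.
rewrite sumEFin !sumr_const card_ord -EFinM lee_fin -[_ *+ (3 ^ n)]mulr_natl -[B *+ _]mulr_natl.
have -> : `|C0| * ((3 ^ n)%N%:R * (#|{ffun 'I_l -> bool}|%:R * B)) =
    (C - 1) * (PN * w ^+ (2 + l) * v * Pwa * d) by rewrite /B /C /c2; ring.
have -> : C * PN * w ^+ (2 + l) * v * Pwa * d = C * (PN * w ^+ (2 + l) * v * Pwa * d) by ring.
by apply: ler_wpM2r; [exact: mulr_ge0|rewrite gerBl].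
Qed.
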